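(* Let $Q$ be a string of length $u$ over an alphabet $\Sigma$, compressed using the ZL78 scheme into a compressed string $Z$ of length $n$, let $P$ be a pattern string of length $m$, and let $k$ be an error threshold. Let $t(m,u',k)$ and $s(m,u',k)$ denote the time and space used by some algorithm solving the (uncompressed) approximate string matching problem with error threshold $k$ for a pattern of length $m$ and a text of length $u'$, where this algorithm reports its matches in sorted order. Then, given $Z$, $P$, and a parameter $\tau \geq 1$, all approximate occurrences of $P$ in $Q$ with at most $k$ errors (i.e. the set $\Gamma(P,Q)$) can be found in $O(n(\tau + m + t(m, 2m+2k,k)) + \mathit{occ})$ expected time and $O(n/\tau + m + s(m,2m+2k,k) + \mathit{occ})$ space, where $\mathit{occ} = |\Gamma(P,Q)|$ is the number of matches.
   Context: Computation model: unit-cost word RAM; the expectation comes from randomized hashing. A ZL78 compressed string is a sequence $Z = z_1\cdots z_n = (r_1,\alpha_1)\cdots(r_n,\alpha_n)$ with $r_i \in \{0,\dots,i-1\}$ and $\alpha_i\in\Sigma$, together with an implicit element $z_0$ with $\mathrm{phrase}(z_0)=\epsilon$ (the empty string). The phrase of $z_i$ is $\mathrm{phrase}(z_i) = \mathrm{phrase}(z_{r_i})\cdot \alpha_i$ (so it is $\alpha_i$ if $r_i=0$), and $Z$ represents the string $\mathrm{phrase}(z_1)\cdots\mathrm{phrase}(z_n)$. ZL78 compression of $Q$ produces such a $Z$ by greedily parsing $Q$ left to right, each new phrase being the longest prefix of the remaining text that is an existing phrase, extended by the next character. The edit distance $\gamma(A,B)$ is the minimum number of single-character insertions, deletions and substitutions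 needed to transform $A$ into $B$. For strings $A,S$, a position $j\in[1,|S|]$ is a match (with at most $k$ errors) of $A$ in $S$ if there is $i\in[1,j]$ with $\gamma(A,S[i,j])\le k$, where $S[i,j]$ is the substring of $S$ from position $i$ to $j$; $\Gamma(A,S)$ denotes the set of all such matches. The approximate string matching problem asks for $\Gamma(P,Q)$. *)

(* Defs.v *)
From mathcomp Require Import all_boot all_order all_algebra.
From mathcomp Require Import boolp.

Set Implicit Arguments.
Unset Strict Implicit.
Unset Printing Implicit Defensive.

Import Order.TTheory GRing.Theory Num.Theory.

(** Characters are identified with their machine codes, so a string
    is a [seq nat] and an alphabet, finite or not, is a [pred nat]. *)

Inductive edit1 : seq nat -> seq nat -> Prop :=
| Insertion u v a : edit1 (u ++ v) (u ++ a :: v)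
| Deletion u v a : edit1 (u ++ a :: v) (u ++ v)
| Substitution u v a b : edit1 (u ++ a :: v) (u ++ b :: v).

Fixpoint edits (d : nat) (A B : seq nat) : Prop :=
  if d is d'.+1 then exists C, edit1 A C /\ edits d' C B else A = B.

Lemma edits_trans d1 d2 A B C : edits d1 A B -> edits d2 B C -> edits (d1 + d2) A C.
Proof.
elim: d1 A => [|d1 IH] A /=; first by move=> ->.
by case=> D [AD DB] BC; exists D; split=> //; apply: IH.
Qed.

Lemma edits_ex A B : exists d, `[< edits d A B >].
Proof.
have del : edits (size A) A [::].
  elim: A => //= a A IH; exists A; split=> //.
  exact: (@Deletion [::] A a).
have ins : edits (size B) [::] B.
  elim/last_ind: B => // B b IH; rewrite size_rcons -addn1.
  apply: edits_trans IH _; exists (rcons B b); split=> //.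
  by rewrite -cats1 -{1}[B]cats0; apply: Insertion.
by exists (size A + size B); apply/asboolP; apply: edits_trans del ins.
Qed.

Definition edit_distance (A B : seq nat) : nat := ex_minn (edits_ex A B).

(** [S[i, j]], with positions counted from 1 and both ends included. *)
Definition substring (S : seq nat) (i j : nat) : seq nat :=
  take (j - i).+1 (drop i.-1 S).

Definition matches (k : nat) (A S : seq nat) : seq nat :=
  [seq j <- iota 1 (size S) |
     has (fun i => edit_distance A (substring S i j) <= k) (iota 1 j)].

(** The element [z_i = (r_i, alpha_i)] is the entry of index [i.-1]. *)
Definition zl_string := seq (nat * nat).

(** [phrase z_0, ..., phrase z_n]; the phrase of [z_0] is empty. *)
Definition phrases (Z : zl_string) : seq (seq nat) :=
  foldl (fun ps z => rcons ps (rcons (nth [::] ps z.1) z.2)) [:: [::]] Z.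

Definition phrase (Z : zl_string) (i : nat) : seq nat := nth [::] (phrases Z) i.

Definition reference (Z : zl_string) (i : nat) : nat := (nth (0, 0) Z i.-1).1.

Definition decompress (Z : zl_string) : seq nat := flatten (phrases Z).

(** The part of the text that is still to be parsed when [z_i] is produced. *)
Definition remaining (Z : zl_string) (i : nat) : seq nat :=
  flatten (drop i (phrases Z)).

(** A phrase [X] is a candidate for extension by the next character only if there
    is a next character. This matters for [z_n] alone: when all that remains of the
    text is an existing phrase, [z_n] repeats that phrase. *)
Definition proper_prefix (X Y : seq nat) : bool := prefix X Y && (size X < size Y).

Definition zl78 (Q : seq nat) (Z : zl_string) : Prop :=
  decompress Z = Q /\
  forall i, 0 < i <= size Z ->
    reference Z i < i /\
    forall j, j < i -> proper_prefix (phrase Z j) (remaining Z i) ->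
      size (phrase Z j) <= size (phrase Z (reference Z i)).

(** The machine is a randomized unit-cost word RAM. Words are the naturals below
    [2 ^ w]. The machine has registers, of which a program names finitely many, a
    working memory addressed by words, a read-only random-access input and a
    write-only output. Programs are structured, and every command executed,
    including the evaluation of a test, costs one unit. *)

Inductive binop :=
| Add | Minus | Mul | Div | Mod | And | Or | Xor | Shl | Shr | Ltn | Eqn.

Definition binop_eval (w : nat) (o : binop) (x y : nat) : nat :=
  match o with
  | Add => x + y
  | Minus => x + 2 ^ w - y
  | Mul => x * y
  | Div => x %/ y
  | Mod => x %% y
  | And => Nat.land x y
  | Or  => Nat.lor x y
  | Xor => Nat.lxor x y
  | Shl => x * 2 ^ y
  | Shr => x %/ 2 ^ y
  | Ltn => x < y
  | Eqn => x == y
  end %% 2 ^ w.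

Inductive cmd :=
| Skip
| Const (x v : nat)
| Op (x : nat) (o : binop) (y z : nat)
| Peek (x y : nat)
| Poke (x y : nat)
| Read (x y : nat)
| Emit (x : nat)
| Rand (x : nat)
| Seq (c1 c2 : cmd)
| If (x : nat) (c1 c2 : cmd)
| While (x : nat) (c : cmd).

(** [cont] is the stack of commands still to be executed. [peak] is the number of
    cells of the shortest initial segment of the memory that contains all cells read
    or written so far. *)
Record state := State {
  cont : seq cmd;
  reg  : nat -> nat;
  mem  : nat -> nat;
  peak : nat;
  out  : seq nat
}.

Definition upd (f : nat -> nat) (x v : nat) : nat -> nat :=
  fun y => if y == x then v else f y.

(** The equally likely successors of a state; there are none iff it has halted. *)
Definition next (w : nat) (inp : seq nat) (st : state) : seq state :=
  let: State ks r m p o := st in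
  match ks with
  | [::] => [::]
  | c :: ks =>
    match c with
    | Skip => [:: State ks r m p o]
    | Const x v => [:: State ks (upd r x (v %% 2 ^ w)) m p o]
    | Op x b y z => [:: State ks (upd r x (binop_eval w b (r y) (r z))) m p o]
    | Peek x y => [:: State ks (upd r x (m (r y))) m (maxn p (r y).+1) o]
    | Poke x y => [:: State ks r (upd m (r x) (r y)) (maxn p (r x).+1) o]
    | Read x y => [:: State ks (upd r x (nth 0 inp (r y) %% 2 ^ w)) m p o]
    | Emit x => [:: State ks r m p (rcons o (r x))]
    | Rand x => [seq State ks (upd r x v) m p o | v <- iota 0 (2 ^ w)]
    | Seq c1 c2 => [:: State [:: c1, c2 & ks] r m p o]
    | If x c1 c2 => [:: State ((if r x != 0 then c1 else c2) :: ks) r m p o]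
    | While x c1 =>
        [:: State (if r x != 0 then [:: c1, While x c1 & ks] else ks) r m p o]
    end
  end.

Inductive reachable (w : nat) (inp : seq nat) (st0 : state) : state -> Prop :=
| Reach0 : reachable w inp st0 st0
| ReachS st i : reachable w inp st0 st -> i < size (next w inp st) ->
    reachable w inp st0 (nth st (next w inp st) i).

(** The expectation of [min(T, fuel)], [T] being the running time from [st]. *)
Fixpoint truncated_time (w : nat) (inp : seq nat) (fuel : nat) (st : state) : rat :=
  if fuel is fuel'.+1 then
    let succ := next w inp st in
    if succ is [::] then 0%R
    else (1 + (\sum_(st' <- succ) truncated_time w inp fuel' st') / (size succ)%:R)%R
  else 0%R.

(** Neither the registers nor the memory are initialized. *)
Definition initial (w : nat) (c : cmd) (st : state) : Prop :=
  [/\ cont st = [:: c], forall x, reg st x < 2 ^ w, forall a, mem st a < 2 ^ w,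
      peak st = 0 & out st = [::]].

(** On input [inp], [c] uses at most [S] cells of working memory and outputs a
    sequence satisfying [post], both with certainty, in expected time at most [T]:
    by monotone convergence, [E(time)] is the supremum of the [E(min(time, fuel))].
    In particular, [c] halts almost surely. *)
Definition runs (w : nat) (c : cmd) (inp : seq nat) (T S : rat)
    (post : seq nat -> Prop) : Prop :=
  forall st0, initial w c st0 ->
    [/\ forall fuel, (truncated_time w inp fuel st0 <= T)%R,
        forall st, reachable w inp st0 st -> ((peak st)%:R <= S)%R
      & forall st, reachable w inp st0 st -> cont st = [::] -> post (out st)].

(** Words have at least [e.+1 * log N] bits, where [N] accounts for the length of the
    input, the numbers in it, and the memory [s] of the uncompressed matcher. *)
Definition wide (e w : nat) (inp : seq nat) (s : nat) : bool :=
  (2 + size inp + \max_(x <- inp) x + s) ^ e.+1 <= 2 ^ w.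

Definition text_input (k : nat) (P S : seq nat) : seq nat :=
  [:: size P; size S; k] ++ P ++ S.

Definition zl78_input (k tau : nat) (P : seq nat) (Z : zl_string) : seq nat :=
  [:: size P; size Z; k; tau] ++ P ++ flatten [seq [:: z.1; z.2] | z <- Z].

Definition solves_matching (Sigma : pred nat) (A : cmd) (e : nat)
    (t s : nat -> nat -> nat -> nat) : Prop :=
  forall (w k : nat) (P S : seq nat), all Sigma P -> all Sigma S ->
    let m := size P in let u := size S in
    wide e w (text_input k P S) (s m u k) ->
    runs w A (text_input k P S) (t m u k)%:R (s m u k)%:R
      (fun o => sorted leq o && perm_eq o (matches k P S)).

(* Main.v *)
From mathcomp Require Import all_boot all_order all_algebra.
From mathcomp Require Import boolp zify ring lra.
Require Import Defs.

(** Let [h = m + k]. Whether a position is a match depends on the last [h] letters up to it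
    only. Hence the matches among the first [h] positions of a phrase, and a match at its last
    position, are found by running the given matcher on the last [2 * h] letters of the text
    up to there. Any other match in a phrase depends on letters of that phrase only, so it is a
    translate of a match at the end of a shorter phrase on the path to the root of the trie.
    The nodes whose phrase is longer than [h] and ends with a match are recorded, each with a
    link to the nearest recorded ancestor; distinct records come from distinct matches, so
    there are at most [occ] of them.

    The depth of an element, its ancestor at depth [h] and its nearest recorded ancestor have
    to be found in memory [O(n / tau)]. The elements are therefore processed in blocks of
    about [n / tau]. All elements of a block climb to the root together, passing the ranges of
    [n / tau] consecutive indices from the last to the first: one ascending sweep over a
    range tabulates, for each of its nodes, the first ancestor below the range and what is
    met on the way there. This takes time [O(n)] per block. No hashing is needed: the only
    randomness is that of the given matcher.

    If [k >= m] and [k > 0] then every position is a match, so that [n <= occ] and the depths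
    of all nodes may be stored. *)

Set Implicit Arguments.
Unset Strict Implicit.
Unset Printing Implicit Defensive.

Import Order.TTheory GRing.Theory Num.Theory.

(** * A command language with a simulation primitive *)

(** The matcher is an arbitrary randomized program known only through its contract, and nothing is
    known about [t] and [s] as functions. It is therefore run only on texts of exactly [2 * h]
    letters, shorter ones being padded: [h] candidate positions, and the [h] letters before them on
    which they may depend. Its code is relocated into the host program, its registers and memory
    interleaved with those of the host, its input and output redirected. As its running time is
    bounded in expectation only, counting steps along one execution is not enough: budgets are time
    credits bounding truncated expectations, and a simulated run is paid for by a potential
    proportional to the expected time it still needs. The obstacle in a climb is that distances are
    counted from [z_i], whereas the ancestor sought has a given depth, and depths are unknown until
    the root is reached; hence anchors are left behind on the way. The case [k >= m] is set apart
    because [k < m] gives [h <= 2 * m], which makes the cost [n * h] of preparing the windows part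
    of [n * m]. *)

Section Safety.

Variables (w : nat) (inp : seq nat) (cap : nat) (post : seq nat -> Prop).

(** Indexing by fuel rather than by reachability lets the certain guarantees be proved in the same
    induction as the bound on the truncated expectation, without any termination argument. *)
Fixpoint ok (f : nat) (st : state) : Prop :=
  [/\ peak st <= cap, cont st = [::] -> post (out st) &
      if f is f'.+1 then
        forall i, i < size (next w inp st) -> ok f' (nth st (next w inp st) i)
      else True].

Definition safe (f : nat) (st : state) (b : rat) : Prop :=
  ok f st /\ (truncated_time w inp f st <= b)%R.

Lemma truncated_timeS f st : truncated_time w inp f.+1 st =
  (if next w inp st is [::] then 0
   else 1 + (\sum_(st' <- next w inp st) truncated_time w inp f st') /
            (size (next w inp st))%:R)%R.
Proof. by []. Qed.

Lemma truncated_time_rand f x ks r m p o :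
  truncated_time w inp f.+1 (State (Rand x :: ks) r m p o) =
  (1 + (\sum_(v <- iota 0 (2 ^ w)) truncated_time w inp f (State ks (upd r x v) m p o)) /
       (2 ^ w)%:R)%R.
Proof.
rewrite truncated_timeS /= size_map size_iota big_map.
by have: 0 < 2 ^ w by [rewrite expn_gt0]; case: (2 ^ w).
Qed.

Lemma truncated_time_ge0 f st : (0 <= truncated_time w inp f st)%R.
Proof.
elim: f st => //= f IH st; case: (next w inp st) => [//|s l].
by rewrite addr_ge0 // divr_ge0 // sumr_ge0.
Qed.

Lemma truncated_time_leS f st :
  (truncated_time w inp f st <= truncated_time w inp f.+1 st)%R.
Proof.
elim: f st => [|f IH] st; first exact: truncated_time_ge0.
rewrite [X in (_ <= X)%R]/= /=; case: (next w inp st) => [//|s l].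
rewrite lerD2l ler_pM2r ?invr_gt0 ?ltr0n //.
by apply: ler_sum => s' _; exact: IH.
Qed.

Lemma truncated_time_le f g st : f <= g ->
  (truncated_time w inp f st <= truncated_time w inp g st)%R.
Proof.
by move/subnK<-; elim: (g - f) => // d /le_trans; apply; exact: truncated_time_leS.
Qed.

Lemma reachable_ok st0 st : reachable w inp st0 st ->
  (forall f, ok f st0) -> forall f, ok f st.
Proof.
elim=> // {}st i _ IH ilt ok0 f.
by have /= [_ _] := IH ok0 f.+1; apply.
Qed.

Lemma safe_runs c (T S : rat) :
  (forall f st0, initial w c st0 -> safe f st0 T) ->
  (cap%:R <= S)%R -> runs w c inp T S post.
Proof.
move=> H leS st0 ini; split=> [f|st rst|st rst].
- by case: (H f st0 ini).
- have /= [ple _ _] := reachable_ok rst (fun f => (H f st0 ini).1) 0.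
  by apply: le_trans leS; rewrite ler_nat.
- by have /= [_ ? _] := reachable_ok rst (fun f => (H f st0 ini).1) 0.
Qed.

Lemma safe_weaken f st b b' : (b <= b')%R -> safe f st b -> safe f st b'.
Proof. by move=> bb' [o t]; split=> //; apply: le_trans bb'. Qed.

(** The premise speaks of smaller fuel only, which is what makes strong induction on the fuel
    available for loops and simulated runs. At fuel 0 nothing has been spent, hence the condition
    that [b] is nonnegative. *)
Lemma safe_step f c ks r m p o st1 b :
  next w inp (State (c :: ks) r m p o) = [:: st1] -> p <= cap -> (0 <= b)%R ->
  (forall f', f' < f -> safe f' st1 b) ->
  safe f (State (c :: ks) r m p o) (1 + b).
Proof.
move=> E ple b0; case: f => [_|f /(_ f (leqnn _)) [o1 t1]].
  by split=> //=; rewrite addr_ge0.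
split; first by split=> // i; rewrite E; case: i.
by rewrite truncated_timeS E big_seq1 /= divr1 lerD2l.
Qed.

End Safety.

(** Expressions and structured commands over variables and sixteen arrays. The cell [x] of
    the array [al] lies at address [16 * x + al], so arrays whose lengths are not known in
    advance can grow side by side. Variable [x] is register [3 * x + 1]; registers [3 * x]
    are temporaries and registers [3 * x + 2] belong to a simulated program. *)
Inductive expr :=
| EVar (x : nat)
| ECst (v : nat)
| EBin (o : binop) (a b : expr)
| ELd (al : nat) (e : expr)
| ERd (e : expr).

Inductive hcmd :=
| HSkip
| HAsg (x : nat) (e : expr)
| HSto (al : nat) (e1 e2 : expr)
| HEmit (e : expr)
| HSeq (c1 c2 : hcmd)
| HIf (e : expr) (c1 c2 : hcmd)
| HWhile (e : expr) (c : hcmd)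
| HSim (rd cb : hcmd).

Record hstate := HState {
  vars : nat -> nat;
  arrs : nat -> nat -> nat;
  outs : seq nat;
  aregs : nat -> nat
}.

Definition setv (st : hstate) (x v : nat) : hstate :=
  HState (fun y => if Nat.eqb y x then v else vars st y) (arrs st) (outs st) (aregs st).

Definition seta (st : hstate) (al i v : nat) : hstate :=
  HState (vars st)
    (fun be => if Nat.eqb be al then fun j => if j == i then v else arrs st al j
               else arrs st be) (outs st) (aregs st).

Definition seto (st : hstate) (v : nat) : hstate :=
  HState (vars st) (arrs st) (rcons (outs st) v) (aregs st).

Definition seta_sim (st : hstate) (r m : nat -> nat) : hstate :=
  HState (vars st) (fun be => if Nat.eqb be 0 then m else arrs st be) (outs st) r.

Definition same_sim (st st' : hstate) : Prop :=
  aregs st' = aregs st /\ arrs st' 0 = arrs st 0.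

Definition sem (o : binop) (x y : nat) : nat :=
  match o with
  | Add => x + y | Minus => x - y | Mul => x * y | Div => x %/ y
  | Ltn => x < y | Eqn => x == y | _ => 0
  end.

(** Conditions under which the machine operation, computed modulo [W], agrees with the arithmetic of
    [sem]. Subtraction would wrap around for [x < y]. *)
Definition exact_op (W : nat) (o : binop) (x y : nat) : Prop :=
  match o with
  | Add => x + y < W
  | Minus => y <= x
  | Mul => x * y < W
  | Div | Ltn | Eqn => True
  | _ => False
  end.

Fixpoint ecost (e : expr) : nat :=
  match e with
  | EVar _ | ECst _ => 1
  | EBin _ a b => ecost a + ecost b + 3
  | ELd _ a => ecost a + 10
  | ERd a => ecost a + 2
  end.

(** Addresses of the variables and the array through which a simulated program
    communicates. *)
Notation sim_val := 0.
Notation sim_adr := 1.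
Notation sim_arr := 0.

Section Evaluation.

Variables (W : nat) (inp : seq nat) (cap : nat).

Fixpoint ev (st : hstate) (e : expr) : nat :=
  match e with
  | EVar x => vars st x
  | ECst v => v
  | EBin o a b => sem o (ev st a) (ev st b)
  | ELd al a => arrs st al (ev st a)
  | ERd a => nth 0 inp (ev st a)
  end.

Fixpoint es (st : hstate) (e : expr) : Prop :=
  match e with
  | EVar x => True
  | ECst v => v < W
  | EBin o a b =>
    [/\ es st a, es st b & exact_op W o (ev st a) (ev st b)]
  | ELd al a => [/\ al < 16, es st a & ev st a < cap]
  | ERd a => es st a
  end.

End Evaluation.

(** The value is left in temporary [t]; higher temporaries may be overwritten, lower ones are
    preserved, so the first operand of a binary operation survives the evaluation of the second.
    [Or] of a register with itself serves as a move. *)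
Fixpoint cexp (e : expr) (t : nat) : cmd :=
  match e with
  | EVar x => Op (3 * t) Or (3 * x + 1) (3 * x + 1)
  | ECst v => Const (3 * t) v
  | EBin o a b =>
    Seq (cexp a t) (Seq (cexp b t.+1) (Op (3 * t) o (3 * t) (3 * t.+1)))
  | ELd al a =>
    Seq (cexp a t) (Seq (Const (3 * t.+1) 16) (Seq (Op (3 * t) Mul (3 * t) (3 * t.+1))
      (Seq (Const (3 * t.+1) al) (Seq (Op (3 * t) Add (3 * t) (3 * t.+1))
        (Peek (3 * t) (3 * t))))))
  | ERd a => Seq (cexp a t) (Read (3 * t) (3 * t))
  end.

Definition casg x e := Seq (cexp e 0) (Op (3 * x + 1) Or 0 0).
Definition csto al e1 e2 :=
  Seq (cexp e1 0) (Seq (cexp e2 1)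
    (Seq (Const 6 16) (Seq (Op 0 Mul 0 6) (Seq (Const 6 al) (Seq (Op 0 Add 0 6)
      (Poke 0 3)))))).

(** Program [A] runs with its memory kept in the array [sim_arr]; [rd] replaces its
    accesses to the input and [cb] is called on each of its output values. *)
Fixpoint csim (rd cb : cmd) (A : cmd) : cmd :=
  match A with
  | Skip => Skip
  | Const x v => Const (3 * x + 2) v
  | Op x o y z => Op (3 * x + 2) o (3 * y + 2) (3 * z + 2)
  | Peek x y =>
    Seq (Op (3 * sim_adr + 1) Or (3 * y + 2) (3 * y + 2))
      (Seq (casg sim_val (ELd sim_arr (EVar sim_adr)))
        (Op (3 * x + 2) Or (3 * sim_val + 1) (3 * sim_val + 1)))
  | Poke x y =>
    Seq (Op (3 * sim_adr + 1) Or (3 * x + 2) (3 * x + 2))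
      (Seq (Op (3 * sim_val + 1) Or (3 * y + 2) (3 * y + 2))
        (csto sim_arr (EVar sim_adr) (EVar sim_val)))
  | Read x y =>
    Seq (Op (3 * sim_adr + 1) Or (3 * y + 2) (3 * y + 2))
      (Seq rd (Op (3 * x + 2) Or (3 * sim_val + 1) (3 * sim_val + 1)))
  | Emit x =>
    Seq (Op (3 * sim_val + 1) Or (3 * x + 2) (3 * x + 2)) cb
  | Rand x => Rand (3 * x + 2)
  | Seq c1 c2 => Seq (csim rd cb c1) (csim rd cb c2)
  | If x c1 c2 => If (3 * x + 2) (csim rd cb c1) (csim rd cb c2)
  | While x c => While (3 * x + 2) (csim rd cb c)
  end.

Fixpoint comp (A : cmd) (c : hcmd) : cmd :=
  match c with
  | HSkip => Skip
  | HAsg x e => casg x e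
  | HSto al e1 e2 => csto al e1 e2
  | HEmit e => Seq (cexp e 0) (Emit 0)
  | HSeq c1 c2 => Seq (comp A c1) (comp A c2)
  | HIf e c1 c2 => Seq (cexp e 0) (If 0 (comp A c1) (comp A c2))
  | HWhile e c => Seq (cexp e 0) (While 0 (Seq (comp A c) (cexp e 0)))
  | HSim rd cb => csim (comp A rd) (comp A cb) A
  end.

Section Wp.

Variables (W : nat) (inp : seq nat) (cap : nat).

Notation ev := (ev inp).
Notation es := (es W inp cap).

(** [runs w A ainp aT aS apost] is what is known of the simulated program. *)
Variables (ainp : seq nat -> Prop) (aT aS : nat).
Variable apost : seq nat -> seq nat -> Prop.

(** Weakest precondition with time credits: [b] bounds the expected running time, the
    continuation included. *)
Fixpoint wp (c : hcmd) (Q : hstate -> nat -> Prop) (st : hstate) (b : nat) : Prop :=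
  match c with
  | HSkip => 1 <= b /\ Q st (b - 1)
  | HAsg x e => [/\ es st e, ecost e + 2 <= b & Q (setv st x (ev st e)) (b - (ecost e + 2))]
  | HSto al e1 e2 =>
    [/\ [/\ al < 16, es st e1, es st e2 & ev st e1 < cap], ecost e1 + ecost e2 + 11 <= b
      & Q (seta st al (ev st e1) (ev st e2)) (b - (ecost e1 + ecost e2 + 11))]
  | HEmit e => [/\ es st e, ecost e + 2 <= b & Q (seto st (ev st e)) (b - (ecost e + 2))]
  | HSeq c1 c2 => 1 <= b /\ wp c1 (wp c2 Q) st (b - 1)
  | HIf e c1 c2 =>
    [/\ es st e, ecost e + 2 <= b
      & if ev st e != 0 then wp c1 Q st (b - (ecost e + 2))
        else wp c2 Q st (b - (ecost e + 2))]
  | HWhile e c =>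
    exists2 I : hstate -> nat -> Prop, I st b &
      forall st' b', I st' b' ->
        [/\ es st' e, ecost e + 3 <= b'
          & if ev st' e != 0 then wp c I st' (b' - (ecost e + 3))
            else Q st' (b' - (ecost e + 3))]
  | HSim rd cb =>
    exists S J C, [/\ ainp S /\ aS <= cap,
      [/\ J [::] st, (forall o st' r m, J o st' -> J o (seta_sim st' r m)),
          (forall o st' v, J o st' -> J o (setv st' sim_val v)) &
          (forall o st' v, J o st' -> J o (setv st' sim_adr v))],
      (forall o st', J o st' ->
         wp rd (fun st'' _ => [/\ J o st'', same_sim st' st''
                                & vars st'' sim_val = nth 0 S (vars st' sim_adr)])
           st' C),
      (forall o st', J o st' ->
         wp cb (fun st'' _ => J (rcons o (vars st' sim_val)) st'' /\ same_sim st' st'') st' C)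
      & (C + 40) * aT <= b /\
        forall o st', apost S o -> J o st' -> Q st' (b - (C + 40) * aT)]
  end.

End Wp.

(** * Correctness of the compilation *)

Section Soundness.

Variables (w : nat) (inp : seq nat) (cap : nat) (post : seq nat -> Prop).
Hypothesis cap_lt : 16 * cap < 2 ^ w.
Hypothesis w_gt : 16 < 2 ^ w.
Hypothesis inp_lt : forall i, nth 0 inp i < 2 ^ w.

Notation ev := (ev inp).
Notation es := (es (2 ^ w) inp cap).
Notation safe := (safe w inp (16 * cap) post).

(** Temporaries are only required to hold words. Sixteen interleaved arrays of at most [cap] cells
    each give the bound [16 * cap] on [peak]. *)
Definition rel (h : hstate) (r m : nat -> nat) (p : nat) (o : seq nat) : Prop :=
  [/\ [/\ forall x, r (3 * x + 1) = vars h x & forall x, r (3 * x + 2) = aregs h x],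
      forall al x, al < 16 -> m (16 * x + al) = arrs h al x,
      (forall x, r x < 2 ^ w), (forall a, m a < 2 ^ w) & p <= 16 * cap /\ o = outs h].

Lemma rel_tmp h r m p p' o t v : rel h r m p o -> v < 2 ^ w -> p' <= 16 * cap ->
  rel h (upd r (3 * t) v) m p' o.
Proof.
move=> [[h1 h2] h3 h4 h5 [h6 h7]] vlt plt; split=> //; last first.
- by move=> x; rewrite /upd; case: eqP.
- by split=> x; rewrite /upd; case: eqP => [|_ //]; lia.
Qed.

Lemma rel_var h r m p p' o x v : rel h r m p o -> v < 2 ^ w -> p' <= 16 * cap ->
  rel (setv h x v) (upd r (3 * x + 1) v) m p' o.
Proof.
move=> [[h1 h2] h3 h4 h5 [h6 h7]] vlt plt; split=> //; last first.
- by move=> y; rewrite /upd; case: eqP.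
- split=> y; rewrite /upd /=; last by case: eqP => [|_ //]; lia.
  by case: eqP => e; case: PeanoNat.Nat.eqb_spec => //; lia.
Qed.

Lemma ev_lt h e r m p o : es h e -> rel h r m p o -> ev h e < 2 ^ w.
Proof.
move=> + [[h1 _] h3 h4 h5 _]; elim: e => /=.
- by move=> x _; rewrite -h1.
- by [].
- move=> op a IHa b IHb [/IHa la /IHb lb]; case: op => //= H; try lia.
  + by apply: leq_ltn_trans la; rewrite leq_div.
- by move=> al e _ [ale _ _]; rewrite -h3.
- by [].
Qed.

Lemma binop_evalE op x y : x < 2 ^ w -> y < 2 ^ w ->
  exact_op (2 ^ w) op x y -> binop_eval w op x y = sem op x y.
Proof.
rewrite /binop_eval /sem; case: op => //= xlt ylt H; try by rewrite modn_small.
- by rewrite -addnBAC // modnDr modn_small // (leq_ltn_trans (leq_subr _ _)).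
- by rewrite modn_small // (leq_ltn_trans (leq_div _ _)).
- by rewrite modn_small //; lia.
- by rewrite modn_small //; lia.
Qed.

Lemma binop_eval_or x : x < 2 ^ w -> binop_eval w Or x x = x.
Proof. by move=> xlt; rewrite /binop_eval PeanoNat.Nat.lor_diag modn_small. Qed.

Lemma upd_same f x v : upd f x v x = v.
Proof. by rewrite /upd eqxx. Qed.

Lemma upd_other f x v y : y <> x -> upd f x v y = f y.
Proof. by rewrite /upd; case: eqP. Qed.

Lemma relP h r m p o : rel h r m p o -> p <= 16 * cap.
Proof. by case=> _ _ _ _ []. Qed.

Lemma rel_reg h r m p o x : rel h r m p o -> r x < 2 ^ w.
Proof. by case. Qed.

Lemma ler01_rat : (0 <= 1 :> rat)%R. Proof. by []. Qed.
Lemma ler0n_rat (n : nat) : (0 <= n%:R :> rat)%R. Proof. exact: ler0n. Qed.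
Lemma addr_ge0_rat (x y : rat) : (0 <= x -> 0 <= y -> 0 <= x + y)%R.
Proof. exact: addr_ge0. Qed.

Ltac nonneg := match goal with
  | |- is_true (_ <= _ + _)%R => refine (addr_ge0_rat _ _); nonneg
  | |- is_true (_ <= 1)%R => exact ler01_rat
  | |- is_true (_ <= _%:R)%R => exact (ler0n_rat _)
  | _ => assumption
  | H : forall _, is_true (0 <= _)%R |- _ => exact (H _)
  end.

Ltac step := apply: safe_step;
  [ reflexivity | first [eapply relP; eassumption | lia] | nonneg | idtac ].

(** The address computation shared by loads and stores; [v < cap] and [16 * cap < 2 ^ w] exclude
    overflow. *)
Lemma addr_sound t t1 al v h r m p o f ks c (b : rat) : t < t1 -> al < 16 -> v < cap ->
  r (3 * t) = v -> rel h r m p o -> (0 <= b)%R ->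
  (forall f' r', f' < f -> rel h r' m p o -> r' (3 * t) = 16 * v + al ->
     (forall t', t' <> t -> t' <> t1 -> r' (3 * t') = r (3 * t')) ->
       safe f' (State (c :: ks) r' m p o) b) ->
  safe f (State (Seq (Const (3 * t1) 16) (Seq (Op (3 * t) Mul (3 * t) (3 * t1))
      (Seq (Const (3 * t1) al) (Seq (Op (3 * t) Add (3 * t) (3 * t1)) c))) :: ks) r m p o)
    (1 + (1 + (1 + (1 + (1 + (1 + (1 + (1 + b))))))))%R.
Proof.
move=> t1t ale vlt rt R b0 H.
have ne : 3 * t <> 3 * t1 by lia.
step => f1 lf1; step => f2 lf2.
rewrite modn_small //.
have R2 := rel_tmp t1 R w_gt (relP R).
step => f3 lf3; step => f4 lf4.
rewrite upd_same upd_other // rt.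
rewrite binop_evalE; [|lia|lia|rewrite /=; lia].
have R4 : rel h (upd (upd r (3 * t1) 16) (3 * t) (v * 16)) m p o.
  by apply: (rel_tmp _ R2 _ (relP R)); lia.
rewrite /=.
step => f5 lf5; step => f6 lf6.
rewrite modn_small; last lia.
have R6 : rel h (upd (upd (upd r (3 * t1) 16) (3 * t) (v * 16)) (3 * t1) al) m p o.
  by apply: (rel_tmp _ R4 _ (relP R)); lia.
step => f7 lf7; step => f8 lf8.
rewrite [X in binop_eval _ _ X]upd_other // !upd_same.
rewrite binop_evalE; [|lia|lia|rewrite /=; lia].
apply: H; first lia.
- by apply: (rel_tmp _ R6 _ (relP R)); rewrite /=; lia.
- by rewrite upd_same /=; lia.
- by move=> t' d1 d2; rewrite !upd_other //; lia.
Qed.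

Lemma cexp_sound e : forall t h r m p o f ks (b : rat), es h e -> rel h r m p o -> (0 <= b)%R ->
  (forall f' r' p', f' <= f -> rel h r' m p' o -> r' (3 * t) = ev h e ->
     (forall t', t' < t -> r' (3 * t') = r (3 * t')) ->
     safe f' (State ks r' m p' o) b) ->
  safe f (State (cexp e t :: ks) r m p o) ((ecost e)%:R + b)%R.
Proof.
elim: e => [x|v|op a IHa b IHb|al a IH|a IH] t h r m p o f ks bud.
- move=> /= _ R b0 H; step => f' lf.
  rewrite binop_eval_or; last exact: rel_reg R.
  apply: H; first exact: ltnW.
  + by apply: (rel_tmp _ R); [exact: rel_reg R | exact: relP R].
  + by rewrite upd_same; case: R => [[->]].
  + by move=> t' lt'; rewrite upd_other //; lia.
- move=> /= vlt R b0 H; step => f' lf; rewrite modn_small //.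
  apply: H; first exact: ltnW.
  + by apply: (rel_tmp _ R) => //; exact: relP R.
  + by rewrite upd_same.
  + by move=> t' lt'; rewrite upd_other //; lia.
- move=> /= [sa sb sop] R b0 H.
  have -> : ((ecost a + ecost b + 3)%:R + bud = 1 + ((ecost a)%:R + (1 + ((ecost b)%:R + (1 + bud)))))%R.
    by rewrite !natrD; ring.
  step => f1 lf1.
  apply: (IHa _ h) => //; first nonneg.
  move=> f2 r2 p2 lf2 R2 r2t r2o; step => f3 lf3.
  apply: (IHb _ h) => //; first nonneg.
  move=> f4 r4 p4 lf4 R4 r4t r4o; step => f5 lf5.
  have E : binop_eval w op (r4 (3 * t)) (r4 (3 * t.+1)) = sem op (ev h a) (ev h b).
    by rewrite r4t r4o ?leqnn // r2t binop_evalE //; apply: ev_lt; eassumption.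
  rewrite E; apply: H; first lia.
  + apply: (rel_tmp _ R4); last exact: relP R4.
    by apply: (@ev_lt _ (EBin op a b) r m p o).
  + by rewrite upd_same.
  + by move=> t' lt'; rewrite upd_other ?r4o ?r2o //; lia.
- move=> /= [ale sa alt] R b0 H.
  have -> : ((ecost a + 10)%:R + bud = 1 + ((ecost a)%:R + (1 + (1 + (1 + (1 + (1 + (1 + (1 + (1 + (1 + bud)))))))))))%R.
    by rewrite !natrD; ring.
  step => f1 lf1.
  apply: (IH _ h) => //; first nonneg.
  move=> f2 r2 p2 lf2 R2 r2t r2o.
  have H3 : forall f' r', f' < f2 -> rel h r' m p2 o -> r' (3 * t) = 16 * ev h a + al ->
     (forall t', t' <> t -> t' <> t.+1 -> r' (3 * t') = r2 (3 * t')) ->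
     safe f' (State (Peek (3 * t) (3 * t) :: ks) r' m p2 o) (1 + bud).
    move=> f3 r3 lf3 R3 r3t r3o; step => f4 lf4.
    rewrite r3t; have [_ h3 _ h5 _] := R3.
    apply: H; first lia.
    + by apply: (rel_tmp _ R3) => //; rewrite geq_max (relP R2) /=; lia.
    + by rewrite upd_same h3.
    + by move=> t' lt'; rewrite upd_other ?r3o ?r2o //; lia.
  by apply: (addr_sound _ ale alt r2t R2 _ H3) => //; apply: addr_ge0.
- move=> /= sa R b0 H.
  have -> : ((ecost a + 2)%:R + bud = 1 + ((ecost a)%:R + (1 + bud)))%R.
    by rewrite !natrD; ring.
  step => f1 lf1.
  apply: (IH _ h) => //; first nonneg.
  move=> f2 r2 p2 lf2 R2 r2t r2o; step => f3 lf3.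
  rewrite modn_small //; apply: H; first lia.
  + by apply: (rel_tmp _ R2) => //; exact: relP R2.
  + by rewrite upd_same r2t.
  + by move=> t' lt'; rewrite upd_other ?r2o //; lia.
Qed.

Lemma casg_sound x e h r m p o f ks (b : rat) : es h e -> rel h r m p o -> (0 <= b)%R ->
  (forall f' r' p', f' < f -> rel (setv h x (ev h e)) r' m p' o ->
     safe f' (State ks r' m p' o) b) ->
  safe f (State (casg x e :: ks) r m p o) ((ecost e + 2)%:R + b)%R.
Proof.
move=> s R b0 H.
have -> : ((ecost e + 2)%:R + b = 1 + ((ecost e)%:R + (1 + b)))%R.
  by rewrite !natrD; ring.
step => f1 lf1; apply: (@cexp_sound e 0 h) => //; first nonneg.
move=> f2 r2 p2 lf2 R2 r2t _; step => f3 lf3.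
rewrite binop_eval_or; last exact: rel_reg R2.
rewrite -[0]/(3 * 0) r2t; apply: H; first lia.
by apply: (rel_var _ R2 _ (relP R2)); apply: ev_lt; eassumption.
Qed.

Lemma csto_sound al e1 e2 h r m p o f ks (b : rat) : al < 16 -> es h e1 -> es h e2 ->
  ev h e1 < cap -> rel h r m p o -> (0 <= b)%R ->
  (forall f' r' m' p', f' < f -> rel (seta h al (ev h e1) (ev h e2)) r' m' p' o ->
     safe f' (State ks r' m' p' o) b) ->
  safe f (State (csto al e1 e2 :: ks) r m p o) ((ecost e1 + ecost e2 + 11)%:R + b)%R.
Proof.
move=> ale s1 s2 lt1 R b0 H.
have -> : ((ecost e1 + ecost e2 + 11)%:R + b = 1 + ((ecost e1)%:R + (1 + ((ecost e2)%:R +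
    (1 + (1 + (1 + (1 + (1 + (1 + (1 + (1 + (1 + b)))))))))))))%R.
  by rewrite !natrD; ring.
step => f1 lf1; apply: (@cexp_sound e1 0 h) => //; first nonneg.
move=> f2 r2 p2 lf2 R2 r2t _; step => f3 lf3.
apply: (@cexp_sound e2 1 h) => //; first nonneg.
move=> f4 r4 p4 lf4 R4 r4t r4o.
have r40 : r4 (3 * 0) = ev h e1 by rewrite r4o.
apply: (@addr_sound 0 2 al (ev h e1) h _ _ _ _ _ _ _ _ _ ale lt1 r40 R4) => //; first by apply: addr_ge0.
move=> f5 r5 lf5 R5 r5t r5o; step => f6 lf6.
have -> : r5 0 = 16 * ev h e1 + al by rewrite -[0]/(3 * 0).
have -> : r5 3 = ev h e2 by rewrite -[3]/(3 * 1) r5o // r4t.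
apply: H; first lia.
have [h1 h3 h4 h5 [h6 h7]] := R5.
split=> //; last by split=> //; rewrite geq_max h6 /=; lia.
- move=> be x lb; rewrite /= /upd.
  case: PeanoNat.Nat.eqb_spec => [->|ne].
    have -> : (16 * x + al == 16 * ev h e1 + al) = (x == ev h e1) by apply/eqP/eqP; lia.
    by case: eqP => // _; apply: h3.
  by case: eqP => [|_]; [lia | apply: h3].
- by move=> a; rewrite /upd; case: eqP => // _; apply: ev_lt s2 R.
Qed.

Variables (A : cmd) (ainp : seq nat -> Prop) (aT aS : nat).
Variable apost : seq nat -> seq nat -> Prop.
Hypothesis HA : forall S, ainp S ->
  runs w A S aT%:R aS%:R (apost S) /\ forall i, nth 0 S i < 2 ^ w.

Notation wp := (wp (2 ^ w) inp cap ainp aT aS apost).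

(** Continuation-passing form: [e] is the budget of [ks] alone, and the credits [b'] left over by
    [c] are handed on to it. Randomized commands can thus be composed without speaking of
    distributions over intermediate states. *)
Definition sound_cmd (c : hcmd) : Prop :=
  forall Q h b, wp c Q h b ->
  forall f ks (e : rat) r m p o, (0 <= e)%R -> rel h r m p o ->
  (forall f' h' b' r' m' p' o', f' <= f -> Q h' b' -> rel h' r' m' p' o' ->
     safe f' (State ks r' m' p' o') (b'%:R + e)%R) ->
  safe f (State (comp A c :: ks) r m p o) (b%:R + e)%R.

(** [simulates] equates functions whereas [rel] relates values pointwise; replacing the simulated
    components by pointwise equal ones bridges the gap. *)
Lemma rel_sim h r m p o : rel h r m p o ->
  rel (seta_sim h (fun x => r (3 * x + 2)) (fun x => m (16 * x))) r m p o.
Proof.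
move=> [[h1 h2] h3 h4 h5 h6]; split=> //= al x ale.
by case: PeanoNat.Nat.eqb_spec => [->|_]; [rewrite addn0 | exact: h3].
Qed.

Lemma rel_areg h r m p o x v : rel h r m p o -> v < 2 ^ w ->
  rel (seta_sim h (upd (aregs h) x v) (arrs h 0)) (upd r (3 * x + 2) v) m p o.
Proof.
move=> [[h1 h2] h3 h4 h5 [h6 h7]] vlt; split=> //=.
- split=> y; rewrite /upd; first by case: eqP => [|_ //]; lia.
  have -> : (3 * y + 2 == 3 * x + 2) = (y == x) by apply/eqP/eqP; lia.
  by case: eqP.
- move=> al y ale; case: PeanoNat.Nat.eqb_spec => [->|_]; exact: h3.
- by move=> y; rewrite /upd; case: eqP.
Qed.

Lemma rel_var' h r m p o x v : rel h r m p o -> v < 2 ^ w ->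
  rel (setv h x v) (upd r (3 * x + 1) v) m p o.
Proof. by move=> R vlt; apply: (rel_var _ R vlt); case: R => _ _ _ _ []. Qed.

(** * Running the matcher inside the host program *)

Section Simulation.

Variables (rd cb : hcmd) (S : seq nat) (J : seq nat -> hstate -> Prop) (C : nat).
Hypothesis rd_sound : sound_cmd rd.
Hypothesis cb_sound : sound_cmd cb.
Hypothesis AS : ainp S.
Hypothesis aS_cap : aS <= cap.
Hypothesis J_sim : forall o st r m, J o st -> J o (seta_sim st r m).
Hypothesis J_val : forall o st v, J o st -> J o (setv st sim_val v).
Hypothesis J_adr : forall o st v, J o st -> J o (setv st sim_adr v).
Hypothesis J_rd : forall o st, J o st ->
  wp rd (fun st' _ => [/\ J o st', same_sim st st'
                        & vars st' sim_val = nth 0 S (vars st sim_adr)]) st C.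
Hypothesis J_cb : forall o st, J o st ->
  wp cb (fun st' _ => J (rcons o (vars st sim_val)) st' /\ same_sim st st') st C.

Notation csim := (csim (comp A rd) (comp A cb)).
Notation tt := (truncated_time w S).

Definition simulates (stA : state) (h : hstate) : Prop :=
  [/\ J (out stA) h, aregs h = reg stA & arrs h 0 = mem stA].

(** The potential is [C + 40] times the expected remaining time of the simulated run, truncated at
    the fuel of the host. Every simulated command costs the host at least one step, so this fuel
    suffices, and at most [C + 40] steps, the amount by which the potential exceeds the average over
    the successors. Reachability of [stA] is carried along because the space and output guarantees
    of [A] are stated for reachable states. *)
Lemma sim_sound st0 ks (e : rat) : initial w A st0 -> (0 <= e)%R ->
  forall f stA h r m p o, reachable w S st0 stA ->
  rel h r m p o -> simulates stA h ->
  (forall f' o' h' r' m' p' o'', f' <= f -> rel h' r' m' p' o'' -> J o' h' -> apost S o' ->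
     safe f' (State ks r' m' p' o'') e) ->
  safe f (State (map csim (cont stA) ++ ks) r m p o) ((C + 40)%:R * tt f stA + e)%R.
Proof.
move=> ini e0 f; have [f0 le_f0] := ubnP f; elim: f0 f le_f0 => // f0 IH f le_f0.
move=> stA h r m p o rch R SR Hend.
have [HAr Slt] := HA AS; have [_ HApk HApo] := HAr st0 ini.
have D0 : (0 <= (C + 40)%:R :> rat)%R by [].
have tt0 g st : (0 <= tt g st)%R by exact: truncated_time_ge0.
case: stA => [[|c ksA] rA mA pA oA] in rch SR *.
  rewrite /=; apply: (safe_weaken (b := e)).
    by rewrite lerDr mulr_ge0.
  by apply: (Hend f oA h) => //; [case: SR | apply: (HApo _ rch)].
case: f => [|f] in le_f0 Hend *.
  by split=> //=; [split=> //; exact: relP R | rewrite mulr0 add0r].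
have IH1 : forall st1 f' h' r' m' p' o', f' <= f -> reachable w S st0 st1 ->
    rel h' r' m' p' o' -> simulates st1 h' ->
    safe f' (State (map csim (cont st1) ++ ks) r' m' p' o') ((C + 40)%:R * tt f st1 + e)%R.
  move=> st1 f' h' r' m' p' o' le_f' rch1 R1 SR1.
  apply: (safe_weaken (b := ((C + 40)%:R * tt f' st1 + e)%R)).
    by rewrite lerD2r ler_wpM2l //; exact: truncated_time_le.
  apply: (IH f' _ st1 h') => //; first lia.
  by move=> f'' *; apply: (Hend f''); eauto; lia.
case: SR => JA regA memA; rewrite /= in JA regA memA.
have rE x : r (3 * x + 2) = rA x by case: R => [[_ ->]] _ _ _ _; rewrite regA.
pose X st1 := ((C + 40)%:R * tt f st1 + e)%R.
have det st1 (B : rat) : next w S (State (c :: ksA) rA mA pA oA) = [:: st1] ->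
    (B <= (C + 40)%:R + X st1)%R ->
    (reachable w S st0 st1 -> safe f.+1 (State (csim c :: map csim ksA ++ ks) r m p o) B) ->
    safe f.+1 (State (map csim (c :: ksA) ++ ks) r m p o)
     ((C + 40)%:R * tt f.+1 (State (c :: ksA) rA mA pA oA) + e)%R.
  move=> E le_b H; rewrite truncated_timeS E big_seq1 /= divr1 mulrDr mulr1 -addrA.
  apply: safe_weaken le_b _; apply: H.
  by have := ReachS rch (i := 0); rewrite E; apply.
have X0 st1 : (0 <= X st1)%R by rewrite addr_ge0 // mulr_ge0.
have C0 : (0 <= C%:R :> rat)%R by exact: ler0n.
have CD : ((C + 40)%:R = C%:R + 40 :> rat)%R by rewrite natrD.
case: c => [|x v|x op y z|x y|x y|x y|x|x|c1 c2|x c1 c2|x c1] in rch det *.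
- refine (det _ (1 + X _)%R erefl _ _) => [|rch1]; first lra.
  step => f1 lf1.
  by apply: (IH1 _ _ h _ _ _ _ _ rch1).
- refine (det _ (1 + X _)%R erefl _ _) => [|rch1]; first lra.
  step => f1 lf1.
  apply: (IH1 _ _ _ _ _ _ _ _ rch1) => //.
    by apply: rel_areg R _; rewrite ltn_mod; lia.
  by split=> /=; [exact: J_sim | rewrite regA | rewrite memA].
- refine (det _ (1 + X _)%R erefl _ _) => [|rch1]; first lra.
  step => f1 lf1.
  apply: (IH1 _ _ _ _ _ _ _ _ rch1) => //.
    by apply: rel_areg R _; rewrite ltn_mod; lia.
  by split=> /=; [exact: J_sim | rewrite regA !rE | rewrite memA].
- refine (det _ (1 + (1 + (1 + (13%:R + (1 + X _)))))%R erefl _ _) => [|rch1]; first lra.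
  (* The successor counts the accessed cell in its [peak], so the space bound of [A] on that state
     bounds the address. *)
  have ltc : rA y < cap.
    by have := HApk _ rch1; rewrite ler_nat /= geq_max; lia.
  step => f1 lf1; step => f2 lf2; step => f3 lf3.
  rewrite binop_eval_or; last exact: rel_reg R.
  have R1 := rel_var' sim_adr R (rel_reg (3 * y + 2) R).
  apply: (casg_sound _ R1); rewrite /= ?rE //; first by rewrite addr_ge0.
  move=> f4 r4 p4 lf4 R4; step => f5 lf5.
  rewrite binop_eval_or; last exact: rel_reg R4.
  have v4 : r4 (3 * sim_val + 1) = mA (rA y).
    by have [[-> _] _ _ _ _] := R4; rewrite /= memA.
  rewrite v4; apply: (IH1 _ _ _ _ _ _ _ _ rch1); first lia.
    apply: (rel_areg _ R4); rewrite -v4; exact: rel_reg R4.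
  split=> //=; last by rewrite regA.
  by apply: J_sim; apply: J_val; apply: J_adr.
- refine (det _ (1 + (1 + (1 + (1 + (13%:R + X _)))))%R erefl _ _) => [|rch1]; first lra.
  have ltc : rA x < cap.
    by have := HApk _ rch1; rewrite ler_nat /= geq_max; lia.
  step => f1 lf1; step => f2 lf2; step => f3 lf3; step => f4 lf4.
  rewrite binop_eval_or; last exact: rel_reg R.
  have R1 := rel_var' sim_adr R (rel_reg (3 * x + 2) R).
  rewrite upd_other; last lia.
  rewrite binop_eval_or; last exact: rel_reg R.
  have R2 := rel_var' sim_val R1 (rel_reg (3 * y + 2) R).
  apply: (csto_sound (al := sim_arr) _ _ _ _ R2); rewrite /= ?rE //.
  move=> f5 r5 m5 p5 lf5 R5.
  apply: (IH1 _ _ _ _ _ _ _ _ rch1); [lia | exact: R5 |].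
  split=> /=; first by apply: J_sim; apply: J_val; apply: J_adr.
    exact: regA.
  by rewrite -memA.
- refine (det _ (1 + (1 + (1 + (C%:R + (1 + X _)))))%R erefl _ _) => [|rch1]; first lra.
  step => f1 lf1; step => f2 lf2; step => f3 lf3.
  rewrite binop_eval_or; last exact: rel_reg R.
  have R1 := rel_var' sim_adr R (rel_reg (3 * y + 2) R).
  apply: (rd_sound (J_rd (J_adr _ JA)) _ R1); first nonneg.
  move=> f4 h4 b4 r4 m4 p4 o4 lf4 [J4 [reg4 mem4] v4] R4.
  apply: (safe_weaken (b := (1 + X (State ksA (upd rA x (nth 0 S (rA y) %% 2 ^ w)) mA pA oA))%R)).
    by rewrite lerDr.
  step => f5 lf5.
  rewrite binop_eval_or; last exact: rel_reg R4.
  have w4 : r4 (3 * sim_val + 1) = nth 0 S (rA y) %% 2 ^ w.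
    by have [[-> _] _ _ _ _] := R4; rewrite v4 /= rE modn_small.
  rewrite w4; apply: (IH1 _ _ _ _ _ _ _ _ rch1); first lia.
    by apply: (rel_areg _ R4); rewrite ltn_mod; lia.
  split=> /=; first exact: J_sim.
    by rewrite reg4 /= regA.
  by rewrite mem4 /= memA.
- refine (det _ (1 + (1 + (C%:R + X _)))%R erefl _ _) => [|rch1]; first lra.
  step => f1 lf1; step => f2 lf2.
  rewrite binop_eval_or; last exact: rel_reg R.
  have R1 := rel_var' sim_val R (rel_reg (3 * x + 2) R).
  apply: (cb_sound (J_cb (J_val _ JA)) _ R1); first nonneg.
  move=> f4 h4 b4 r4 m4 p4 o4 lf4 [J4 [reg4 mem4]] R4.
  apply: (safe_weaken (b := X (State ksA rA mA pA (rcons oA (rA x))))).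
    by rewrite lerDr.
  apply: (IH1 _ _ h4 _ _ _ _ _ rch1) => //; first lia.
  by split=> /=; [move: J4; rewrite /= rE | rewrite reg4 | rewrite mem4].
- rewrite truncated_time_rand.
  split.
    split=> //; first exact: relP R.
    move=> i; rewrite size_map size_iota => ilt.
    rewrite (nth_map 0) ?size_iota // nth_iota // add0n.
    have rch1 := ReachS rch (i := i).
    rewrite /= size_map size_iota (nth_map 0) ?size_iota // nth_iota // add0n in rch1.
    apply: (IH1 _ _ _ _ _ _ _ _ (rch1 ilt) (rel_areg x R ilt) _).1 => //.
    by split=> /=; [exact: J_sim | rewrite regA | rewrite memA].
  rewrite [map _ _ ++ _]/= truncated_time_rand.
  have Wn0 : ((2 ^ w)%:R != 0 :> rat)%R by rewrite pnatr_eq0; lia.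
  (* For [Rand] the budget is checked on average only: the bounds for the single outcomes are summed
     and divided by [2 ^ w]. *)
  pose T i := tt f (State ksA (upd rA x i) mA pA oA).
  have le1 : (\sum_(i <- iota 0 (2 ^ w))
      truncated_time w inp f (State (map csim ksA ++ ks) (upd r (3 * x + 2) i) m p o)
      <= \sum_(i <- iota 0 (2 ^ w)) ((C + 40)%:R * T i + e))%R.
    rewrite big_seq [X in (_ <= X)%R]big_seq; apply: ler_sum => i.
    rewrite mem_iota /= add0n => ilt.
    have rch1 := ReachS rch (i := i).
    rewrite /= size_map size_iota (nth_map 0) ?size_iota // nth_iota // add0n in rch1.
    apply: (IH1 _ _ _ _ _ _ _ _ (rch1 ilt) (rel_areg x R ilt) _).2 => //.
    by split=> /=; [exact: J_sim | rewrite regA | rewrite memA].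
  have E1 : (\sum_(i <- iota 0 (2 ^ w)) ((C + 40)%:R * T i + e) =
     (C + 40)%:R * (\sum_(i <- iota 0 (2 ^ w)) T i) + (2 ^ w)%:R * e)%R.
    by rewrite big_split /= mulr_sumr big_const_seq count_predT size_iota iter_addr addr0 mulr_natl.
  rewrite E1 in le1; set sB := (\sum_(i <- _) _)%R in le1 *.
  rewrite -/(T _); set sA := (\sum_(i <- _) T i)%R in le1 *.
  have : (sB / (2 ^ w)%:R <= (C + 40)%:R * (sA / (2 ^ w)%:R) + e)%R.
    have -> : ((C + 40)%:R * (sA / (2 ^ w)%:R) + e = ((C + 40)%:R * sA + (2 ^ w)%:R * e) / (2 ^ w)%:R)%R.
      by field.
    by rewrite ler_pM2r // invr_gt0 ltr0n expn_gt0.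
  have : (1 <= (C + 40)%:R :> rat)%R by rewrite ler1n; lia.
  by rewrite mulrDr mulr1; set z := (_ * (sA / _))%R; lra.
- refine (det _ (1 + X _)%R erefl _ _) => [|rch1]; first lra.
  by step => f1 lf1; apply: (IH1 _ _ h _ _ _ _ _ rch1).
- refine (det _ (1 + X _)%R erefl _ _) => [|rch1]; first lra.
  step => f1 lf1; rewrite rE.
  by case: ifP rch1 => rx rch1; apply: (IH1 _ _ h _ _ _ _ _ rch1).
- refine (det _ (1 + X _)%R erefl _ _) => [|rch1]; first lra.
  step => f1 lf1; rewrite rE.
  by case: ifP rch1 => rx rch1; apply: (IH1 _ _ h _ _ _ _ _ rch1).
Qed.

End Simulation.

Lemma sound c : sound_cmd c.
Proof.
elim: c => [|x e|al e1 e2|e|c1 IH1 c2 IH2|e c1 IH1 c2 IH2|e c IH|rd IHrd cb IHcb] Q h b /=.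
- move=> [b1 HQ] f ks ep r m p o ep0 R H.
  have -> : (b%:R + ep = 1 + ((b - 1)%:R + ep))%R by rewrite natrB //; ring.
  by step => f' lf; apply: H HQ R; exact: ltnW.
- move=> [se le_b HQ] f ks ep r m p o ep0 R H.
  have -> : (b%:R + ep = (ecost e + 2)%:R + ((b - (ecost e + 2))%:R + ep))%R by rewrite natrB //; ring.
  apply: (casg_sound se R); first nonneg.
  by move=> f' r' p' lf R'; apply: H HQ R'; exact: ltnW.
- move=> [[ale s1 s2 lt1] le_b HQ] f ks ep r m p o ep0 R H.
  set k := _ + _ + 11 in le_b HQ.
  have -> : (b%:R + ep = k%:R + ((b - k)%:R + ep))%R by rewrite natrB //; ring.
  apply: (csto_sound ale s1 s2 lt1 R); first nonneg.
  by move=> f' r' m' p' lf R'; apply: H HQ R'; exact: ltnW.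
- move=> [se le_b HQ] f ks ep r m p o ep0 R H.
  have -> : (b%:R + ep = 1 + ((ecost e)%:R + (1 + ((b - (ecost e + 2))%:R + ep))))%R.
    by rewrite natrB // natrD; ring.
  step => f1 lf1; apply: (@cexp_sound e 0 h) => //; first nonneg.
  move=> f2 r2 p2 lf2 R2 r2t _; step => f3 lf3.
  apply: H HQ _; first lia.
  case: R2 => h1 h2 h3 h4 [h5 h6]; split=> //; split=> //=.
  by rewrite -h6 -[0]/(3 * 0) r2t.
- move=> [b1 HQ] f ks ep r m p o ep0 R H.
  have -> : (b%:R + ep = 1 + ((b - 1)%:R + ep))%R by rewrite natrB //; ring.
  step => f1 lf1; apply: (IH1 _ _ _ HQ _ _ _ _ _ _ _ ep0 R).
  move=> f2 h2 b2 r2 m2 p2 o2 lf2 HQ2 R2; apply: (IH2 _ _ _ HQ2 _ _ _ _ _ _ _ ep0 R2).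
  by move=> f3 *; apply: H; eauto; lia.
- move=> [se le_b HQ] f ks ep r m p o ep0 R H.
  have -> : (b%:R + ep = 1 + ((ecost e)%:R + (1 + ((b - (ecost e + 2))%:R + ep))))%R.
    by rewrite natrB // natrD; ring.
  step => f1 lf1; apply: (@cexp_sound e 0 h) => //; first nonneg.
  move=> f2 r2 p2 lf2 R2 r2t _; step => f3 lf3.
  rewrite -[0]/(3 * 0) r2t.
  case: ifP HQ => _ HQ; [apply: (IH1 _ _ _ HQ _ _ _ _ _ _ _ ep0 R2) | apply: (IH2 _ _ _ HQ _ _ _ _ _ _ _ ep0 R2)];
    by move=> f4 *; apply: H; eauto; lia.
- move=> [I I0 HI] f ks ep r m p o ep0 R H.
  (* The states considered are those about to evaluate the test. The unit subtracted pays for the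
     [Seq] on entry to the loop and is simply dropped in later rounds. *)
  have loop : forall f' h' b' r' m' p' o', f' <= f -> I h' b' -> rel h' r' m' p' o' ->
      safe f' (State [:: cexp e 0, While 0 (Seq (comp A c) (cexp e 0)) & ks] r' m' p' o')
        (b'%:R + ep - 1)%R.
    move=> f'; have [f0 le_f0] := ubnP f'; elim: f0 f' le_f0 => // f0 IHf f' le_f0.
    move=> h' b' r' m' p' o' lf' I' R'.
    have [se le_b HQ] := HI _ _ I'.
    apply: (safe_weaken (b := ((ecost e)%:R + (1 + (1 + ((b' - (ecost e + 3))%:R + ep))))%R)).
      by rewrite natrB // natrD; lra.
    apply: (@cexp_sound e 0 h') => //; first nonneg.
    move=> f2 r2 p2 lf2 R2 r2t _; step => f3 lf3.
    rewrite -[0]/(3 * 0) r2t; case: ifP HQ => _ HQ.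
      step => f4 lf4; apply: (IH _ _ _ HQ _ _ _ _ _ _ _ ep0 R2).
      move=> f5 h5 b5 r5 m5 p5 o5 lf5 I5 R5.
      apply: (safe_weaken (b := (b5%:R + ep - 1)%R)); first by rewrite gerDl lerN10.
      by apply: (IHf _ _ h5) => //; lia.
    apply: (safe_weaken (b := ((b' - (ecost e + 3))%:R + ep)%R)); first by rewrite lerDr.
    by apply: (H _ h') => //; lia.
  have [se le_b HQ] := HI _ _ I0.
  have b1 : (1 <= b%:R :> rat)%R by rewrite ler1n; lia.
  have -> : (b%:R + ep = 1 + (b%:R + ep - 1))%R by ring.
  apply: safe_step => //; [exact: relP R | lra |].
  by move=> f' lf'; apply: (loop _ h) => //; exact: ltnW.
- move=> [S [J [C [[AS le_aS] [J0 Jsim Jval Jadr] Jrd Jcb [le_b HQ]]]]] f ks ep r m p o ep0 R H.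
  have [_ _ r_lt m_lt _] := R.
  (* The contract of [A] holds for arbitrary initial registers and memory, so whatever earlier runs
     left behind is a legitimate starting point and nothing has to be cleared. *)
  pose st0 := State [:: A] (fun x => r (3 * x + 2)) (fun x => m (16 * x)) 0 [::].
  have ini : initial w A st0 by split=> //= ?.
  have bep : (0 <= (b - (C + 40) * aT)%:R + ep)%R by apply: addr_ge0.
  have := @sim_sound rd cb S J C IHrd IHcb AS le_aS Jsim Jval Jadr Jrd Jcb
    st0 ks _ ini bep f st0 _ r m p o (Reach0 _ _ _) (rel_sim R).
  have [HAr _] := HA AS; have [HAt _ _] := HAr st0 ini.
  move=> H1; refine (safe_weaken _ (H1 _ _)).
  - have -> : (b%:R = (C + 40)%:R * aT%:R + (b - (C + 40) * aT)%:R :> rat)%R.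
      by rewrite -natrM -natrD; congr (_%:R)%R; lia.
    by rewrite -addrA lerD2r ler_wpM2l.
  - by split=> //; exact: Jsim.
  - by move=> f' o' h' r' m' p' o'' lf R' J' P'; apply: H R' => //; exact: HQ P' J'.
Qed.

End Soundness.

(** * Program logic *)

Fixpoint vmods (c : hcmd) : seq nat :=
  match c with
  | HAsg x _ => [:: x]
  | HSeq c1 c2 | HIf _ c1 c2 => vmods c1 ++ vmods c2
  | HWhile _ c => vmods c
  | HSim rd cb => sim_val :: sim_adr :: vmods rd ++ vmods cb
  | _ => [::]
  end.

Fixpoint amods (c : hcmd) : seq nat :=
  match c with
  | HSto al _ _ => [:: al]
  | HSeq c1 c2 | HIf _ c1 c2 => amods c1 ++ amods c2
  | HWhile _ c => amods c
  | HSim rd cb => sim_arr :: amods rd ++ amods cb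
  | _ => [::]
  end.

Fixpoint emits (c : hcmd) : bool :=
  match c with
  | HEmit _ => true
  | HSeq c1 c2 | HIf _ c1 c2 | HSim c1 c2 => emits c1 || emits c2
  | HWhile _ c => emits c
  | _ => false
  end.

Definition frame (c : hcmd) (st st' : hstate) : Prop :=
  [/\ forall x, x \notin vmods c -> vars st' x = vars st x,
      forall al, al \notin amods c -> arrs st' al = arrs st al
    & ~~ emits c -> outs st' = outs st].

Lemma frame_refl c st : frame c st st. Proof. by []. Qed.

Lemma frame_trans c st1 st2 st3 : frame c st1 st2 -> frame c st2 st3 -> frame c st1 st3.
Proof.
move=> [v1 a1 o1] [v2 a2 o2]; split=> [x xc|al alc|ec].
- by rewrite v2 // v1.
- by rewrite a2 // a1.
- by rewrite o2 // o1.
Qed.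

Lemma frame_sub c c' st st' : {subset vmods c <= vmods c'} -> {subset amods c <= amods c'} ->
  (emits c -> emits c') -> frame c st st' -> frame c' st st'.
Proof.
move=> sv sa se [v a o]; split=> [x xc|al alc|ec].
- by apply: v; apply: contra xc; exact: sv.
- by apply: a; apply: contra alc; exact: sa.
- by apply: o; apply: contra ec; exact: se.
Qed.

Lemma nat_of_bool_neq0 (b : bool) : (nat_of_bool b != 0) = b.
Proof. by case: b. Qed.

Lemma nat_of_bool_eq0 (b : bool) : nat_of_bool b = 0 -> b = false.
Proof. by case: b. Qed.

Lemma eqb_neq x y : x != y -> Nat.eqb x y = false.
Proof. by move=> /eqP xy; apply/PeanoNat.Nat.eqb_neq. Qed.

Section Logic.

Variables (W : nat) (inp : seq nat) (cap : nat).
Variables (ainp : seq nat -> Prop) (aT aS : nat) (apost : seq nat -> seq nat -> Prop).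

Notation wp := (wp W inp cap ainp aT aS apost).
Notation ev := (ev inp).
Notation es := (es W inp cap).

Lemma wp_mono c (Q Q' : hstate -> nat -> Prop) st b :
  (forall st' b', Q st' b' -> Q' st' b') -> wp c Q st b -> wp c Q' st b.
Proof.
elim: c Q Q' st b => [|x e|al e1 e2|e|c1 IH1 c2 IH2|e c1 IH1 c2 IH2|e c IH|rd _ cb _] Q Q' st b QQ' /=.
- by case=> ? /QQ'.
- by case=> ? ? /QQ'.
- by case=> ? ? /QQ'.
- by case=> ? ? /QQ'.
- by case=> ? H; split=> //; apply: IH1 H => ? ?; exact: IH2.
- by case=> ? ?; case: ifP => _ H; split=> //; [exact: IH1 H | exact: IH2 H].
- case=> I I0 H; exists I => // st' b' /H [? ?]; case: ifP => _ ?; split=> //; exact: QQ'.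
- case=> S [J [C [? ? ? ? [? H]]]]; exists S, J, C; split=> //; split=> // o st' Ho HJ.
  exact: (QQ' _ _ (H _ _ Ho HJ)).
Qed.

(** Every specification gets its frame for free, from a syntactic account of what a command may
    write; loops and simulations carry it inside their invariants. *)
Lemma wp_frame c (Q : hstate -> nat -> Prop) st b :
  wp c Q st b -> wp c (fun st' b' => Q st' b' /\ frame c st st') st b.
Proof.
elim: c Q st b => [|x e|al e1 e2|e|c1 IH1 c2 IH2|e c1 IH1 c2 IH2|e c IH|rd IHrd cb IHcb] Q st b /=.
- by case.
- case=> ? ? ?; split=> //; split=> //; split=> //= y.
  by rewrite inE => yx; rewrite eqb_neq.
- case=> ? ? ?; split=> //; split=> //; split=> //= y.
  by rewrite inE => yx; rewrite eqb_neq.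
- by case=> ? ? ?; split=> //; split=> //; split.
- case=> ? /IH1 H; split=> //; apply: wp_mono H => st1 b1 [/IH2 H F1].
  apply: wp_mono H => st2 b2 [HQ F2]; split=> //; apply: (@frame_trans _ _ st1).
    by apply: frame_sub F1 => [x|x|] /=; rewrite ?mem_cat => ->.
  by apply: frame_sub F2 => [x|x|] /=; rewrite ?mem_cat => ->; rewrite orbT.
- case=> ? ?; case: ifP => _ H; split=> //; [move/IH1: H | move/IH2: H];
    apply: wp_mono => st2 b2 [HQ F]; split=> //; apply: frame_sub F => [x|x|] /=;
    by rewrite ?mem_cat => ->; rewrite ?orbT.
- case=> I I0 H; exists (fun st' b' => I st' b' /\ frame c st st') => [|st' b' [I' F]].
    by split=> //; exact: frame_refl.
  have [? ?] := H _ _ I'; case: ifP => _ H'; split=> //.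
  by move/IH: H'; apply: wp_mono => st2 b2 [? F2]; split=> //; exact: frame_trans F2.
- case=> S [J [C [? [J0 J1 J2 J3] Jrd Jcb [? H]]]].
  exists S, (fun o st' => J o st' /\ frame (HSim rd cb) st st'), C; split=> //.
  + split=> //.
    * move=> o st' r m [HJ [F1 F2 F3]]; split; first exact: J1.
      split=> //= al; rewrite inE => alc; have := alc; rewrite negb_or => /andP[al0 _].
      by rewrite (eqb_neq al0); exact: F2.
    * move=> o st' v [HJ [F1 F2 F3]]; split; first exact: J2.
      split=> //= x; rewrite inE => xc; have := xc; rewrite negb_or => /andP[x0 _].
      by rewrite (eqb_neq x0); exact: F1.
    * move=> o st' v [HJ [F1 F2 F3]]; split; first exact: J3.
      split=> //= x; rewrite !inE => xc; have := xc; rewrite !negb_or => /and3P[_ x0 _].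
      by rewrite (eqb_neq x0); apply: F1; rewrite /= !inE.
  + move=> o st' [/Jrd/IHrd HJ F]; apply: wp_mono HJ => st2 _ [[HJ ? ?] F2].
    split=> //; split=> //; apply: frame_trans F _.
    by apply: frame_sub F2 => [x|x|] /=; rewrite ?(inE, mem_cat) => ->; rewrite /= ?orbT.
  + move=> o st' [/Jcb/IHcb HJ F]; apply: wp_mono HJ => st2 _ [[HJ ?] F2].
    split=> //; split=> //; apply: frame_trans F _.
    by apply: frame_sub F2 => [x|x|] /=; rewrite ?(inE, mem_cat) => ->; rewrite /= ?orbT.
  + by split=> // o st' Ho [HJ F]; split=> //; exact: (H _ _ Ho HJ).
Qed.

(** The frame rule for time: additional credits pass through a command untouched. A subprogram can
    therefore be specified with a fixed budget, whatever its context has left. *)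
Lemma wp_credit d c (Q : hstate -> nat -> Prop) st b : wp c Q st b ->
  wp c (fun st' b' => exists2 b1, Q st' b1 & b' = b1 + d) st (b + d).
Proof.
elim: c Q st b => [|x e|al e1 e2|e|c1 IH1 c2 IH2|e c1 IH1 c2 IH2|e c IH|rd IHrd cb IHcb] Q st b /=.
- by case=> b1 HQ; split; [lia | exists (b - 1) => //; lia].
- by case=> ? ? HQ; split=> //; [lia | eexists; [exact: HQ | lia]].
- by case=> ? ? HQ; split=> //; [lia | eexists; [exact: HQ | lia]].
- by case=> ? ? HQ; split=> //; [lia | eexists; [exact: HQ | lia]].
- case=> ? /IH1; rewrite -addnBAC // => H; split; first lia.
  by apply: wp_mono H => st1 _ [b1 /IH2 H ->].
- by case=> ? ?; case: ifP => _ H; (split=> //; first lia); rewrite -addnBAC //;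
    [exact: IH1 | exact: IH2].
- case=> I I0 H; exists (fun st' b' => exists2 b1, I st' b1 & b' = b1 + d) => [|st' _ [b' I' ->]].
    by exists b.
  have [? ?] := H _ _ I'; case: ifP => _ H'; (split=> //; first lia); rewrite -addnBAC //.
    exact: IH.
  by eexists; [exact: H' |].
- case=> S [J [C [? ? ? ? [? H]]]]; exists S, J, C; split=> //; split=> [|o st' Ho HJ].
    lia.
  by eexists; [exact: H HJ | lia].
Qed.

(** The rule by which specifications of subprograms are applied: it combines consequence, the frame
    of the variables and the frame of the credits. *)
Lemma wp_use c (P : hstate -> Prop) (Q : hstate -> nat -> Prop) st n b :
  wp c (fun st' _ => P st') st n -> n <= b ->
  (forall st' b', P st' -> frame c st st' -> b - n <= b' -> Q st' b') -> wp c Q st b.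
Proof.
move=> /wp_frame/(wp_credit (b - n)); rewrite addnC => H le_n HQ.
rewrite subnK // in H; apply: wp_mono H => st' _ [b1 [HP F] ->].
by apply: HQ => //; rewrite leq_addl.
Qed.

Lemma wp_weaken c (P : hstate -> Prop) st n b :
  wp c (fun st' _ => P st') st n -> n <= b -> wp c (fun st' _ => P st') st b.
Proof. by move=> H le_n; apply: wp_use H le_n _. Qed.

(** The second argument of the invariant [I] is what remains to be paid. *)
Lemma wp_loop e c (I : hstate -> nat -> Prop) (P : hstate -> Prop) st n0 : I st n0 ->
  (forall st' n, frame c st st' -> I st' n ->
     es st' e /\
     if ev st' e != 0 then
       exists k n', ecost e + 3 + k + n' <= n /\ wp c (fun st'' _ => I st'' n') st' k
     else ecost e + 3 <= n /\ P st') ->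
  wp (HWhile e c) (fun st' _ => P st') st n0.
Proof.
move=> I0 H; rewrite /=.
exists (fun st' b => frame c st st' /\ exists2 n, I st' n & n <= b); first by split=> //; exists n0.
move=> st' b [F [n In le_n]]; have [He] := H _ _ F In.
case: ifP => _; last by case=> ? ?; split=> //; lia.
case=> k [n' [le_k Hk]]; split=> //; first lia.
apply: wp_use Hk _ _; first by lia.
move=> st2 b2 I2 F2 le_b; split; first exact: frame_trans F2.
by exists n' => //; lia.
Qed.

Lemma wp_seq c1 c2 Q st b : 1 <= b -> wp c1 (wp c2 Q) st (b - 1) -> wp (HSeq c1 c2) Q st b.
Proof. by []. Qed.

Lemma wp_asg x e (Q : hstate -> nat -> Prop) st b : es st e -> ecost e + 2 <= b ->
  Q (setv st x (ev st e)) (b - (ecost e + 2)) -> wp (HAsg x e) Q st b.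
Proof. by []. Qed.

Lemma wp_sto al e1 e2 (Q : hstate -> nat -> Prop) st b : al < 16 /\ ev st e1 < cap ->
  es st e1 -> es st e2 ->
  ecost e1 + ecost e2 + 11 <= b ->
  Q (seta st al (ev st e1) (ev st e2)) (b - (ecost e1 + ecost e2 + 11)) ->
  wp (HSto al e1 e2) Q st b.
Proof. by case. Qed.

Lemma wp_emit e (Q : hstate -> nat -> Prop) st b : es st e -> ecost e + 2 <= b ->
  Q (seto st (ev st e)) (b - (ecost e + 2)) -> wp (HEmit e) Q st b.
Proof. by []. Qed.

Lemma wp_skip (Q : hstate -> nat -> Prop) st b : 1 <= b -> Q st (b - 1) -> wp HSkip Q st b.
Proof. by []. Qed.

Lemma wp_if e c1 c2 Q st b : es st e -> ecost e + 2 <= b ->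
  (ev st e != 0 -> wp c1 Q st (b - (ecost e + 2))) ->
  (ev st e = 0 -> wp c2 Q st (b - (ecost e + 2))) -> wp (HIf e c1 c2) Q st b.
Proof. by move=> ? ? H1 H2 /=; split=> //; case: ifPn => [/H1|/negPn/eqP/H2]. Qed.

(** [S] is the input shown to the simulated program and [J o] the invariant of the host once [o] has
    been output. [J] has to withstand any change of the simulated state and of the two communication
    variables. [C] bounds one call of [rd] or [cb]; the 40 covers the at most 17 other commands
    executed per simulated command. *)
Lemma wp_sim rd cb S (J : seq nat -> hstate -> Prop) C (Q : hstate -> nat -> Prop) st b :
  ainp S -> aS <= cap -> J [::] st ->
  (forall o st' r m, J o st' -> J o (seta_sim st' r m)) ->
  (forall o st' v, J o st' -> J o (setv st' sim_val v)) ->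
  (forall o st' v, J o st' -> J o (setv st' sim_adr v)) ->
  (forall o st', J o st' ->
     wp rd (fun st'' _ => [/\ J o st'', same_sim st' st''
                            & vars st'' sim_val = nth 0 S (vars st' sim_adr)]) st' C) ->
  (forall o st', J o st' ->
     wp cb (fun st'' _ => J (rcons o (vars st' sim_val)) st'' /\ same_sim st' st'') st' C) ->
  (C + 40) * aT <= b ->
  (forall o st', apost S o -> J o st' -> Q st' (b - (C + 40) * aT)) ->
  wp (HSim rd cb) Q st b.
Proof. by move=> *; exists S, J, C. Qed.

End Logic.

(** * Matches in the text and in the trie *)

Lemma edits_size d A B : edits d A B -> size B <= size A + d.
Proof.
elim: d A => [|d IH] A /=; first by move=> ->; rewrite addn0.
case=> C [AC /IH]; suff : size C <= (size A).+1 by lia.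
by case: AC => *; rewrite !size_cat /=; lia.
Qed.

Lemma edit_distance_le k A B :
  edit_distance A B <= k <-> exists2 d, d <= k & edits d A B.
Proof.
rewrite /edit_distance; case: ex_minnP => d /asboolP dAB dmin; split=> [le_k|[d' le_k dAB']].
  by exists d.
by apply: leq_trans le_k; apply: dmin; apply/asboolP.
Qed.

Lemma edit_distance_size k A B : edit_distance A B <= k -> size B <= size A + k.
Proof. by case/edit_distance_le => d le_d /edits_size; lia. Qed.

Lemma edits_del_cat A B : edits (size A) (A ++ B) B.
Proof. by elim: A => //= a A IH; exists (A ++ B); split=> //; exact: (@Deletion [::]). Qed.

(** All letters of [A] but the last are deleted and that one is substituted. An empty [A] takes one
    insertion, hence the maximum with 1. *)
Lemma edit_distance_char k A b : maxn 1 (size A) <= k -> edit_distance A [:: b] <= k.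
Proof.
move=> le_k; apply/edit_distance_le; case: A le_k => [|a A] /= le_k.
  by exists 1; [lia | exists [:: b]; split=> //; exact: (@Insertion [::] [::])].
exists (size A + 1); first by lia.
elim/last_ind: A a {le_k} => [|A c _] a.
  by exists [:: b]; split=> //; exact: (@Substitution [::] [::]).
apply: (@edits_trans _ _ _ [:: c]).
  by rewrite size_rcons -cats1 -cat_cons; exact: edits_del_cat (a :: A) [:: c].
by exists [:: b]; split=> //; exact: (@Substitution [::] [::]).
Qed.

(** * Matches as a property of the text read so far *)

Section Matching.

Variables (k : nat) (P : seq nat).

Definition ends (Y : seq nat) : bool :=
  has (fun q => edit_distance P (drop (size Y - q) Y) <= k) (iota 1 (size Y)).

Lemma matches_ends S :
  matches k P S = [seq j <- iota 1 (size S) | ends (take j S)].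
Proof.
apply: eq_in_filter => j; rewrite mem_iota => /andP[j1 jS].
have szj : size (take j S) = j by rewrite size_take; case: ltnP; lia.
rewrite /ends szj.
have E i : 0 < i <= j -> substring S i j = drop (j - (j.+1 - i)) (take j S).
  by move=> ij; rewrite /substring take_drop; f_equal; [lia | f_equal; lia].
apply/hasP/hasP => [[i]|[q]]; rewrite mem_iota => Hi H.
  by exists (j.+1 - i); rewrite ?mem_iota -?E //; lia.
exists (j.+1 - q); rewrite ?mem_iota ?E; try lia.
by have -> : j.+1 - (j.+1 - q) = q by lia.
Qed.

(** By [edit_distance_size] a matching suffix has at most [size P + k] letters, so it cannot reach
    into [X]. *)
Lemma ends_cat X Y : size P + k <= size Y -> ends (X ++ Y) = ends Y.
Proof.
move=> le_Y.
have E q : q <= size Y -> drop (size (X ++ Y) - q) (X ++ Y) = drop (size Y - q) Y.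
  by move=> le_q; rewrite drop_cat size_cat ifN; [f_equal; lia | lia].
apply/hasP/hasP => [[q]|[q]]; rewrite mem_iota => Hq H.
  have := edit_distance_size H; rewrite size_drop size_cat => le_q.
  rewrite size_cat in Hq.
  by exists q; rewrite ?mem_iota -?E //; lia.
by exists q; [rewrite mem_iota size_cat; lia | rewrite E //; lia].
Qed.

Lemma mem_matches S j : j \in matches k P S = (0 < j <= size S) && ends (take j S).
Proof. by rewrite matches_ends mem_filter mem_iota add1n ltnS andbC. Qed.

Lemma matches_uniq S : uniq (matches k P S).
Proof. exact/filter_uniq/iota_uniq. Qed.

Lemma matches_all S : maxn 1 (size P) <= k -> matches k P S = iota 1 (size S).
Proof.
move=> le_k; rewrite matches_ends; apply/all_filterP/allP => -[|j]; rewrite mem_iota // => jS.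
have ltj : j < size S by lia.
rewrite (take_nth 0) // /ends; apply/hasP; exists 1; rewrite ?mem_iota size_rcons //.
by rewrite subn1 -cats1 drop_size_cat //; exact: edit_distance_char.
Qed.

Lemma matches_nil S : P = [::] -> k = 0 -> matches k P S = [::].
Proof.
move=> P0 k0; rewrite matches_ends (eq_in_filter (a2 := pred0)) ?filter_pred0 // => j.
rewrite mem_iota => jS; apply/hasPn => q; rewrite mem_iota size_take => Hq.
apply/negP => /edit_distance_size; rewrite P0 k0 size_drop size_take.
by move: Hq; rewrite /=; case: ltnP; lia.
Qed.

(** Padding on the right and cutting off a distant past do not change which of the last
    [d] positions of a prefix of the text are matches. *)
Lemma matches_window Q T d W h e : h = size P + k -> e = minn T (2 * h) -> T <= size Q -> d <= T -> d <= h ->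
  size W = 2 * h -> take e W = drop (T - e) (take T Q) ->
  perm_eq [seq j + (T - e) | j <- matches k P W & e - d < j <= e]
    [seq j <- matches k P Q | T - d < j <= T].
Proof.
move=> hE eE TQ dT dh szW HW.
have eW : e <= size W by rewrite szW eE geq_minr.
have ends_eq j : e - d < j <= e -> ends (take j W) = ends (take (j + (T - e)) Q).
  move=> Hj.
  have -> : take j W = drop (T - e) (take (j + (T - e)) Q).
    have -> : take j W = take j (take e W) by rewrite take_takel //; lia.
    by rewrite HW take_drop take_takel //; lia.
  have := ends_cat (take (T - e) (take (j + (T - e)) Q)) (Y := drop (T - e) (take (j + (T - e)) Q)).
  case: (ltnP (2 * h) T) => [ltT|leT].
    rewrite cat_take_drop => -> //; rewrite size_drop size_take.
    by case: ltnP; lia.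
  have -> : T - e = 0 by lia.
  by rewrite drop0.
apply: uniq_perm.
- rewrite map_inj_uniq => [|x y]; first exact/filter_uniq/matches_uniq.
  exact: addIn.
- exact/filter_uniq/matches_uniq.
move=> j; rewrite mem_filter mem_matches.
apply/mapP/idP => [[j']|/and3P[Hj1 Hj2 Hj3]].
  rewrite mem_filter mem_matches => /and3P[Hj1 Hj2 Hj3 ->].
  rewrite ends_eq // in Hj3; rewrite Hj3 andbT.
  by move: Hj1 Hj2; lia.
exists (j - (T - e)); last by move: Hj1; lia.
have Hj : e - d < j - (T - e) <= e by move: Hj1; lia.
have jE : j - (T - e) + (T - e) = j by move: Hj1; lia.
by rewrite mem_filter mem_matches ends_eq // jE Hj3 Hj /=; lia.
Qed.

End Matching.

(** * The trie of phrases and its place in the text *)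

Section Parse.

Variable Z : zl_string.

Definition letter (i : nat) : nat := (nth (0, 0) Z i.-1).2.
Definition len (i : nat) : nat := size (phrase Z i).
Definition anc (i d : nat) : nat := iter d (reference Z) i.
Definition text (i : nat) : seq nat := flatten (take i (phrases Z)).
Definition start (i : nat) : nat := size (text i).
(** The path from [z_i] upwards, [z_i] included; stopping after [len i] nodes leaves out the root
    [z_0]. *)
Definition ancestors (i : nat) : seq nat := traject (reference Z) i (len i).

Hypothesis Z_ok : forall i, 0 < i <= size Z -> reference Z i < i.

(** Since [0.-1 = 0], the entry read is that of [z_1], whose reference can only be [0], or the
    default. The root thus becomes a fixed point of [reference]. *)
Lemma reference0 : reference Z 0 = 0.
Proof.
rewrite /reference /=; case: Z Z_ok => [|z Z'] //= H.
by have := H 1 isT; rewrite /reference /=; lia.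
Qed.

Lemma size_phrases (Y : zl_string) : size (phrases Y) = (size Y).+1.
Proof.
elim/last_ind: Y => // Y z IH.
by rewrite /phrases -cats1 foldl_cat /= size_rcons IH size_cat addn1.
Qed.

Lemma phrases_rcons (Y : zl_string) z :
  phrases (rcons Y z) = rcons (phrases Y) (rcons (phrase Y z.1) z.2).
Proof. by rewrite /phrases -cats1 foldl_cat. Qed.

Lemma phrase0 : phrase Z 0 = [::].
Proof.
rewrite /phrase; elim/last_ind: (Z) => // Y z IH.
by rewrite phrases_rcons nth_rcons size_phrases.
Qed.

Lemma phraseE i : 0 < i <= size Z ->
  phrase Z i = rcons (phrase Z (reference Z i)) (letter i).
Proof.
move: i; rewrite /letter; elim/last_ind: Z Z_ok => [|Y z IH] Y_ok i Hi; first by move: Hi => /=; lia.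
have Y_ok' j : 0 < j <= size Y -> reference Y j < j.
  move=> Hj; have := Y_ok j; rewrite /reference nth_rcons size_rcons.
  by rewrite ifT; [apply; lia | lia].
have stable j : j <= size Y -> phrase (rcons Y z) j = phrase Y j.
  by move=> Hj; rewrite /phrase phrases_rcons nth_rcons size_phrases ltnS Hj.
have := Y_ok i Hi; rewrite /reference !nth_rcons; rewrite size_rcons in Hi.
case: (ltngtP i (size Y).+1) => [lt_i|lt_i|->] /=; [|lia|].
  rewrite (_ : i.-1 < size Y); last lia.
  move=> lt_r; rewrite stable; last lia.
  rewrite (stable (nth (0, 0) Y i.-1).1); last lia.
  by apply: IH => //; lia.
rewrite ltnn eqxx => lt_r; rewrite (stable z.1) //.
by rewrite /phrase phrases_rcons nth_rcons size_phrases ltnn eqxx.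
Qed.

Lemma lenE i : 0 < i <= size Z -> len i = (len (reference Z i)).+1.
Proof. by move=> Hi; rewrite /len phraseE // size_rcons. Qed.

Lemma len0 : len 0 = 0. Proof. by rewrite /len phrase0. Qed.

Lemma len_gt0 i : i <= size Z -> (0 < len i) = (0 < i).
Proof. by case: i => [|i] Hi; [rewrite len0 | rewrite lenE]. Qed.

Lemma reference_le i : i <= size Z -> reference Z i <= i.
Proof. by case: i => [|i] Hi; [rewrite reference0 | apply/ltnW/Z_ok]. Qed.

Lemma len_le i : i <= size Z -> len i <= i.
Proof.
have [n] := ubnP i; elim: n i => // n IH [|i] lti Hi; first by rewrite len0.
by rewrite lenE // ltnS; have := @Z_ok i.+1 Hi => lt_r; apply: leq_trans (IH _ _ _) _; lia.
Qed.

Lemma ancS i d : anc i d.+1 = anc (reference Z i) d.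
Proof. exact: iterSr. Qed.

Lemma anc_add i d d' : anc i (d + d') = anc (anc i d) d'.
Proof. by rewrite /anc addnC iterD. Qed.

Lemma anc_le i d : i <= size Z -> anc i d <= i.
Proof.
move=> Hi; elim: d => // d IH; rewrite /anc iterS -/(anc i d).
exact: leq_trans (reference_le (leq_trans IH Hi)) IH.
Qed.

Lemma phrase_anc i d : i <= size Z -> d <= len i ->
  phrase Z (anc i d) = take (len i - d) (phrase Z i).
Proof.
elim: d i => [|d IH] i Hi Hd; first by rewrite subn0 take_size.
have i0 : 0 < i by case: i Hi Hd => //; rewrite len0.
have Hi' : 0 < i <= size Z by lia.
rewrite ancS IH; [|exact: leq_trans (reference_le Hi) Hi|by rewrite (lenE Hi') in Hd].
rewrite (lenE Hi') subSS [in RHS]phraseE // -cats1 takel_cat //.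
by rewrite leq_subr.
Qed.

Lemma len_anc i d : i <= size Z -> d <= len i -> len (anc i d) = len i - d.
Proof. by move=> Hi Hd; rewrite {1}/len phrase_anc // size_takel // leq_subr. Qed.

Lemma anc_len i : i <= size Z -> anc i (len i) = 0.
Proof.
move=> Hi; have := len_anc Hi (leqnn _); rewrite subnn => H.
by apply/eqP; rewrite -leqn0 leqNgt -len_gt0 ?H //; exact: leq_trans (anc_le _ Hi) Hi.
Qed.

Lemma anc_gt0 i d : i <= size Z -> (0 < anc i d) = (d < len i).
Proof.
move=> Hi; case: (leqP (len i) d) => Hd; last first.
  by rewrite -len_gt0 ?len_anc ?subn_gt0 //; [exact: ltnW | exact: leq_trans (anc_le _ Hi) Hi].
rewrite -(subnK Hd) addnC anc_add anc_len //; elim: (d - len i) => // e.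
by rewrite ancS reference0.
Qed.

Lemma ancestors0 : ancestors 0 = [::].
Proof. by rewrite /ancestors len0. Qed.

Lemma ancestorsE i : 0 < i <= size Z -> ancestors i = i :: ancestors (reference Z i).
Proof. by move=> Hi; rewrite /ancestors lenE. Qed.

Lemma mem_ancestors i x : i <= size Z ->
  x \in ancestors i -> exists2 d, d < len i & x = anc i d.
Proof. by move=> Hi /trajectP. Qed.

Lemma ancestors_le i x : i <= size Z -> x \in ancestors i -> 0 < x <= i.
Proof.
move=> Hi /(mem_ancestors Hi)[d Hd ->].
by rewrite anc_gt0 // Hd anc_le.
Qed.

Lemma size_text i : i <= size Z -> start i.+1 = start i + len i.
Proof.
move=> Hi; rewrite /start /text (take_nth [::]) ?size_phrases //.
by rewrite -cats1 flatten_cat size_cat /= cats0.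
Qed.

Lemma textS i : i <= size Z -> text i.+1 = text i ++ phrase Z i.
Proof.
move=> Hi; rewrite /text (take_nth [::]) ?size_phrases //.
by rewrite -cats1 flatten_cat /= cats0.
Qed.

Lemma text1 : text 1 = [::].
Proof. by rewrite textS // /text take0 phrase0. Qed.

Lemma text_decompress : text (size Z).+1 = decompress Z.
Proof. by rewrite /text take_oversize ?size_phrases. Qed.

Lemma take_text i : i <= (size Z).+1 -> take (start i) (decompress Z) = text i.
Proof.
move=> Hi; rewrite /decompress -(cat_take_drop i (phrases Z)) flatten_cat.
by rewrite take_size_cat.
Qed.

Lemma start_le i j : i <= j <= (size Z).+1 -> start i <= start j.
Proof.
case/andP=> le_ij; rewrite -(subnK le_ij); elim: (j - i) => // d IH Hj.
by rewrite addSn size_text; [apply: leq_trans (leq_addr _ _); apply: IH; lia | lia].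
Qed.

Lemma start_le_size i : i <= (size Z).+1 -> start i <= size (decompress Z).
Proof. by move=> Hi; rewrite -text_decompress; apply: start_le; lia. Qed.

Lemma leq_start i : i <= size Z -> i <= start i.+1.
Proof.
elim: i => // i IH Hi.
by have := IH (ltnW Hi); have : 0 < len i.+1 by [rewrite len_gt0]; rewrite (size_text Hi); lia.
Qed.

(** The text can be much longer than the input. Phrase lengths are bounded by indices, and the
    resulting polynomial bound is what lets a text position fit into one word. *)
Lemma start_leq i : i <= (size Z).+1 -> start i <= i * size Z.
Proof.
elim: i => [|i IH] Hi; first by rewrite /start /text take0.
rewrite size_text //; have := len_le Hi; have := IH (ltnW Hi); nia.
Qed.

(** The text up to the end of an occurrence of the phrase of an ancestor of [z_i] at the
    start of the phrase of [z_i]. *)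
Lemma take_phrase i d : i <= size Z -> d <= len i ->
  take (start i + (len i - d)) (decompress Z) = text i ++ phrase Z (anc i d).
Proof.
move=> Hi Hd; rewrite phrase_anc //.
have -> : take (start i + (len i - d)) (decompress Z) = take (start i + (len i - d)) (text i.+1).
  by rewrite -take_text // take_takel // size_text //; lia.
by rewrite textS // take_cat ifN ?addKn // -leqNgt leq_addr.
Qed.

(** * Marked nodes and chains of marked ancestors *)

Section Marks.

Variables (k : nat) (P : seq nat).
Let h := size P + k.
Let Q := decompress Z.

(** A phrase so long that a match at its end lies inside it. *)
Definition marked (y : nat) : bool := (h < len y) && ends k P (phrase Z y).

Definition rank (x : nat) : nat := count marked (iota 1 x).

(** The rank of the nearest marked node below [B] on the path from [x] to the root. *)
Definition code (B x : nat) : nat :=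
  rank (head 0 [seq y <- ancestors x | marked y && (y < B)]).

Lemma rankS x : rank x.+1 = rank x + marked x.+1.
Proof. by rewrite /rank -(addn1 x) iotaD count_cat /= add1n !addn1 addn0. Qed.

Lemma rank_le x y : x <= y -> rank x <= rank y.
Proof.
move=> le_xy; rewrite -(subnK le_xy); elim: (y - x) => // d IH.
by rewrite addSn rankS; apply: leq_trans IH (leq_addr _ _).
Qed.

Lemma rank_gt0 x : 0 < x -> marked x -> 0 < rank x.
Proof. by case: x => // x _ mx; rewrite rankS mx addn1. Qed.

Lemma rank_marked x : 0 < rank x -> exists y, [/\ 0 < y <= x, marked y & rank y = rank x].
Proof.
elim: x => // x IH; rewrite rankS; case mx: (marked x.+1) => /= rx.
  by exists x.+1; rewrite rankS mx leqnn.
by have [|y [Hy my ry]] := IH; first lia; exists y; split=> //; lia.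
Qed.

Lemma rank_unmarked x : 0 < rank x -> ~~ marked x ->
  exists y, [/\ 0 < y < x, marked y & rank y = rank x].
Proof.
move=> /rank_marked[y [Hy my ry]] mx; exists y; split=> //.
by case: (ltngtP y x) => [||yx]; [lia | lia | rewrite -yx my in mx].
Qed.

Lemma code0 B : code B 0 = 0.
Proof. by rewrite /code ancestors0. Qed.

Lemma codeE B x : 0 < x <= size Z ->
  code B x = if marked x && (x < B) then rank x else code B (reference Z x).
Proof. by move=> Hx; rewrite /code ancestorsE //=; case: ifP. Qed.

(** All nodes on the path from [x] to the root are at most [x], so any bound above [x] excludes none
    of them. *)
Lemma code_bound B B' x : x <= size Z -> x < B -> x < B' -> code B x = code B' x.
Proof.
move=> Hx xB xB'; rewrite /code; congr (rank (head _ _)).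
apply: eq_in_filter => y /(ancestors_le Hx) /andP[_ yx].
by rewrite !(leq_ltn_trans yx).
Qed.

Lemma code_skip B x : B <= x -> 0 < x <= size Z -> code B x = code B (reference Z x).
Proof. by move=> Bx Hx; rewrite codeE // ltnNge Bx andbF. Qed.

Lemma chain_nil x : x <= size Z -> code x.+1 x = 0 -> [seq y <- ancestors x | marked y] = [::].
Proof.
have [n] := ubnP x; elim: n x => // n IH [|x] ltx Hx; first by rewrite ancestors0.
rewrite codeE // ltnSn andbT ancestorsE //=; case: ifP => mx.
  by have := rank_gt0 (ltn0Sn x) mx; lia.
have lt_r := @Z_ok x.+1 Hx; rewrite (@code_bound _ (reference Z x.+1).+1) //; try lia.
by apply: IH; lia.
Qed.

(** One step along the links: the code of [x] names its nearest marked ancestor [y], and what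
    follows [y] is the chain of the parent of [y], whose code is the link stored with [y]. *)
Lemma chain_cons x q : x <= size Z -> code x.+1 x = q -> 0 < q ->
  exists y, [/\ 0 < y <= x, marked y, rank y = q &
    [seq y <- ancestors x | marked y] = y :: [seq y <- ancestors (reference Z y) | marked y]].
Proof.
have [n] := ubnP x; elim: n x => // n IH [|x] ltx Hx; first by rewrite code0; lia.
rewrite codeE // ltnSn andbT ancestorsE //=; case: ifP => mx.
  by move=> rq q0; exists x.+1; rewrite leqnn.
have lt_r := @Z_ok x.+1 Hx; rewrite (@code_bound _ (reference Z x.+1).+1) //; try lia.
move=> rq q0; have [||y [Hy my ry E]] := IH _ _ _ rq q0; try lia.
by exists y; split=> //; lia.
Qed.

(** The text up to that position is [text i] followed by the phrase of the ancestor; once this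
    phrase is longer than [h], [ends_cat] removes [text i]. This makes matches inside a phrase a
    matter of the trie alone. *)
Lemma marked_matches i d : i <= size Z -> d < len i ->
  (start i + len (anc i d) \in matches k P Q) && (h < len (anc i d)) = marked (anc i d).
Proof.
move=> Hi Hd; rewrite mem_matches len_anc //; last exact: ltnW.
rewrite /marked len_anc //; last exact: ltnW.
case: (ltnP h (len i - d)) => //= Hh; last by rewrite andbF.
rewrite andbT take_phrase //; last exact: ltnW.
rewrite ends_cat; last by rewrite -/(len _) len_anc ?(ltnW Hh) ?(ltnW Hd).
have := size_text Hi; have := @start_le_size i.+1 Hi; rewrite -/Q.
by case: (ends _ _ _) => /=; lia.
Qed.

(** An ancestor of depth [p] stands for position [start i + p], and depths strictly decrease along
    the path, so no position occurs twice. The end of the phrase is left out because [z_i] is tested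
    separately. *)
Lemma perm_chain i : 0 < i <= size Z ->
  perm_eq [seq start i + len y | y <- [seq y <- ancestors (reference Z i) | marked y]]
    [seq j <- matches k P Q | start i + h < j < start i + len i].
Proof.
move=> Hi; have Hi' : i <= size Z by case/andP: Hi.
have Hr : reference Z i <= size Z by have := reference_le Hi'; lia.
have anc_r d : d < len (reference Z i) -> anc (reference Z i) d = anc i d.+1 /\ d.+1 < len i.
  by rewrite ancS (lenE Hi).
apply: uniq_perm.
- rewrite map_inj_in_uniq => [|x y]; last first.
    rewrite !mem_filter => /andP[_ /(mem_ancestors Hr)[d Hd ->]].
    move=> /andP[_ /(mem_ancestors Hr)[e He ->]] /addnI.
    by rewrite !len_anc ?(ltnW Hd) ?(ltnW He) // => ?; f_equal; lia.
  apply: filter_uniq; rewrite /ancestors.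
  have : forall d, d <= len (reference Z i) ->
     uniq (traject (reference Z) (anc (reference Z i) (len (reference Z i) - d)) d).
    elim=> // d IH Hd; rewrite /= ; apply/andP; split.
      apply/trajectP => -[e He]; rewrite -iterSr -/(anc _ _) => E.
      have := congr1 len E; rewrite -anc_add !len_anc //; lia.
    have -> : reference Z (anc (reference Z i) (len (reference Z i) - d.+1)) =
       anc (reference Z i) (len (reference Z i) - d).
      by rewrite -[in RHS](_ : (len (reference Z i) - d.+1).+1 = len (reference Z i) - d) //; lia.
    by apply: IH; exact: ltnW.
  by move/(_ _ (leqnn _)); rewrite subnn.
- exact/filter_uniq/matches_uniq.
move=> j; rewrite mem_filter; apply/mapP/idP => [[y]|/andP[Hj mj]].
  rewrite mem_filter => /andP[my /(mem_ancestors Hr)[d Hd yE]] ->.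
  have [ancE ltd] := anc_r d Hd; rewrite yE ancE in my *.
  have := marked_matches Hi' ltd; rewrite my => /andP[-> lth].
  by rewrite andbT len_anc in lth *; lia.
set p := j - start i; have [ltp1 ltp2] : h < p /\ p < len i by lia.
have d1 : len i - p = (len (reference Z i) - p).+1 by move: ltp2; rewrite (lenE Hi); lia.
exists (anc i (len i - p)); last by rewrite len_anc //; lia.
rewrite mem_filter -marked_matches ?len_anc //; try lia.
have -> : start i + (len i - (len i - p)) = j by lia.
rewrite mj (_ : h < len i - (len i - p)) /=; last lia.
apply/trajectP; exists (len (reference Z i) - p); first by move: ltp2; rewrite (lenE Hi); lia.
by rewrite d1 ancS.
Qed.

(** A marked node is charged to the match at the end of its own phrase in the text. Phrases are
    nonempty, so these ends are distinct. *)
Lemma rank_occ x : x <= size Z -> rank x <= size (matches k P Q).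
Proof.
move=> Hx; rewrite /rank -size_filter -(size_map (fun y => start y.+1)).
apply: uniq_leq_size => [|j /mapP[y]].
  rewrite map_inj_in_uniq; first exact/filter_uniq/iota_uniq.
  have lt_start a b : 0 < a -> a < b -> b <= size Z -> start a.+1 < start b.+1.
    move=> a0 ab Hb; rewrite (size_text Hb); apply: leq_ltn_trans (@start_le a.+1 b _) _; first lia.
    by rewrite -[X in X < _]addn0 ltn_add2l len_gt0 //; lia.
  move=> a b; rewrite !mem_filter !mem_iota => /andP[_ Ha] /andP[_ Hb] E.
  case: (ltngtP a b) => // ab; [have := @lt_start a b | have := @lt_start b a]; lia.
rewrite mem_filter mem_iota => /andP[my Hy] ->.
have Hy' : y <= size Z by lia.
have := @marked_matches y 0 Hy'; rewrite len_gt0 // my size_text // => H.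
by have /andP[Hy0 _] := Hy; have /andP[] := H Hy0.
Qed.

End Marks.

End Parse.

(** * The program *)

Declare Scope prog_scope.
Delimit Scope prog_scope with prog.
Notation "# v" := (ECst v) (at level 2, format "# v") : prog_scope.
Notation "$ x" := (EVar x) (at level 2, format "$ x") : prog_scope.
Notation "a :+ b" := (EBin Add a b) (at level 50, left associativity) : prog_scope.
Notation "a :- b" := (EBin Minus a b) (at level 50, left associativity) : prog_scope.
Notation "a :** b" := (EBin Mul a b) (at level 40, left associativity) : prog_scope.
Notation "a :/ b" := (EBin Div a b) (at level 40, left associativity) : prog_scope.
Notation "a :< b" := (EBin Ltn a b) (at level 70, no associativity) : prog_scope.
Notation "a :== b" := (EBin Eqn a b) (at level 70, no associativity) : prog_scope.
Notation "al @[ e ]" := (ELd al e) (at level 2, format "al @[ e ]") : prog_scope.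
Notation "x ::= e" := (HAsg x e) (at level 85) : prog_scope.
Notation "al @[ e ] ::= e'" := (HSto al e e') (at level 2, e' at level 85) : prog_scope.
Notation "c1 ;; c2" := (HSeq c1 c2) (at level 90, right associativity) : prog_scope.
Notation "'IF' e 'THEN' c1 'ELSE' c2" := (HIf e c1 c2) (at level 88) : prog_scope.
Notation "'WHILE' e 'DO' c" := (HWhile e c) (at level 88) : prog_scope.

(** [rH] holds [m + k], [rL] twice that and [rBlk] the size of the blocks; [rV] is a position
    of the text and [rRec] the number of recorded nodes; the current block is [rB <= i < rE]
    and the current range [rLo <= x < rHi]. The [w] variables are the arguments and results of
    a run of the simulated matcher. *)
Notation rM := 2. Notation rN := 3. Notation rK := 4. Notation rTau := 5.
Notation rH := 6. Notation rL := 7. Notation rBlk := 8.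
Notation rV := 9. Notation rRec := 10. Notation rB := 11. Notation rE := 12.
Notation rLo := 13. Notation rHi := 14. Notation rX := 15. Notation rPtr := 16.
Notation rY := 17. Notation rQ := 18. Notation rD := 19. Notation rC := 20.
Notation rI := 21. Notation rLen := 22. Notation rG := 23. Notation rA := 24.
Notation wX := 25. Notation wT := 26. Notation wD := 27. Notation wE := 28.
Notation wPos := 29. Notation wF := 30. Notation wFlag := 31. Notation wLo := 32. Notation wOff := 33.

(** [aBuf] is the text given to the simulated matcher. The other [a] arrays are indexed by the
    elements of the block, the [t] arrays by the nodes of the range and the [m] arrays by the
    recorded nodes. *)
Notation aBuf := 1. Notation aCur := 2. Notation aAcc := 3. Notation aA1 := 4.
Notation aD1 := 5. Notation aA2 := 6. Notation aD2 := 7. Notation aNear := 8.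
Notation tNear := 9. Notation tEx := 10. Notation tDe := 11. Notation tLag := 12.
Notation mIdx := 13. Notation mLen := 14. Notation mLink := 15.

Local Open Scope prog_scope.

(** The pair of [z_i] follows four numbers, the [m] letters of the pattern and [i - 1] pairs, hence
    lies at [4 + m + 2 * (i - 1)]. *)
Definition eref (e : expr) : expr := ERd (($rM :+ #2) :+ (#2 :** e)).
Definition eletter (e : expr) : expr := ERd (($rM :+ #3) :+ (#2 :** e)).

Definition c_init : hcmd :=
  rX ::= #0 ;;
  WHILE $rX :< ($rE :- $rB) DO (
    rY ::= $rB :+ $rX ;;
    aCur@[$rX] ::= $rY ;; aAcc@[$rX] ::= #0 ;;
    aA1@[$rX] ::= $rY ;; aD1@[$rX] ::= #0 ;;
    aA2@[$rX] ::= $rY ;; aD2@[$rX] ::= #0 ;;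
    aNear@[$rX] ::= #0 ;;
    rX ::= $rX :+ #1).

Ltac hs := cbn [eref eletter ev sem vars arrs outs setv seta seto Init.Nat.eqb ecost].
Ltac sides := cbn [ev sem vars arrs outs setv seta seto Init.Nat.eqb ecost es exact_op eref eletter];
  repeat split; first [done | lia].
Ltac wps1 := lazymatch goal with
  | |- wp _ _ _ _ _ _ _ (HSeq _ _) _ _ _ => apply: wp_seq; [first [done | lia]|]
  | |- wp _ _ _ _ _ _ _ (HAsg _ _) _ _ _ => apply: wp_asg; [sides | hs; first [done | lia] | hs]
  | |- wp _ _ _ _ _ _ _ (HSto _ _ _) _ _ _ => apply: wp_sto; [sides | sides | sides | hs; first [done | lia] | hs]
  | |- wp _ _ _ _ _ _ _ (HEmit _) _ _ _ => apply: wp_emit; [sides | hs; first [done | lia] | hs]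
  | |- wp _ _ _ _ _ _ _ HSkip _ _ _ => apply: wp_skip; [first [done | lia] | hs]
  end.
Ltac wps := repeat wps1.
Ltac wpif c := apply: wp_if; [sides | hs; first [done | lia] | hs => c | hs => c].

(** Records are sorted by index and a pass visits the ranges downwards, so [rPtr], the number of
    records not above the current node, only decreases during a pass. Entries of unrecorded nodes
    are zeroed explicitly because memory is not initialized. *)
Definition c_load : hcmd :=
  rX ::= $rHi ;;
  WHILE $rLo :< $rX DO (
    rX ::= $rX :- #1 ;;
    tNear@[$rX :- $rLo] ::= #0 ;;
    IF #0 :< $rPtr THEN
      IF mIdx@[$rPtr :- #1] :== $rX THEN
        (tNear@[$rX :- $rLo] ::= $rPtr ;; rPtr ::= $rPtr :- #1)
      ELSE HSkip
    ELSE HSkip).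

(** References point to smaller indices, so in ascending order the entry of the parent is always
    complete. [tLag] is meaningless as long as the distance is below [h]; it is set at distance
    exactly [h] and inherited from there on. *)
Definition c_sweep : hcmd :=
  rX ::= $rLo ;;
  WHILE $rX :< $rHi DO (
    rY ::= eref $rX ;;
    rQ ::= $rX :- $rLo ;;
    (IF $rY :< $rLo THEN (tEx@[$rQ] ::= $rY ;; rD ::= #1)
     ELSE (
       rC ::= $rY :- $rLo ;;
       tEx@[$rQ] ::= tEx@[$rC] ;;
       rD ::= tDe@[$rC] :+ #1 ;;
       tLag@[$rQ] ::= tLag@[$rC] ;;
       IF tNear@[$rQ] THEN HSkip ELSE tNear@[$rQ] ::= tNear@[$rC])) ;;
    tDe@[$rQ] ::= $rD ;;
    (IF $rD :== $rH THEN tLag@[$rQ] ::= $rX ELSE HSkip) ;;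
    rX ::= $rX :+ #1).

(** A jump of length at least [h] takes its new anchor from [tLag]. Shorter jumps add up in [aD2];
    when the sum reaches [h], the second anchor replaces the first. *)
Definition c_jump : hcmd :=
  rX ::= #0 ;;
  WHILE $rX :< ($rE :- $rB) DO (
    rC ::= aCur@[$rX] ;;
    (IF $rC :< $rLo THEN HSkip ELSE (
      rQ ::= $rC :- $rLo ;;
      rD ::= tDe@[$rQ] ;;
      rY ::= tEx@[$rQ] ;;
      aAcc@[$rX] ::= aAcc@[$rX] :+ $rD ;;
      aCur@[$rX] ::= $rY ;;
      (IF $rD :< $rH THEN (
         aD1@[$rX] ::= aD1@[$rX] :+ $rD ;;
         aD2@[$rX] ::= aD2@[$rX] :+ $rD ;;
         IF aD2@[$rX] :< $rH THEN HSkip ELSE (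
           aA1@[$rX] ::= aA2@[$rX] ;;
           aD1@[$rX] ::= aD2@[$rX] ;;
           aA2@[$rX] ::= $rY ;;
           aD2@[$rX] ::= #0))
       ELSE (
         aA1@[$rX] ::= tLag@[$rQ] ;;
         aD1@[$rX] ::= $rH ;;
         aA2@[$rX] ::= $rY ;;
         aD2@[$rX] ::= #0)) ;;
      IF aNear@[$rX] THEN HSkip ELSE aNear@[$rX] ::= tNear@[$rQ])) ;;
    rX ::= $rX :+ #1).

(** The first range is the block itself. Ranges start at indices [1 + r * N], so the value 0 of
    [rLo] is free to signal that the range starting at 1 is done. *)
Definition c_pass : hcmd :=
  rLo ::= $rB ;; rHi ::= $rE ;; rPtr ::= $rRec ;;
  WHILE $rLo DO (
    c_load ;; c_sweep ;; c_jump ;;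
    rHi ::= $rLo ;;
    IF $rBlk :< $rLo THEN rLo ::= $rLo :- $rBlk ELSE rLo ::= #0).

(** Writes the last [$wE] letters of the text that ends with the phrase of [$wX], preceded
    by the phrases before [$rI], and pads them up to the length [$rL]. *)
Definition c_fill : hcmd :=
  wPos ::= $wE ;; wF ::= $rI ;;
  (WHILE $wPos DO
    IF $wX THEN (
      wPos ::= $wPos :- #1 ;;
      aBuf@[$wPos] ::= eletter $wX ;;
      wX ::= eref $wX)
    ELSE (wF ::= $wF :- #1 ;; wX ::= $wF)) ;;
  wPos ::= $wE ;;
  WHILE $wPos :< $rL DO (
    aBuf@[$wPos] ::= ERd #4 ;;
    wPos ::= $wPos :+ #1).

(** Access to the simulated input: the pattern is part of the input, the text is in the
    buffer. *)
Definition c_rd : hcmd :=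
  IF $sim_adr :< #3 THEN
    IF $sim_adr :== #0 THEN sim_val ::= $rM
    ELSE IF $sim_adr :== #1 THEN sim_val ::= $rL ELSE sim_val ::= $rK
  ELSE IF $sim_adr :< (#3 :+ $rM) THEN sim_val ::= ERd ($sim_adr :+ #1)
  ELSE IF $sim_adr :< ((#3 :+ $rM) :+ $rL) THEN sim_val ::= aBuf@[$sim_adr :- (#3 :+ $rM)]
  ELSE sim_val ::= #0.

Definition c_cb : hcmd :=
  IF $wLo :< $sim_val THEN
    IF $sim_val :< ($wE :+ #1) THEN (HEmit ($sim_val :+ $wOff) ;; wFlag ::= #1) ELSE HSkip
  ELSE HSkip.

Definition c_run : hcmd :=
  (IF $wT :< $rL THEN wE ::= $wT ELSE wE ::= $rL) ;;
  c_fill ;;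
  wFlag ::= #0 ;; wLo ::= $wE :- $wD ;; wOff ::= $wT :- $wE ;;
  HSim c_rd c_cb.

(** [wX] becomes the ancestor at depth [h]; it is at most [2 * h] steps above the anchor. *)
Definition c_locate : hcmd :=
  rA ::= $rI :- $rB ;;
  rLen ::= aAcc@[$rA] ;;
  IF $rH :< $rLen THEN (
    wX ::= aA1@[$rA] ;;
    rQ ::= aD1@[$rA] ;;
    (WHILE $rH :< $rQ DO (wX ::= eref $wX ;; rQ ::= $rQ :- #1)) ;;
    wD ::= $rH)
  ELSE (wX ::= $rI ;; wD ::= $rLen).

(** After the climb [aNear] knows only the records below the block, and [c_mark] completes the entry
    of each processed element. So a parent inside the block is consulted directly, while for a
    parent below the block the entry of [z_i] itself already gives the answer. *)
Definition c_chain : hcmd :=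
  rY ::= eref $rI ;;
  (IF $rY :< $rB THEN rG ::= aNear@[$rA] ELSE rG ::= aNear@[$rY :- $rB]) ;;
  rQ ::= $rG ;;
  WHILE $rQ DO (
    rQ ::= $rQ :- #1 ;;
    HEmit ($rV :+ mLen@[$rQ]) ;;
    rQ ::= mLink@[$rQ]).

(** Nodes are recorded in the order of their indices, so a recorded node is represented by
    its [rank], and [0] stands for none. *)
Definition c_mark : hcmd :=
  rV ::= $rV :+ $rLen ;;
  (IF $rH :< $rLen THEN (
     wX ::= $rI ;; wT ::= $rV ;; wD ::= #1 ;;
     c_run ;;
     IF $wFlag THEN (
       mIdx@[$rRec] ::= $rI ;; mLen@[$rRec] ::= $rLen ;; mLink@[$rRec] ::= $rG ;;
       rRec ::= $rRec :+ #1 ;; rG ::= $rRec)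
     ELSE HSkip)
   ELSE HSkip) ;;
  aNear@[$rA] ::= $rG ;;
  rI ::= $rI :+ #1.

Ltac wpifb c := wpif c; [rewrite nat_of_bool_neq0 in c | apply nat_of_bool_eq0 in c].

Section Program.

Variables (W : nat) (inp : seq nat) (cap : nat).
Variables (ainp : seq nat -> Prop) (aT aS : nat) (apost : seq nat -> seq nat -> Prop).
Variables (k : nat) (P : seq nat) (Z : zl_string) (N : nat).

Let n := size Z.
Let m := size P.
Let h := m + k.
Let u := size (decompress Z).

Hypothesis W_big : 100 * (n + m + k + N + cap + u + 10) < W.
Hypothesis Z_ok : forall i, 0 < i <= size Z -> reference Z i < i.
Hypothesis inp_ref : forall i, 0 < i <= n -> nth 0 inp (m + 2 + 2 * i) = reference Z i.
Hypothesis inp_letter : forall i, 0 < i <= n -> nth 0 inp (m + 3 + 2 * i) = letter Z i.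
Hypothesis inp_pat : forall j, j < m -> nth 0 inp (4 + j) = nth 0 P j.
Hypothesis N_gt0 : 0 < N.
Hypothesis N_cap : N <= cap.
Hypothesis h_cap : 2 * h <= cap.
Hypothesis m_gt0 : 0 < m.
Hypothesis aS_cap : aS <= cap.
Variable Sigma : pred nat.
Hypothesis Sigma_text : all Sigma (decompress Z).
Hypothesis Sigma_pat : all Sigma P.
Hypothesis ainp_text : forall S, all Sigma S -> size S = 2 * h -> ainp (text_input k P S).
Hypothesis apost_text : forall S o, size S = 2 * h -> apost (text_input k P S) o ->
  perm_eq o (matches k P S).

Notation wp := (wp W inp cap ainp aT aS apost).
Notation ev := (ev inp).
Notation es := (es W inp cap).

Definition env (st : hstate) : Prop :=
  [/\ vars st rM = m, vars st rN = n, vars st rK = k,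
      vars st rH = h /\ vars st rL = 2 * h & vars st rBlk = N].

Lemma env_frame c st st' : frame c st st' ->
  all (fun x => x \notin vmods c) [:: rM; rN; rK; rH; rL; rBlk] -> env st -> env st'.
Proof.
by case=> Fv _ _ /=; rewrite andbT => /and5P[? ? ? ? /andP[? ?]]; rewrite /env !Fv.
Qed.

Lemma init_spec st B E : vars st rB = B -> vars st rE = E -> B <= E -> E <= B + N -> B <= n ->
  wp c_init (fun st' _ => forall j, j < E - B ->
     [/\ arrs st' aCur j = B + j, arrs st' aAcc j = 0, arrs st' aA1 j = B + j /\ arrs st' aD1 j = 0,
         arrs st' aA2 j = B + j /\ arrs st' aD2 j = 0 & arrs st' aNear j = 0])
   st (200 * (E - B) + 40).
Proof.
move=> stB stE BE EBN Bn; rewrite /c_init.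
wps.
apply: (@wp_weaken _ _ _ _ _ _ _ _ _ _ (200 * (E - B) + 20)); last lia.
apply: (wp_loop (I := fun st' b => exists x, [/\ vars st' rX = x, x <= E - B, b = 200 * (E - B - x) + 20 &
   forall j, j < x -> [/\ arrs st' aCur j = B + j, arrs st' aAcc j = 0, arrs st' aA1 j = B + j /\ arrs st' aD1 j = 0,
         arrs st' aA2 j = B + j /\ arrs st' aD2 j = 0 & arrs st' aNear j = 0]])).
  by exists 0; split=> //; lia.
move=> st' b [Fv _ _] [x [stX le_x -> Hx]].
have := Fv rB isT; have := Fv rE isT; hs => sE sB.
split; first by sides.
hs; case: ifP => lt_x; last first.
  by split; [lia | move=> j jlt; apply: Hx; lia].
exists 180, (200 * (E - B - x.+1) + 20); split; first by lia.
wps.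
exists x.+1; hs; split; try lia.
move=> j; rewrite ltnS leq_eqVlt => /predU1P[->|ltj].
  by rewrite stX eqxx; split; try split; lia.
by rewrite stX (ltn_eqF ltj); exact: Hx.
Qed.

Notation marked := (marked Z k P).
Notation rank := (rank Z k P).
Notation code := (code Z k P).
Notation anc := (anc Z).
Notation len := (len Z).

Hypothesis occ_cap : size (matches k P (decompress Z)) <= cap.

Lemma rank_cap x : x <= n -> rank x <= cap.
Proof. by move=> Hx; apply: leq_trans occ_cap; exact: rank_occ. Qed.

(** * Records and tables of a range *)

Definition records (st : hstate) (B : nat) : Prop :=
  vars st rRec = rank B.-1 /\
  forall y, 0 < y < B -> marked y ->
    [/\ arrs st mIdx (rank y).-1 = y, arrs st mLen (rank y).-1 = len y
      & arrs st mLink (rank y).-1 = code y (reference Z y)].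

Lemma rank_step B x : 0 < x ->
  rank (minn x B.-1) = rank (minn x.-1 B.-1) + (marked x && (x < B)).
Proof.
case: x => // x _; case: (ltnP x.+1 B) => xB.
  have -> : minn x.+1 B.-1 = x.+1 by lia.
  have -> : minn x.+1.-1 B.-1 = x by lia.
  by rewrite rankS andbT.
by rewrite andbF addn0; f_equal; lia.
Qed.

Lemma rank_top B x : marked x && (x < B) -> rank (minn x B.-1) = rank x.
Proof. by case/andP=> _ xB; f_equal; lia. Qed.

(** The last record with index at most [x] and below [B] belongs to [x] precisely if [x] has a
    record; otherwise it belongs to a smaller node. This is the test in [c_load]. *)
Lemma top_record st B x : records st B -> 0 < B -> 0 < rank (minn x B.-1) ->
  (arrs st mIdx (rank (minn x B.-1)).-1 == x) = marked x && (x < B).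
Proof.
move=> [_ Hrec] B0 r0; case: (ltnP x B) => xB.
  have E : minn x B.-1 = x by lia.
  rewrite E in r0 *; case mX: (marked _) => /=.
    have [y [Hy _ _]] := rank_marked r0.
    by have [|-> _ _] := Hrec _ _ mX; rewrite ?eqxx //; lia.
  have [y [Hy my ry]] := rank_unmarked r0 (negbT mX).
  by rewrite -ry; have [|-> _ _] := Hrec _ _ my; [lia | apply/eqP; lia].
have E : minn x B.-1 = B.-1 by lia.
rewrite E in r0 *; have [y [Hy my ry]] := rank_marked r0.
rewrite -ry; have [|-> _ _] := Hrec _ _ my; first lia.
by rewrite andbF; apply/eqP; lia.
Qed.

Lemma load_spec st B lo hi : vars st rLo = lo -> vars st rHi = hi -> 0 < lo <= hi ->
  hi <= lo + N -> hi <= n.+1 -> records st B -> 0 < B <= n ->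
  vars st rPtr = rank (minn hi.-1 B.-1) ->
  wp c_load (fun st' _ =>
      vars st' rPtr = rank (minn lo.-1 B.-1) /\
      forall x, lo <= x < hi ->
        arrs st' tNear (x - lo) = if marked x && (x < B) then rank x else 0)
    st (200 * (hi - lo) + 40).
Proof.
move=> stL stH Hlo HloN Hhin Hrec HB stP; rewrite /c_load.
wps.
apply: (@wp_weaken _ _ _ _ _ _ _ _ _ _ (200 * (hi - lo) + 20)); last lia.
apply: (wp_loop (I := fun st' b => [/\ lo <= vars st' rX <= hi,
    b = 200 * (vars st' rX - lo) + 20, vars st' rPtr = rank (minn (vars st' rX).-1 B.-1) &
    forall x, vars st' rX <= x < hi ->
        arrs st' tNear (x - lo) = if marked x && (x < B) then rank x else 0])).
  by hs; rewrite stH; split=> //; lia.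
move=> st' b [Fv Fa _] [HX -> HP HT].
have := Fv rLo isT; have := Fv rHi isT; have := Fa mIdx isT; hs => sI sH sL.
have ptr_cap : vars st' rPtr <= cap by rewrite HP; apply: rank_cap; lia.
split; first by sides.
hs; case: ifP => lt_x; last first.
  by split; [lia | split=> [|x Hx]; [rewrite HP; f_equal; lia | apply: HT; lia]].
have [x1 EX] : exists x1, vars st' rX = x1.+1 by exists (vars st' rX).-1; lia.
rewrite EX in HX HP HT lt_x *; rewrite /= in HP HT.
have [lo1 x10 x1h] : [/\ lo <= x1, 0 < x1 & x1 < hi] by split; lia.
exists 180, (200 * (x1 - lo) + 20); split; first by lia.
have := rank_step B x10; have := @rank_top B x1; have := @top_record st B x1 Hrec.
rewrite -HP -sI => top1 top2 stp.
have HT0 x : x1 <= x < hi -> x <> x1 ->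
    arrs st' tNear (x - lo) = if marked x && (x < B) then rank x else 0.
  by move=> Hx ne; apply: HT; lia.
have neq x : x1 <= x < hi -> x <> x1 -> (x - lo == x1 - lo) = false.
  by move=> Hx ne; apply/eqP; lia.
have B0 : 0 < B by lia.
have r_le : rank (minn x1.-1 B.-1) <= cap by apply: rank_cap; lia.
have E1 : vars st' rX - 1 = x1 by lia.
have E2 : vars st' rLo = lo by lia.
clear HT Hrec HP Fv Fa sI.
wps; rewrite E1 E2.
wpif c1.
  have p0 : 0 < vars st' rPtr by move: c1; case: (0 < _).
  have {}top1 := top1 B0 p0; rewrite -subn1 in top1.
  wpif c2.
    have mbT : marked x1 && (x1 < B) by rewrite -top1; move: c2; case: (_ == x1).
    rewrite mbT in stp; wps; rewrite ?E1 ?E2; split; try lia.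
    move=> x Hx; case: (x =P x1) => [->|ne]; first by rewrite eqxx mbT -top2.
    by rewrite neq // HT0.
  have mbF : marked x1 && (x1 < B) = false by rewrite -top1; move: c2; case: (_ == x1).
  rewrite mbF in stp; wps; rewrite ?E1 ?E2; split; try lia.
  move=> x Hx; case: (x =P x1) => [->|ne]; first by rewrite eqxx mbF.
  by rewrite neq // HT0.
have mbF : marked x1 && (x1 < B) = false by move: c1 stp; case: (marked x1 && _) => //; case: ltnP; lia.
rewrite mbF in stp; wps; rewrite ?E1 ?E2; split; try lia.
move=> x Hx; case: (x =P x1) => [->|ne]; first by rewrite eqxx mbF.
by rewrite neq // HT0.
Qed.

Hypothesis h_gt0 : 0 < h.

(** What the tables of the range starting at [lo] say about [x]: [ex] is the first ancestor
    below [lo], [de] its distance and [lag] the ancestor at distance [h] before it. *)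
Definition entry (B lo x ex de lag near : nat) : Prop :=
  [/\ 0 < de <= len x, ex = anc x de, ex < lo, h <= de -> lag = anc x (de - h)
    & code B x = if near != 0 then near else code B ex].

Lemma entry_root B lo x lag near : 0 < x <= n -> reference Z x < lo ->
  near = (if marked x && (x < B) then rank x else 0) -> (1 = h -> lag = x) ->
  entry B lo x (reference Z x) 1 lag near.
Proof.
move=> Hx ltr -> Hlag; split=> //.
- by rewrite len_gt0 //; case/andP: Hx.
- by move=> leh; have hE : h = 1 by [lia]; rewrite hE subnn Hlag.
rewrite codeE //; case: ifP => // /andP[mx _].
by rewrite -lt0n rank_gt0 //; case/andP: Hx.
Qed.

(** The exit node is that of the parent, one step further away. The node [h] steps before the exit
    is [x] itself when the distance becomes [h], and beyond that it is the one of the parent. *)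
Lemma entry_step B lo x ex de lag near t lag' near' : 0 < x <= n ->
  entry B lo (reference Z x) ex de lag near ->
  t = (if marked x && (x < B) then rank x else 0) ->
  near' = (if t != 0 then t else near) ->
  (de.+1 = h -> lag' = x) -> (de.+1 <> h -> lag' = lag) ->
  entry B lo x ex de.+1 lag' near'.
Proof.
move=> Hx [Hde exE exlo lagE codeE'] tE nE l1 l2; split=> //.
- by rewrite lenE //; lia.
- by rewrite exE ancS.
- move=> leh; case: (de.+1 =P h) => [E|ne]; first by rewrite l1 // E subnn.
  by rewrite l2 // lagE ?subSn ?ancS //; lia.
rewrite codeE // nE tE codeE'; case: ifP => [/andP[mx _]|//].
have r0 : rank x != 0 by rewrite -lt0n; apply: rank_gt0 => //; case/andP: Hx.
by rewrite r0 r0.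
Qed.

Lemma sweep_spec st B lo hi : env st -> vars st rLo = lo -> vars st rHi = hi -> 0 < lo <= hi ->
  hi <= lo + N -> hi <= n.+1 ->
  (forall x, lo <= x < hi ->
     arrs st tNear (x - lo) = if marked x && (x < B) then rank x else 0) ->
  wp c_sweep (fun st' _ => forall x, lo <= x < hi ->
      entry B lo x (arrs st' tEx (x - lo)) (arrs st' tDe (x - lo)) (arrs st' tLag (x - lo))
        (arrs st' tNear (x - lo)))
    st (400 * (hi - lo) + 40).
Proof.
move=> Henv stL stH Hlo HloN Hhin Ht; rewrite /c_sweep.
wps.
apply: (@wp_weaken _ _ _ _ _ _ _ _ _ _ (400 * (hi - lo) + 20)); last lia.
pose I st' b := exists X, [/\ vars st' rX = X, lo <= X <= hi, b = 400 * (hi - X) + 20,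
    (forall x, lo <= x < X -> entry B lo x (arrs st' tEx (x - lo)) (arrs st' tDe (x - lo)) (arrs st' tLag (x - lo))
        (arrs st' tNear (x - lo))) &
    (forall x, X <= x < hi ->
     arrs st' tNear (x - lo) = if marked x && (x < B) then rank x else 0)].
apply: (wp_loop (I := I)).
  by exists lo; hs; split=> //; lia.
move=> st' b [Fv _ _] [X [EX HX -> HT1 HT2]].
have := Fv rLo isT; have := Fv rHi isT; have := Fv rM isT; have := Fv rH isT; hs.
have [stM _ _ [stHH _] _] := Henv.
rewrite stL stH stM stHH => sHH sM sH sL; clear Fv Henv stL stH stM stHH Ht.
split; first by sides.
hs; rewrite EX sH; case: ifP => lt_x; last by split=> [|x Hx]; [lia | apply: HT1; lia].
have ltX : X < hi by lia.
exists 380, (400 * (hi - X.+1) + 20); split; first by lia.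
have HXn : 0 < X <= n by lia.
have refE := inp_ref HXn; have lt_r := Z_ok HXn.
have tE := HT2 X; rewrite leqnn ltX /= in tE; have {}tE := tE isT.
have new st1 : vars st1 rX = X.+1 ->
   (forall x, x <> X -> lo <= x < hi -> [/\ arrs st1 tEx (x - lo) = arrs st' tEx (x - lo),
     arrs st1 tDe (x - lo) = arrs st' tDe (x - lo), arrs st1 tLag (x - lo) = arrs st' tLag (x - lo) &
     arrs st1 tNear (x - lo) = arrs st' tNear (x - lo)]) ->
   entry B lo X (arrs st1 tEx (X - lo)) (arrs st1 tDe (X - lo)) (arrs st1 tLag (X - lo))
        (arrs st1 tNear (X - lo)) ->
   I st1 (400 * (hi - X.+1) + 20).
  move=> e1 e2 e3; exists X.+1; split=> //; first by lia.
    move=> x Hx; case: (x =P X) => [->//|ne].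
    by have [|-> -> -> ->] := e2 _ ne; [lia | apply: HT1; lia].
  move=> x Hx; have [||_ _ _ ->] := e2 x; try lia.
  by apply: HT2; lia.
have neq x : x <> X -> lo <= x < hi -> (x - lo == X - lo) = false by move=> *; apply/eqP; lia.
have HT1r : lo <= reference Z X -> lo <= reference Z X < X by lia.
have {}HT1r := fun H => HT1 _ (HT1r H).
clear HT2.
have XcapL : X - lo < cap by lia.
wps.
rewrite sM EX refE sL.
clear inp_ref inp_letter inp_pat.
have cE : (X - lo == X - lo) = true by exact: eqxx.
clearbody I.
wpif c1.
  have {}c1 : reference Z X < lo by move: c1; rewrite sL; case: ltnP.
  wps; wpif c2.
    wps; apply: new; hs; rewrite ?EX ?sM ?sL ?refE ?addn1 //; first by move=> x ne Hx; rewrite neq.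
    by rewrite cE; apply: entry_root.
  wps; apply: new; hs; rewrite ?EX ?sM ?sL ?refE ?addn1 //; first by move=> x ne Hx; rewrite neq.
  by rewrite cE; apply: entry_root => // E; move: c2; rewrite sHH -E.
have {}c1 : lo <= reference Z X by move: c1; rewrite sL; case: ltnP.
have Hent := HT1r c1; have [Hde _ _ _ _] := Hent.
have len_n : len (reference Z X) <= n by apply: leq_trans (len_le Z_ok _) _; lia.
have ltc : reference Z X - lo < cap by lia.
have nec : (reference Z X - lo == X - lo) = false by apply/eqP; lia.
clear HT1r.
do 3 (wps; rewrite ?EX ?sM ?sL ?refE ?cE ?nec).
wpif c2; (wps; rewrite ?EX ?sM ?sL ?refE ?cE ?nec; wpif c3).
all: wps; apply: new; hs; rewrite ?EX ?sM ?sL ?refE ?addn1 //; first by move=> x ne Hx; rewrite neq.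
all: rewrite ?cE; apply: (entry_step HXn Hent tE) => //.
all: rewrite sHH addn1 in c3; try by rewrite c2.
all: by move: c3; case: (_ =P h).
Qed.

(** The state of the climb from [z_i]: [cur] is the ancestor at distance [acc]. As the depth of
    [cur] is not known before the root is reached, two anchors [a1] and [a2] at distances [d1]
    and [d2] below [cur] are maintained, so that eventually the ancestor of [z_i] at depth [h]
    is at most [2 * h] steps above [a1]. *)
Definition walker (B i hi cur acc a1 d1 a2 d2 near : nat) : Prop :=
  [/\ cur = anc i acc /\ acc <= len i, cur < hi,
      exists2 e, a1 = anc i e & e + d1 = acc /\ (h <= d1 \/ e = 0),
      [/\ exists2 e, a2 = anc i e & e + d2 = acc, d2 < h & d1 <= d2 + 2 * h]
    & code B i = if near != 0 then near else code B cur].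

Lemma walker_init B i hi : i < hi -> walker B i hi i 0 i 0 i 0 0.
Proof. by move=> lti; split=> //; [exists 0 => //; split=> //; right | split=> //; exists 0]. Qed.

Section Jump.

Variables (B i hi lo cur acc a1 d1 a2 d2 near ex de lag nr : nat).
Hypothesis Hi : i <= n.
Hypothesis Hw : walker B i hi cur acc a1 d1 a2 d2 near.
Hypothesis He : entry B lo cur ex de lag nr.

Let near' := if near != 0 then near else nr.

Lemma jump_common : [/\ ex = anc i (acc + de) /\ acc + de <= len i, ex < lo
  & code B i = if near' != 0 then near' else code B ex].
Proof.
have [[cE le_acc] _ _ _ codeE1] := Hw; have [/andP[_ le_de] exE exlo _ codeE2] := He.
rewrite {1}exE cE anc_add; split=> //.
  by split=> //; move: le_de; rewrite cE len_anc //; lia.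
by rewrite codeE1 codeE2 /near'; case: ifP => // ->.
Qed.

Lemma jump_short : d2 + de < h -> walker B i lo ex (acc + de) a1 (d1 + de) a2 (d2 + de) near'.
Proof.
move=> ltd; have [? ? ?] := jump_common.
have [_ _ [e1 a1E [e1E Hd1]] [[e2 a2E e2E] ltd2 led1] _] := Hw.
split=> //; first by exists e1 => //; split; lia.
by split; [exists e2 => //; lia | lia | lia].
Qed.

Lemma jump_mid : de < h -> h <= d2 + de -> walker B i lo ex (acc + de) a2 (d2 + de) ex 0 near'.
Proof.
move=> ltd led; have [? ? ?] := jump_common.
have [_ _ _ [[e2 a2E e2E] ltd2 led1] _] := Hw.
split=> //; first by exists e2 => //; split; lia.
by split; [exists (acc + de); [case: jump_common => -[] | lia] | lia | lia].
Qed.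

Lemma jump_long : h <= de -> walker B i lo ex (acc + de) lag h ex 0 near'.
Proof.
move=> led; have [? ? ?] := jump_common.
have [[cE le_acc] _ _ _ _] := Hw; have [_ _ _ /(_ led) lagE _] := He.
split=> //.
  by exists (acc + (de - h)); [rewrite lagE cE anc_add | split; lia].
by split; [exists (acc + de); [case: jump_common => -[] | lia] | lia | lia].
Qed.

End Jump.

Lemma walker_weaken B i hi lo cur acc a1 d1 a2 d2 near : cur < lo ->
  walker B i hi cur acc a1 d1 a2 d2 near -> walker B i lo cur acc a1 d1 a2 d2 near.
Proof. by move=> ? []. Qed.

Definition walkers (st : hstate) (B E hi : nat) : Prop :=
  forall j, j < E - B -> walker B (B + j) hi (arrs st aCur j) (arrs st aAcc j) (arrs st aA1 j)
    (arrs st aD1 j) (arrs st aA2 j) (arrs st aD2 j) (arrs st aNear j).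

Lemma jump_spec st B E lo hi : env st -> vars st rLo = lo -> vars st rB = B -> vars st rE = E ->
  0 < lo <= hi -> hi <= lo + N -> hi <= n.+1 -> 0 < B <= E -> E <= B + N -> E <= n.+1 ->
  (forall x, lo <= x < hi ->
      entry B lo x (arrs st tEx (x - lo)) (arrs st tDe (x - lo)) (arrs st tLag (x - lo))
        (arrs st tNear (x - lo))) ->
  walkers st B E hi ->
  wp c_jump (fun st' _ => walkers st' B E lo) st (600 * (E - B) + 40).
Proof.
move=> Henv stL stB stE Hlo HloN Hhin HB HBE HEn Hent Hw; rewrite /c_jump.
wps.
apply: (@wp_weaken _ _ _ _ _ _ _ _ _ _ (600 * (E - B) + 20)); last lia.
pose Wk st' j hi := walker B (B + j) hi (arrs st' aCur j) (arrs st' aAcc j) (arrs st' aA1 j)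
    (arrs st' aD1 j) (arrs st' aA2 j) (arrs st' aD2 j) (arrs st' aNear j).
pose I st' b := exists X, [/\ vars st' rX = X, X <= E - B, b = 600 * (E - B - X) + 20,
   (forall j, j < X -> Wk st' j lo) & (forall j, X <= j < E - B -> Wk st' j hi)].
apply: (wp_loop (I := I)).
  by exists 0; split=> //; try lia; move=> j Hj; apply: Hw; lia.
move=> st' b [Fv Fa _] [X [EX HX -> HT1 HT2]].
have := Fv rLo isT; have := Fv rB isT; have := Fv rE isT; have := Fv rH isT; hs.
have := Fa tEx isT; have := Fa tDe isT; have := Fa tLag isT; have := Fa tNear isT; hs.
move=> sN sLg sD sX.
have [stM _ _ [stHH _] _] := Henv.
rewrite stL stB stE stHH => sHH sE sB sL; clear Fv Fa Henv stL stB stE stM stHH Hw.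
rewrite -sN -sLg -sD -sX in Hent; clear sN sLg sD sX st.
split; first by sides.
hs; rewrite EX sE sB; case: ifP => lt_x; last by split=> [|j Hj]; [lia | apply: HT1; lia].
have ltX : X < E - B by lia.
exists 570, (600 * (E - B - X.+1) + 20); split; first by lia.
have Hi : B + X <= n by lia.
have HwX := HT2 X; rewrite leqnn ltX in HwX; have {}HwX := HwX isT.
have new st1 : vars st1 rX = X.+1 ->
   (forall j, (j == X) = false -> [/\ arrs st1 aCur j = arrs st' aCur j,
     arrs st1 aAcc j = arrs st' aAcc j, arrs st1 aA1 j = arrs st' aA1 j /\ arrs st1 aD1 j = arrs st' aD1 j,
     arrs st1 aA2 j = arrs st' aA2 j /\ arrs st1 aD2 j = arrs st' aD2 j & arrs st1 aNear j = arrs st' aNear j]) ->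
   Wk st1 X lo -> I st1 (600 * (E - B - X.+1) + 20).
  move=> e1 e2 e3; exists X.+1; split=> //.
    move=> j; rewrite ltnS leq_eqVlt => /predU1P[->//|ltj].
    have [] := e2 j; first by rewrite ltn_eqF.
    by rewrite /Wk => -> -> [-> ->] [-> ->] ->; exact: HT1.
  move=> j Hj; have [] := e2 j; first by apply/eqP; lia.
  by rewrite /Wk => -> -> [-> ->] [-> ->] ->; apply: HT2; lia.
have Xcap : X < cap by lia.
have [[_ le_acc] ltcur [e1 _ [e1E _]] [[e2 _ e2E] _ _] _] := HwX.
have len_n : len (B + X) <= n by apply: leq_trans (len_le Z_ok _) _.
clear HT1 HT2 inp_ref inp_letter inp_pat; clearbody I; subst X lo.
pose c := arrs st' aCur (vars st' rX); pose q := c - vars st' rLo.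
wps.
wpif c1.
  wps; apply: new; hs; rewrite ?addn1 //.
  by apply: walker_weaken HwX; move: c1; case: ltnP.
have {}c1 : vars st' rLo <= c by move: c1; rewrite /c; case: ltnP.
have Hq : q < cap by rewrite /q; move: c1 ltcur; rewrite -/c; lia.
have Hec : entry B (vars st' rLo) c (arrs st' tEx q) (arrs st' tDe q) (arrs st' tLag q) (arrs st' tNear q).
  by apply: Hent; rewrite c1 ltcur.
have [[_ le_ad] _ _] := jump_common Hi HwX Hec.
clear Hent; rewrite /q /c in c1 Hq Hec le_ad.
wps.
wpif c2.
  have {}c2 : arrs st' tDe q < h by move: c2; rewrite sHH; case: ltnP.
  rewrite /q /c in c2.
  do 3 (wps; rewrite ?eqxx).
  wpif c3.
    have {}c3 : arrs st' aD2 (vars st' rX) + arrs st' tDe q < h.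
      by move: c3; rewrite eqxx sHH; case: ltnP.
    have J := jump_short Hi HwX Hec c3.
    do 3 (wps; rewrite ?eqxx).
    wpif c4; (do 2 (wps; rewrite ?eqxx)); apply: new; hs; rewrite ?addn1 //;
      [by move=> j -> | rewrite /Wk; hs; rewrite ?eqxx; move: J; rewrite c4 //
      |by move=> j -> | rewrite /Wk; hs; rewrite ?eqxx; move: J; rewrite c4 //].
  have {}c3 : h <= arrs st' aD2 (vars st' rX) + arrs st' tDe q.
    by move: c3; rewrite eqxx sHH; case: ltnP.
  have J := jump_mid Hi HwX Hec c2 c3.
  do 5 (wps; rewrite ?eqxx).
  wpif c4; (do 2 (wps; rewrite ?eqxx)); apply: new; hs; rewrite ?addn1 //;
    [by move=> j -> | rewrite /Wk; hs; rewrite ?eqxx; move: J; rewrite c4 //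
    |by move=> j -> | rewrite /Wk; hs; rewrite ?eqxx; move: J; rewrite c4 //].
have {}c2 : h <= arrs st' tDe q by move: c2; rewrite sHH; case: ltnP.
have J := jump_long Hi HwX Hec c2.
do 5 (wps; rewrite ?eqxx).
wpif c4; (do 2 (wps; rewrite ?eqxx)); apply: new; hs; rewrite ?addn1 //;
  [by move=> j -> | rewrite /Wk; hs; rewrite ?eqxx ?sHH; move: J; rewrite c4 //
  |by move=> j -> | rewrite /Wk; hs; rewrite ?eqxx ?sHH; move: J; rewrite c4 //].
Qed.

Lemma records_frame c st st' B : frame c st st' ->
  (rRec \notin vmods c) && all (fun x => x \notin amods c) [:: mIdx; mLen; mLink] ->
  records st B -> records st' B.
Proof.
by case=> Fv Fa _ /=; rewrite andbT => /and4P[? ? ? ?]; rewrite /records !Fv ?Fa.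
Qed.

Lemma walkers_frame c st st' B E hi : frame c st st' ->
  all (fun x => x \notin amods c) [:: aCur; aAcc; aA1; aD1; aA2; aD2; aNear] ->
  walkers st B E hi -> walkers st' B E hi.
Proof.
case=> _ Fa _ /=; rewrite andbT => /and5P[? ? ? ? /and3P[? ? ?]] H j Hj.
by rewrite !Fa //; exact: H.
Qed.

Lemma pass_spec st b B E : env st -> vars st rB = B -> vars st rE = E ->
  B = 1 + b * N -> B < E -> E <= B + N -> E <= n.+1 -> records st B -> walkers st B E E ->
  wp c_pass (fun st' _ => walkers st' B E 1) st (b.+1 * (1200 * N + 300) + 60).
Proof.
move=> Henv stB stE BE HBE HEN HEn Hrec Hw; rewrite /c_pass.
wps.
have [stRec _] := Hrec.
have HB : 0 < B <= n by lia.
apply: (@wp_weaken _ _ _ _ _ _ _ _ _ _ (b.+1 * (1200 * N + 300) + 20)); last lia.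
pose I st' b' := [/\ walkers st' B E (vars st' rHi),
  vars st' rPtr = rank (minn (vars st' rHi).-1 B.-1) &
  (exists r, [/\ vars st' rLo = 1 + r * N, r <= b, vars st' rLo < vars st' rHi <= n.+1,
     vars st' rHi <= vars st' rLo + N & b' = r.+1 * (1200 * N + 300) + 20]) \/
  [/\ vars st' rLo = 0, vars st' rHi = 1 & b' = 20]].
apply: (wp_loop (I := I)).
  split; hs; rewrite ?stE ?stRec //; first by f_equal; lia.
  by left; exists b; rewrite stB BE; split=> //; lia.
move=> st' b' F [Hw' HP HI].
have Henv' : env st' by apply: env_frame F _ _.
have Hrec' : records st' B by apply: records_frame F _ _.
have := F; case=> Fv _ _; have := Fv rB isT; have := Fv rE isT; hs; rewrite stB stE => sE sB.
clear F Fv Henv Hrec Hw.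
split; first by sides.
hs; case: HI => [[r [loE le_r Hhi HhiN ->]]|[-> hiE ->]]; last by rewrite -hiE; split; [lia | exact: Hw'].
have -> : vars st' rLo != 0 by rewrite loE.
exists (1200 * N + 280), (r * (1200 * N + 300) + 20); split; first by rewrite mulSn; lia.
have lo0 : 0 < vars st' rLo <= vars st' rHi by lia.
have NN : vars st' rHi - vars st' rLo <= N /\ E - B <= N by lia.
(* [id] hides nonlinear equations from [lia]. *)
have [credit crE] : exists credit, id (credit = r * (1200 * N + 300) + 20) by eexists.
rewrite -[r * _ + 20]crE.
have {}loE : id (vars st' rLo = 1 + r * N) by [].
have {}HEN' : id (B = 1 + b * N) by []; clear BE.
wps.
apply: (wp_use (load_spec erefl erefl lo0 HhiN _ Hrec' HB HP)); [lia | lia |].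
move=> st1 b1 [P1 T1] F1 le_b1; clear HP.
have Henv1 : env st1 by apply: env_frame F1 _ _.
have Hw1 : walkers st1 B E (vars st' rHi) by apply: walkers_frame F1 _ _.
case: F1 => Fv _ _; have := Fv rB isT; have := Fv rE isT; have := Fv rLo isT; have := Fv rHi isT.
rewrite sB sE => h1 l1 E1 B1; clear Fv Henv' Hrec'.
wps.
apply: (wp_use (sweep_spec Henv1 l1 h1 lo0 HhiN _ T1)); [lia | lia |].
move=> st2 b2 T2 F2 le_b2.
have Henv2 : env st2 by apply: env_frame F2 _ _.
have Hw2 : walkers st2 B E (vars st' rHi) by apply: walkers_frame F2 _ _.
case: F2 => Fv _ _; have := Fv rB isT; have := Fv rE isT; have := Fv rLo isT; have := Fv rPtr isT.
rewrite B1 E1 l1 P1 => P2 l2 E2 B2; clear Fv T1 Hw1 Henv1 Hw'.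
wps.
apply: (wp_use (jump_spec Henv2 l2 B2 E2 lo0 HhiN _ _ HEN HEn T2 Hw2)); [lia | lia | lia |].
move=> st3 b3 Hw3 F3 le_b3.
have Henv3 : env st3 by apply: env_frame F3 _ _.
have [_ _ _ _ blk3] := Henv3.
case: F3 => Fv _ _; have := Fv rB isT; have := Fv rE isT; have := Fv rLo isT; have := Fv rPtr isT.
rewrite B2 E2 l2 P2 => P3 l3 E3 B3; clear Fv T2 Hw2 Henv2 Henv3.
have b3_ge : 100 <= b3 by clear -le_b1 le_b2 le_b3 Hhi HhiN NN; lia.
clear le_b1 le_b2 le_b3 HEN' NN.
wps.
wpif c1; wps.
  split; hs; rewrite ?l3 //; left; exists r.-1; rewrite blk3.
  have {}c1 : N < vars st' rLo by move: c1; rewrite blk3 l3; case: ltnP.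
  rewrite /id in loE crE; have r0 : 0 < r by case: (r) loE c1 => //; lia.
  move: loE crE; rewrite -(prednK r0) mulSn /= => loE crE; clear -c1 le_r Hhi lo0 r0 N_gt0 loE crE.
  by split=> //; lia.
have {}c1 : vars st' rLo <= N by move: c1; rewrite blk3 l3; case: ltnP.
rewrite /id in loE crE; have r0 : r = 0.
  by case: (r) loE c1 => // r' ->; rewrite mulSn; lia.
have lo1 : vars st' rLo = 1 by rewrite loE r0.
split; hs; rewrite ?l3 ?lo1 //; first by rewrite -lo1.
  by rewrite P3 lo1.
by right; split; hs; rewrite ?l3 ?lo1 // crE r0.
Qed.

Definition window (X : seq nat) (e : nat) : seq nat :=
  drop (size X - e) X ++ nseq (2 * h - e) (nth 0 P 0).

Lemma size_window X e : e <= size X -> e <= 2 * h -> size (window X e) = 2 * h.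
Proof. by move=> *; rewrite size_cat size_drop size_nseq; lia. Qed.

Lemma take_letter X s f c : s < size X -> 0 < c <= n -> take s.+1 X = text Z f ++ phrase Z c ->
  nth 0 X s = letter Z c /\ take s X = text Z f ++ phrase Z (reference Z c).
Proof.
move=> lts Hc; rewrite (take_nth 0) // phraseE // -rcons_cat => H.
by case: (rcons_inj H).
Qed.

Lemma fill_spec st i x e : env st -> vars st rI = i -> vars st wX = x -> vars st wE = e ->
  0 < i <= n -> x <= i -> e <= size (text Z i ++ phrase Z x) -> e <= 2 * h ->
  wp c_fill (fun st' _ => forall j, j < 2 * h ->
      arrs st' aBuf j = nth 0 (window (text Z i ++ phrase Z x) e) j)
    st (600 * (2 * h) + 500).
Proof.
move=> Henv stI stX stE Hi Hx Hsz He; rewrite /c_fill.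
have [stM _ _ [_ stL] _] := Henv.
set X := text Z i ++ phrase Z x in Hsz *.
wps.
pose P1 st' := forall j, j < e -> arrs st' aBuf j = nth 0 X (size X - e + j).
pose I st' b := exists f c, [/\ vars st' wF = f, vars st' wX = c, 0 < f <= n /\ c <= n,
   vars st' wPos <= e /\ take (size X - (e - vars st' wPos)) X = text Z f ++ phrase Z c &
   (forall j, vars st' wPos <= j < e -> arrs st' aBuf j = nth 0 X (size X - e + j)) /\
   400 * vars st' wPos + (if c == 0 then 150 else 0) + 20 <= b].
apply: (wp_use (n := 400 * (2 * h) + 180) (P := P1)).
- apply: (@wp_weaken _ _ _ _ _ _ _ _ _ _ (400 * e + (if x == 0 then 150 else 0) + 20)).
    apply: (wp_loop (I := I)).
      exists i, x; hs; rewrite stE subnn subn0 take_size; split=> //; first by lia.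
      by split=> // j; lia.
    move=> st' b [Fv _ _] [f [c [EF EC [Hf Hc] [le_pos HT] [Hbuf le_b]]]].
    have := Fv rM isT; hs; rewrite stM => sM.
    clear Fv Henv stI stX stE stM stL.
    split; first by sides.
    hs; case: ifP => [pos0|/negbFE/eqP pos0]; last first.
      by split; [lia | move=> j Hj; apply: Hbuf; lia].
    exists 140, (if c == 0 then 400 * vars st' wPos + 20 else 400 * (vars st' wPos).-1 + 170).
    split; first by move: le_b; case: (c == 0); lia.
    wpif c1.
      rewrite EC in c1; rewrite (negbTE c1) {le_b}.
      have c_gt0 : 0 < c <= n by lia.
      have refE := inp_ref c_gt0; have lt_r := Z_ok c_gt0; have letE := inp_letter c_gt0.
      rewrite -sM -EC in refE letE.
      have [p EP] : exists p, vars st' wPos = p.+1 by exists (vars st' wPos).-1; lia.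
      rewrite EP in HT le_pos Hbuf.
      have sE : size X - (e - p.+1) = (size X - e + p).+1 by lia.
      have sE' : size X - (e - p) = size X - e + p by lia.
      rewrite sE in HT; have [|nE tE] := take_letter _ c_gt0 HT; first lia.
      have bufcap : vars st' wPos - 1 < cap by lia.
      wps.
      exists f, (reference Z c); hs; split=> //; [by rewrite refE EC | by lia | |].
        by rewrite EP subn1 sE'; split; [lia | exact: tE].
      rewrite EP subn1 /=; split; last by case: eqP; lia.
      move=> j Hj; rewrite letE EC; case: (j =P p) => [->//|ne]; apply: Hbuf; lia.
    have {}c1 : c = 0 by rewrite -EC.
    rewrite c1 eqxx.
    rewrite c1 phrase0 // cats0 in HT.
    have f1 : 1 < f.
      case: (ltngtP f 1) => // [|f1]; first by lia.
      by have := congr1 size HT; rewrite f1 text1 // size_take /=; case: ifP; lia.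
    have tE : text Z f = text Z f.-1 ++ phrase Z f.-1.
      by rewrite -textS //; [rewrite prednK //; lia | lia].
    wps.
    exists f.-1, f.-1; hs; rewrite EF subn1.
    have -> : (f.-1 == 0) = false by apply/eqP; lia.
    by split=> //; [lia | rewrite -tE | split=> //; lia].
- by case: eqP; lia.
- lia.
move=> st' b' Hbuf F le_b; have [Fv _ _] := F.
have := Fv rL isT; have := Fv wE isT; hs; rewrite stL stE => sE sL.
clear F Fv I; clearbody X.
wps.
apply: (@wp_weaken _ _ _ _ _ _ _ _ _ _ (150 * (2 * h - e) + 20)); last lia.
pose I st2 b := exists p, [/\ vars st2 wPos = p, e <= p <= 2 * h,
   (forall j, j < p -> arrs st2 aBuf j = nth 0 (window X e) j) & 150 * (2 * h - p) + 20 <= b].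
have sz : size (window X e) = 2 * h by apply: size_window.
have szd : size (drop (size X - e) X) = e by rewrite size_drop; lia.
apply: (wp_loop (I := I)).
  exists e; hs; rewrite sE; split=> //; first by lia.
  by move=> j Hj; rewrite Hbuf // nth_cat szd Hj nth_drop.
move=> st2 b2 [Fv _ _] [p [EP Hp Hb le_b2]].
have := Fv rL isT; hs; rewrite sL => sL2; clear Fv.
split; first by sides.
hs; case: ifP => lt_p; last first.
  by split; [lia | move=> j Hj; apply: Hb; lia].
exists 100, (150 * (2 * h - p.+1) + 20); split; first by lia.
have patE := inp_pat m_gt0.
have pcap : vars st2 wPos < cap by lia.
wps.
exists p.+1; hs; rewrite EP addn1; split=> //; first by lia.
move=> j; rewrite ltnS leq_eqVlt => /predU1P[->|ltj]; last by rewrite ltn_eqF //; exact: Hb.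
by rewrite eqxx -[4]addn0 patE nth_cat szd ifN ?nth_nseq; [rewrite ifT //; lia | lia].
Qed.

Notation Q := (decompress Z).

Lemma run_spec st i x d T : env st -> vars st rI = i -> vars st wX = x -> vars st wD = d ->
  vars st wT = T -> 0 < i <= n -> x <= i -> take T Q = text Z i ++ phrase Z x ->
  T <= u -> d <= h -> d <= T ->
  wp c_run (fun st' _ => exists o,
      [/\ outs st' = outs st ++ o, perm_eq o [seq j <- matches k P Q | T - d < j <= T]
        & (vars st' wFlag != 0) = (o != [::])])
    st (1200 * h + 240 * aT + 800).
Proof.
move=> Henv stI stX stD stT Hi Hx HT Tu dh dT; rewrite /c_run.
have [stM _ stK [_ stL] _] := Henv.
pose e := minn T (2 * h); pose X := text Z i ++ phrase Z x.
have szX : size X = T by rewrite /X -HT size_takel.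
apply: wp_seq; first by lia.
apply: (wp_use (n := 20) (P := fun st' => vars st' wE = e)).
- wpif c1; wps; rewrite /e ?stT ?stL in c1 *; move: c1; case: ltnP => //; lia.
- lia.
move=> st1 b1 E1 F1 le_b1.
have Henv1 : env st1 by apply: env_frame F1 _ _.
have [Fv _ Fo] := F1; have := Fv rI isT; have := Fv wX isT; have := Fv wD isT; have := Fv wT isT.
have {}Fo := Fo isT; rewrite stI stX stD stT => T1 D1 X1 I1.
clear F1 Fv Henv stM stL stK.
have eX : e <= size X by rewrite szX geq_minl.
have eh : e <= 2 * h by exact: geq_minr.
wps.
apply: (wp_use (fill_spec Henv1 I1 X1 E1 Hi Hx eX eh)); first by lia.
rewrite -/X; set Wn := window X e.
move=> st2 b2 Hbuf F2 le_b2.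
have Henv2 : env st2 by apply: env_frame F2 _ _.
have [Fv _ Fo2] := F2; have := Fv wD isT; have := Fv wT isT; have := Fv wE isT.
have {}Fo2 := Fo2 isT; rewrite T1 D1 E1 => E2 T2 D2.
clear F2 Fv Henv1.
have eT : e <= T by exact: geq_minl.
have de : d <= e by rewrite leq_min dT; lia.
have eE : id (e = minn T (2 * h)) by [].
clearbody e.
wps.
have [stM _ stK [_ stL] _] := Henv2.
have szW : size Wn = 2 * h by apply: size_window.
pose J o st' := [/\ [/\ vars st' rM = m, vars st' rL = 2 * h & vars st' rK = k],
  [/\ vars st' wE = e, vars st' wLo = e - d & vars st' wOff = T - e],
  forall j, j < 2 * h -> arrs st' aBuf j = nth 0 Wn j,
  outs st' = outs st ++ [seq y + (T - e) | y <- o & e - d < y <= e] &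
  (vars st' wFlag != 0) = has (fun y => e - d < y <= e) o].
rewrite -/X in HT; clearbody X; apply: (wp_sim (S := text_input k P Wn) (J := J) (C := 200)) => //.
- apply: ainp_text => //.
  rewrite all_cat; apply/andP; split.
    have : all Sigma (take T Q).
      by apply/allP => y /mem_take yQ; exact: (allP Sigma_text).
    rewrite HT => /allP HX; apply/allP => y /mem_drop; exact: HX.
  by apply/allP => y /nseqP[-> _]; apply: (allP Sigma_pat); exact: mem_nth.
- by split=> //=; rewrite ?Fo2 ?Fo ?cats0 ?E2 ?D2 ?T2.
- move=> o st' [[sM sL sK] [sE sLo sOff] sB sO sF].
  have Jst v : J o (setv st' sim_val v) by [].
  clear Hbuf stM stK stL E2 T2 D2 Henv2 eT de eh eX Fo2 I1 X1 D1 T1 E1 Fo sO sF sE sLo sOff dT dh HT szX Tu le_b2.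
  have nthE z : nth 0 (text_input k P Wn) (z + 3) = if z < m then nth 0 P z else nth 0 Wn (z - m).
    by rewrite addn3 /= nth_cat.
  have y3 : 3 <= vars st' sim_adr -> vars st' sim_adr = vars st' sim_adr - 3 + 3 by lia.
  have adr_lt : vars st' sim_adr < 3 + vars st' rM -> vars st' sim_adr + 1 < W by lia.
  have adr_lt2 : vars st' sim_adr < 3 + vars st' rM + vars st' rL ->
    vars st' sim_adr - (3 + vars st' rM) < cap by lia.
  rewrite /c_rd.
  wpifb c1.
    wpifb c2; first by wps; split=> //; rewrite (eqP c2) sM.
    wpifb c3; first by wps; split=> //; rewrite (eqP c3) sL -szW.
    have E2' : vars st' sim_adr = 2 by lia.
    by wps; split=> //; rewrite sK E2'.
  have {}y3 : vars st' sim_adr = vars st' sim_adr - 3 + 3 by apply: y3; rewrite leqNgt c1.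
  wpifb c2.
    have {}adr_lt := adr_lt c2.
    wps; split=> //; rewrite {2}y3 nthE ifT; last by lia.
    by rewrite -inp_pat; [f_equal; lia | lia].
  wpifb c3.
    have {}adr_lt2 := adr_lt2 c3.
    wps; split=> //; rewrite {2}y3 nthE ifF; last by lia.
    by rewrite sB; [f_equal; lia | lia].
  wps; split=> //; rewrite y3 nthE ifF; last by lia.
  by rewrite nth_default // szW; lia.
- move=> o st' [[sM sL sK] [sE sLo sOff] sB sO sF].
  clear Hbuf stM stK stL E2 T2 D2 Henv2 eX Fo2 I1 X1 D1 T1 E1 Fo dT HT szX le_b2.
  have has_rcons : has (fun y => e - d < y <= e) (rcons o (vars st' sim_val)) =
    (e - d < vars st' sim_val <= e) || has (fun y => e - d < y <= e) o by rewrite has_rcons.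
  have filter_r : [seq y + (T - e) | y <- rcons o (vars st' sim_val) & e - d < y <= e] =
     if e - d < vars st' sim_val <= e then rcons [seq y + (T - e) | y <- o & e - d < y <= e] (vars st' sim_val + (T - e))
     else [seq y + (T - e) | y <- o & e - d < y <= e].
    by rewrite filter_rcons; case: ifP => // _; rewrite map_rcons.
  have new : forall st3, arrs st3 = arrs st' ->
    [/\ vars st3 rM = m, vars st3 rL = 2 * h & vars st3 rK = k] ->
    [/\ vars st3 wE = e, vars st3 wLo = e - d & vars st3 wOff = T - e] ->
    outs st3 = (if e - d < vars st' sim_val <= e then rcons (outs st') (vars st' sim_val + (T - e)) else outs st') ->
    (vars st3 wFlag != 0) = (e - d < vars st' sim_val <= e) || (vars st' wFlag != 0) ->
    J (rcons o (vars st' sim_val)) st3.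
    move=> st3 e1 e2 e3 e4 e5; split=> //; first by rewrite e1.
      by rewrite e4 filter_r sO; case: ifP => // _; rewrite rcons_cat.
    by rewrite e5 sF has_rcons.
  clear has_rcons filter_r sB sO sF; clearbody J.
  rewrite /c_cb; wpifb c1.
    wpifb c2.
      have {}c2 : vars st' sim_val <= e by lia.
      wps; split=> //; apply: new => //=; rewrite -?sLo c1 c2 //= sOff //.
    have {}c2 : (vars st' sim_val <= e) = false by lia.
    by wps; split=> //; apply: new => //=; rewrite -?sLo c1 c2.
  by wps; split=> //; apply: new => //=; rewrite -?sLo c1.
- by lia.
move=> o st' Po [_ _ _ sO sF]; have {}Po := apost_text szW Po.
exists [seq y + (T - e) | y <- o & e - d < y <= e]; split=> //.
  have eE' : e = minn T (2 * h) by [].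
  have tW : take e Wn = drop (T - e) (take T Q) by rewrite take_size_cat ?HT ?szX // size_drop szX; lia.
  apply: perm_trans (matches_window (Q := Q) (erefl h) eE' Tu dT dh szW tW).
  exact/perm_map/perm_filter.
by rewrite sF has_count -size_filter; case: [seq y <- o | _].
Qed.

Definition climbed (st : hstate) (B i : nat) : Prop :=
  walker B i 1 (arrs st aCur (i - B)) (arrs st aAcc (i - B)) (arrs st aA1 (i - B))
    (arrs st aD1 (i - B)) (arrs st aA2 (i - B)) (arrs st aD2 (i - B)) (arrs st aNear (i - B)).

Lemma climbed_acc st B i : i <= n -> climbed st B i -> arrs st aAcc (i - B) = len i.
Proof.
move=> Hi [[cE le_acc] lt1 _ _ _]; have := len_anc Z_ok Hi le_acc.
rewrite -cE (_ : arrs st aCur _ = 0); last by lia.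
by rewrite len0; lia.
Qed.

Lemma climbed_near st B i : i <= n -> climbed st B i -> arrs st aNear (i - B) = code B i.
Proof.
move=> Hi [_ lt1 _ _ ->]; case: eqP => [-> /=|//].
by rewrite (_ : arrs st aCur _ = 0) ?code0 //; lia.
Qed.

Lemma climbed_anchor st B i : i <= n -> climbed st B i -> h < len i ->
  exists2 e, arrs st aA1 (i - B) = anc i e & e + arrs st aD1 (i - B) = len i /\
    h <= arrs st aD1 (i - B) <= 3 * h.
Proof.
move=> Hi Hc lth; have accE := climbed_acc Hi Hc; have [_ _ [e aE [eE He]] [_ lt2 le1] _] := Hc.
by exists e => //; split; [lia | case: He => ?; lia].
Qed.

Lemma locate_spec st B i : env st -> vars st rI = i -> vars st rB = B -> B <= i -> 0 < i <= n ->
  i - B < cap -> climbed st B i ->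
  wp c_locate (fun st' _ => [/\ vars st' rA = i - B, vars st' rLen = len i,
      vars st' wD = minn h (len i) & vars st' wX = anc i (len i - minn h (len i))])
    st (140 * h + 200).
Proof.
move=> Henv stI stB HB Hi Hcap Hc; have Hin : i <= n by lia.
have [stM _ _ [stH _] _] := Henv; have accE := climbed_acc Hin Hc.
rewrite /c_locate; subst i B.
wps; rewrite accE.
wpifb c1; rewrite stH in c1; last first.
  have E : minn h (len (vars st rI)) = len (vars st rI) by lia.
  by wps; split; hs => //; rewrite E // subnn.
have [e aE [eE Hd]] := climbed_anchor Hin Hc c1.
have E : minn h (len (vars st rI)) = h by lia.
wps; rewrite aE.
set i := vars st rI in Hi Hin c1 E eE aE *; set d := arrs st aD1 _ in eE Hd *.
apply: (wp_use (n := 60 * (d - h) + 20) (P := fun st' => vars st' wX = anc i (len i - h))).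
- apply: (wp_loop (I := fun st' b => exists q, [/\ vars st' rQ = q, h <= q <= d,
     vars st' wX = anc i (len i - q) & 60 * (q - h) + 20 <= b])).
    by exists d; hs; split=> //; [lia | f_equal; lia].
  move=> st' b [Fv _ _] [q [EQ Hq EX le_b]].
  have := Fv rH isT; have := Fv rM isT; hs; rewrite stH stM => sM sH.
  split; first by sides.
  hs; rewrite EQ sH; case: ifP => ltq; last first.
    by split; [lia | rewrite EX; f_equal; f_equal; lia].
  have Hx : 0 < anc i (len i - q) <= n.
    rewrite anc_gt0 //; apply/andP; split; first by lia.
    by apply: leq_trans (anc_le _ _ _) _.
  have refE := inp_ref Hx; rewrite -EX -sM in refE.
  exists 30, (60 * (q.-1 - h) + 20); split; first by lia.
  clear Fv; wps.
  exists q.-1; rewrite EQ; split=> //; try lia.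
  rewrite refE EX -/(anc 1 _); have -> : len i - q.-1 = (len i - q) + 1 by lia.
  by rewrite anc_add.
- lia.
move=> st' b' EX F le_b; have [Fv _ _] := F; have := Fv rH isT; have := Fv rA isT; have := Fv rLen isT.
hs; rewrite stH => sLen sA sH; clear F Fv.
by wps; rewrite E sH sLen sA.
Qed.

Lemma chain_spec st B i : env st -> vars st rI = i -> vars st rB = B -> vars st rA = i - B ->
  vars st rV = start Z i -> B <= i -> 0 < i <= n -> i - B < cap -> records st i ->
  arrs st aNear (i - B) = code B i ->
  (forall y, B <= y < i -> arrs st aNear (y - B) = code y.+1 y) ->
  wp c_chain (fun st' _ => vars st' rG = code i (reference Z i) /\
      outs st' = outs st ++
        [seq start Z i + len y | y <- [seq y <- ancestors Z (reference Z i) | marked y]])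
    st (80 * size [seq y <- ancestors Z (reference Z i) | marked y] + 150).
Proof.
move=> Henv stI stB stA stV HB Hi Hcap [_ Hrec] nearB near.
have [stM _ _ _ _] := Henv; rewrite /c_chain.
have refE := inp_ref Hi; rewrite -stM -stI in refE; have lt_r := Z_ok Hi.
have HV : start Z i <= u by apply: start_le_size; lia.
wps; rewrite refE stI.
apply: (wp_use (n := 40) (P := fun st' => vars st' rG = code i (reference Z i))).
- wpifb c1; rewrite stB in c1.
    wps; rewrite stA nearB code_skip //; apply: code_bound => //; lia.
  have le_c : reference Z i - B < cap by lia.
  wps; rewrite stB near; [|lia].
  by apply: code_bound => //; lia.
- lia.
move=> st1 b1 G1 [Fv Fa Fo] le_b1.
have := Fv rV isT; have := Fa mLen isT; have := Fa mLink isT; have := Fo isT; hs.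
rewrite stV => O1 K1 L1 V1; clear Fv Fa Fo near nearB.
wps.
have Hr : reference Z i <= n by lia.
pose R0 := outs st ++ [seq start Z i + len y | y <- [seq y <- ancestors Z (reference Z i) | marked y]].
apply: (@wp_weaken _ _ _ _ _ _ _ _ _ _ (80 * size [seq y <- ancestors Z (reference Z i) | marked y] + 20)); last by lia.
apply: (wp_loop (I := fun st' b => exists x, [/\ x < i, vars st' rQ = code x.+1 x, vars st' rG = code i (reference Z i),
   outs st' ++ [seq start Z i + len y | y <- [seq y <- ancestors Z x | marked y]] = R0 &
   80 * size [seq y <- ancestors Z x | marked y] + 20 <= b])).
  exists (reference Z i); hs; rewrite O1; split=> //.
  by rewrite G1; apply: code_bound => //; lia.
move=> st' b [Fv Fa _] [x [ltx EQ EG EO le_b]].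
have := Fv rV isT; have := Fa mLen isT; have := Fa mLink isT; hs; rewrite V1 K1 L1 => K2 L2 V2; clear Fv Fa.
split; first by sides.
have Hx : x <= n by lia.
hs; case: ifP => [q0|/negbFE/eqP q0]; last first.
  rewrite q0 in EQ; rewrite (chain_nil Z_ok Hx (esym EQ)) /= cats0 in EO le_b.
  by split; [lia | split].
have q_gt0 : 0 < vars st' rQ by rewrite lt0n.
have [y [Hy my ry chE]] := chain_cons Z_ok Hx (esym EQ) q_gt0.
rewrite chE /= in EO le_b.
have [|_ lenE' linkE] := Hrec y _ my; first by lia.
have rcap : rank y <= cap by apply: rank_cap; lia.
have qE : vars st' rQ - 1 = (rank y).-1 by rewrite ry subn1.
have lenle : len y <= n by apply: leq_trans (len_le Z_ok _) _; lia.
exists 60, (80 * size [seq y <- ancestors Z (reference Z y) | marked y] + 20); split; first by lia.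
have lt_ry : reference Z y < y by apply: Z_ok; lia.
have l2 : arrs st' mLen (vars st' rQ - 1) = len y by rewrite L2 qE.
have k2 : arrs st' mLink (vars st' rQ - 1) = code (reference Z y).+1 (reference Z y).
  by rewrite K2 qE linkE; apply: code_bound => //; lia.
clear Hrec chE K2 L2 linkE lenE' K1 L1; move: EO; rewrite -cat_rcons => EO.
wps; exists (reference Z y); rewrite k2 l2 V2; split=> //; lia.
Qed.

Lemma mark_spec st B i : env st -> vars st rI = i -> vars st rB = B -> vars st rA = i - B ->
  vars st rLen = len i -> vars st rV = start Z i -> vars st rG = code i (reference Z i) ->
  B <= i -> 0 < i <= n -> i - B < cap -> records st i ->
  wp c_mark (fun st' _ => [/\ records st' i.+1, vars st' rV = start Z i.+1, vars st' rI = i.+1,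
      (forall j, arrs st' aNear j = if j == i - B then code i.+1 i else arrs st aNear j) &
      exists o, outs st' = outs st ++ o /\
        perm_eq o (if h < len i then [seq j <- matches k P Q | start Z i.+1 - 1 < j <= start Z i.+1]
                   else [::])])
    st (1200 * h + 240 * aT + 1500).
Proof.
move=> Henv stI stB stA stL stV stG HB Hi Hcap Hrec; have Hin : i <= n by lia.
have [stM _ _ [stH _] _] := Henv; rewrite /c_mark.
have HV : start Z i + len i <= u by rewrite -size_text //; apply: start_le_size; lia.
have codeE' : code i.+1 i = if marked i then rank i else code i (reference Z i).
  rewrite codeE // ltnSn andbT; case: ifP => // _.
  by apply: code_bound => //; have := Z_ok Hi; lia.
have rankE : rank i = rank i.-1 + marked i.
  by case/andP: Hi; case: (i) => // i' _ _; rewrite rankS.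
have lenn : len i <= n by apply: leq_trans (len_le Z_ok _) _.
have rcap : rank i <= cap by apply: rank_cap.
have recS st' : vars st' rRec = rank i ->
    (forall y, 0 < y < i -> marked y ->
       [/\ arrs st' mIdx (rank y).-1 = y, arrs st' mLen (rank y).-1 = len y
         & arrs st' mLink (rank y).-1 = code y (reference Z y)]) ->
    (marked i -> [/\ arrs st' mIdx (rank i).-1 = i, arrs st' mLen (rank i).-1 = len i
         & arrs st' mLink (rank i).-1 = code i (reference Z i)]) -> records st' i.+1.
  move=> e1 e2 e3; split=> // y; rewrite ltnS => Hy my.
  case: (ltngtP y i) => [lti||E]; [by apply: e2; lia | by lia | by rewrite E in my *; exact: e3].
have [stR Hrec'] := Hrec.
wps; rewrite stV stL.
pose o1 := [seq j <- matches k P Q | start Z i.+1 - 1 < j <= start Z i.+1].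
apply: (wp_use (n := 1200 * h + 240 * aT + 1200)
  (P := fun st' => [/\ records st' i.+1, vars st' rG = code i.+1 i &
      exists o, outs st' = outs st ++ o /\ perm_eq o (if h < len i then o1 else [::])])).
- wpifb c1; rewrite stH ?stL in c1; last first.
    wps; have mF : marked i = false by apply/negbTE/nandP; left; rewrite -/h c1.
    rewrite mF addn0 in rankE codeE'; split.
    + by apply: recS; rewrite ?mF //= stR.
    + by rewrite /= stG.
    + by rewrite c1; exists [::]; rewrite cats0.
  wps.
  set stx := setv _ wD 1.
  have takeE : take (start Z i + len i) Q = text Z i ++ phrase Z i.
    by have := take_phrase Z_ok Hin (leq0n _); rewrite subn0.
  have h0 := h_gt0.
  have Henvx : env stx by exact: Henv.
  apply: (wp_use (run_spec (T := start Z i + len i) (d := 1) (x := i) Henvx stI _ _ _ Hi (leqnn _) takeE HV _ _)) => //; try lia.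
  move=> st' b' [o [Oo Po Fl]] F le_b; have [Fv Fa _] := F.
  have := Fv rI isT; have := Fv rLen isT; have := Fv rG isT; have := Fv rRec isT.
  have := Fa mIdx isT; have := Fa mLen isT; have := Fa mLink isT.
  rewrite /stx; hs; rewrite stI stL stG stR => A15 A14 A13 vR vG vL vI.
  have mE : marked i = (o != [::]).
    have := @marked_matches Z Z_ok k P i 0 Hin; rewrite len_gt0 // /anc /= -/h c1 andbT => <-; last by case/andP: Hi.
    rewrite -size_eq0 (perm_size Po) size_filter -lt0n -has_count.
    apply/idP/hasP => [H|[j jm Hj]]; first by exists (start Z i + len i) => //; clear -c1; lia.
    by have -> : start Z i + len i = j by clear -c1 Hj; lia.
  have EO : exists o, outs st' = outs st ++ o /\ perm_eq o (if h < len i then o1 else [::]).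
    by exists o; split; [exact: Oo | rewrite c1 /o1 size_text].
  have Hrecy y : 0 < y < i -> marked y -> (rank y).-1 != rank i.-1.
    move=> Hy my; have := @rank_gt0 Z k P y; have : rank y <= rank i.-1 by apply: rank_le; clear -Hy; lia.
    by move=> le1 /(_ _ my); case/andP: Hy => y0 _ /(_ y0); clear -le1; lia.
  have {}le_b : 150 <= b' by clear -le_b; lia.
  clear Po Fv Fa F Hrec HV takeE lenn.
  wpif c2.
    rewrite Fl -mE in c2; rewrite c2 addn1 in rankE; rewrite c2 in codeE'.
    have rc : rank i.-1 < cap by lia.
    wps; split; [|by hs; rewrite vR codeE'; lia | exact: EO].
    apply: recS; hs; rewrite ?vR ?vI ?vL ?vG; first lia.
      move=> y Hy my; rewrite !(negbTE (Hrecy y Hy my)) A13 A14 A15; exact: Hrec'.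
    by move=> _; rewrite rankE /= eqxx.
  have mF : marked i = false by rewrite mE -Fl c2.
  rewrite mF addn0 in rankE codeE'.
  wps; split; [| by rewrite vG codeE' | exact: EO].
  by apply: recS; rewrite ?mF // ?vR // A13 A14 A15.
- lia.
move=> st' b' [R1 G1 O1] F le_b; have [Fv Fa _] := F.
have := Fv rI isT; have := Fv rV isT; have := Fv rA isT; have := Fa aNear isT; hs.
rewrite stI stA => A8 vA vV vI; clear F Fv Fa recS.
wps; split=> //; hs; rewrite ?vV ?size_text // ?vI ?addn1 //.
by move=> j; rewrite vA G1 A8.
Qed.

Definition in_block (st : hstate) (B E i : nat) : Prop :=
  [/\ env st /\ records st i, [/\ vars st rB = B, vars st rE = E & vars st rI = i],
      vars st rV = start Z i,
      forall y, B <= y < i -> arrs st aNear (y - B) = code y.+1 y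
    & forall y, i <= y < E -> climbed st B y].

Definition c_element : hcmd := c_locate ;; wT ::= $rV :+ $wD ;; c_run ;; c_chain ;; c_mark.

Lemma element_matches i oa ob oc : 0 < i <= n ->
  perm_eq oa [seq j <- matches k P Q | start Z i + minn h (len i) - minn h (len i) < j <= start Z i + minn h (len i)] ->
  perm_eq ob [seq j <- matches k P Q | start Z i + h < j < start Z i + len i] ->
  perm_eq oc (if h < len i then [seq j <- matches k P Q | start Z i.+1 - 1 < j <= start Z i.+1] else [::]) ->
  perm_eq (oa ++ ob ++ oc) [seq j <- matches k P Q | start Z i < j <= start Z i.+1].
Proof.
move=> Hi Pa Pb Pc; have Hin : i <= n by lia.
have sz := size_text Hin.
apply/permP => p; rewrite !count_cat (permP Pa) (permP Pb) (permP Pc).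
have -> : count p (if h < len i then [seq j <- matches k P Q | start Z i.+1 - 1 < j <= start Z i.+1] else [::]) =
  count p [seq j <- matches k P Q | (h < len i) && (start Z i.+1 - 1 < j <= start Z i.+1)].
  by case: (h < len i) => //=; rewrite filter_pred0.
move: (matches k P Q) => l; rewrite !count_filter addnA; elim: l => //= j l IH.
have -> : (p j && (start Z i < j <= start Z i.+1) : nat) =
  (p j && (start Z i + minn h (len i) - minn h (len i) < j <= start Z i + minn h (len i))) +
  (p j && (start Z i + h < j < start Z i + len i)) +
  (p j && ((h < len i) && (start Z i.+1 - 1 < j <= start Z i.+1))).
  by case: (p j) => //=; have len_pos : 0 < len i by [rewrite len_gt0 //; case/andP: Hi]; lia.
by move: IH; lia.
Qed.

Lemma element_spec st B E i : in_block st B E i -> 0 < B <= i -> i < E -> E <= n.+1 -> E <= B + N ->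
  wp c_element (fun st' _ => in_block st' B E i.+1 /\
      exists o, outs st' = outs st ++ o /\
        perm_eq o [seq j <- matches k P Q | start Z i < j <= start Z i.+1])
    st (2600 * h + 480 * aT + 3000 +
        80 * size [seq j <- matches k P Q | start Z i < j <= start Z i.+1]).
Proof.
move=> [[Henv Hrec] [stB stE stI] stV near clm] HB Hi HE HEN; rewrite /c_element.
have Hin : 0 < i <= n by lia.
have Hin' : i <= n by lia.
have Hcap : i - B < cap by lia.
have HB' : B <= i by lia.
have Hci : climbed st B i by apply: clm; rewrite leqnn.
have HV : start Z i + len i <= u by rewrite -size_text //; apply: start_le_size; lia.
set ch := [seq y <- ancestors Z (reference Z i) | marked y].
have chain_le : size ch <= size [seq j <- matches k P Q | start Z i < j <= start Z i.+1].
  rewrite -(size_map (fun y => start Z i + len y)) (perm_size (perm_chain Z_ok k P Hin)).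
  rewrite !size_filter; apply: sub_count => j /=; rewrite size_text //.
  by rewrite -/h; lia.
set sz := size [seq j <- _ | _] in chain_le *.
have d_le : minn h (len i) <= h by exact: geq_minl.
have d_le2 : minn h (len i) <= len i by exact: geq_minr.
have [dE'] : exists d, id (d = minn h (len i)) by eexists.
move=> dE; rewrite /id in dE.
wps.
apply: (wp_use (locate_spec Henv stI stB HB' Hin Hcap Hci)); first by lia.
rewrite -dE in d_le d_le2 *.
move=> st1 b1 [A1 L1 D1 X1] F1 le_b1.
have Henv1 : env st1 by apply: env_frame F1 _ _.
have Hrec1 : records st1 i by apply: records_frame F1 _ _.
have [Fv Fa Fo] := F1.
have := Fv rI isT; have := Fv rB isT; have := Fv rE isT; have := Fv rV isT; have := Fa aNear isT; have := Fo isT.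
rewrite stB stI stE stV => O1 N1 V1 E1 B1 I1.
have clm1 y : i <= y < E -> climbed st1 B y by move/clm; rewrite /climbed !Fa.
clear F1 Fv Fa Fo clm Henv Hrec Hci stB stE stI stV; rewrite -O1 -N1 in near *; clear O1 N1 st.
wps; rewrite V1 D1.
set st2 := setv st1 wT _.
have takeE : take (start Z i + dE') Q = text Z i ++ phrase Z (anc i (len i - dE')).
  by rewrite -take_phrase //; [f_equal; lia | lia].
have Henv2 : env st2 by exact: Henv1.
have Xle : anc i (len i - dE') <= i by apply: anc_le.
have Tu : start Z i + dE' <= u by lia.
have dT : dE' <= start Z i + dE' by rewrite leq_addl.
apply: (wp_use (run_spec (st := st2) Henv2 I1 X1 D1 erefl Hin Xle takeE Tu d_le dT)); first by lia.
move=> st3 b3 [oa [Oa Pa _]] F3 le_b3.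
have Henv3 : env st3 by apply: env_frame F3 _ _.
have Hrec3 : records st3 i by apply: records_frame F3 _ _.
have [Fv Fa _] := F3.
have := Fv rI isT; have := Fv rB isT; have := Fv rE isT; have := Fv rV isT; have := Fv rA isT; have := Fv rLen isT; have := Fa aNear isT.
rewrite /st2; hs; rewrite I1 B1 E1 V1 A1 L1 => N3 L3 A3 V3 E3 B3 I3.
have clm3 y : i <= y < E -> climbed st3 B y by move/clm1; rewrite /climbed !Fa.
rewrite /= in Oa; clear F3 Fv Fa clm1 Henv1 Hrec1 Henv2 L1 A1 V1 E1 B1 I1 D1 X1 takeE Xle dT.
rewrite -N3 in near; clear N3.
have nearB : arrs st3 aNear (i - B) = code B i by apply: climbed_near => //; apply: clm3; rewrite leqnn.
wps.
apply: (wp_use (chain_spec Henv3 I3 B3 A3 V3 HB' Hin Hcap Hrec3 nearB near)); first by rewrite -/ch; lia.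
move=> st4 b4 [G4 O4] F4 le_b4.
have Henv4 : env st4 by apply: env_frame F4 _ _.
have Hrec4 : records st4 i by apply: records_frame F4 _ _.
have [Fv Fa _] := F4.
have := Fv rI isT; have := Fv rB isT; have := Fv rE isT; have := Fv rV isT; have := Fv rA isT; have := Fv rLen isT; have := Fa aNear isT.
rewrite I3 B3 E3 V3 A3 L3 => N4 L4 A4 V4 E4 B4 I4.
have clm4 y : i <= y < E -> climbed st4 B y by move/clm3; rewrite /climbed !Fa.
clear F4 Fv Fa clm3 Henv3 Hrec3 L3 A3 V3 E3 B3 I3.
rewrite -N4 in near; clear N4 nearB.
rewrite -/ch in le_b4 O4.
apply: (wp_use (mark_spec Henv4 I4 B4 A4 L4 V4 G4 HB' Hin Hcap Hrec4)); first by lia.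
move=> st5 b5 [Hrec5 V5 I5 N5 [oc [Oc Pc]]] F5 _.
have Henv5 : env st5 by apply: env_frame F5 _ _.
have [Fv Fa _] := F5; have := Fv rB isT; have := Fv rE isT; rewrite E4 B4 => E5 B5.
split; last first.
  exists (oa ++ [seq start Z i + len y | y <- ch] ++ oc); split; first by rewrite Oc O4 Oa !catA.
  by apply: element_matches => //; [rewrite -dE | exact: perm_chain].
split=> //.
  move=> y Hy; rewrite N5; case: (y =P i) => [->|ne]; first by rewrite eqxx.
  by rewrite ifF; [apply: near | apply/eqP]; clear -Hy ne HB'; lia.
move=> y Hy; have := clm4 y; rewrite /climbed N5 ifF ?Fa //; last by apply/eqP; clear -Hy HB'; lia.
by apply; clear -Hy; lia.
Qed.

Definition between (a b : nat) : seq nat := [seq j <- matches k P Q | a < j <= b].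

Lemma between_nil a : between a a = [::].
Proof. by rewrite /between (eq_filter (a2 := pred0)) ?filter_pred0 // => j /=; lia. Qed.

Lemma between_cat a b c : a <= b <= c -> perm_eq (between a b ++ between b c) (between a c).
Proof.
move=> Habc; apply/permP => p; rewrite count_cat /between.
move: (matches k P Q) => l; rewrite !count_filter; elim: l => //= j l IH.
have -> : (p j && (a < j <= c) : nat) = (p j && (a < j <= b)) + (p j && (b < j <= c)).
  by case: (p j) => //=; lia.
by move: IH; lia.
Qed.

Lemma size_between a b c : a <= b <= c ->
  size (between a c) = size (between a b) + size (between b c).
Proof. by move=> /between_cat/perm_size <-; rewrite size_cat. Qed.

Lemma between_all : between 0 (start Z n.+1) = matches k P Q.
Proof.
apply/all_filterP/allP => j; rewrite mem_matches /start text_decompress.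
by case/andP.
Qed.

Definition c_block : hcmd :=
  rE ::= $rB :+ $rBlk ;;
  (IF $rN :< $rE THEN rE ::= $rN :+ #1 ELSE HSkip) ;;
  c_init ;; c_pass ;;
  rI ::= $rB ;;
  (WHILE $rI :< $rE DO c_element) ;;
  rB ::= $rE.

(** The cost of an element, reported matches apart. *)
Definition elt_cost : nat := 2600 * h + 480 * aT + 3100.

Lemma block_spec st b B E : env st -> records st B -> vars st rB = B -> vars st rV = start Z B ->
  B = 1 + b * N -> B <= n -> E = minn (B + N) n.+1 ->
  wp c_block (fun st' _ => [/\ env st' /\ records st' E, vars st' rB = E, vars st' rV = start Z E &
      exists o, outs st' = outs st ++ o /\ perm_eq o (between (start Z B) (start Z E))])
    st (b.+1 * (1200 * N + 300) + 200 * N + 400 + (E - B) * elt_cost +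
        80 * size (between (start Z B) (start Z E))).
Proof.
move=> Henv Hrec stB stV BE Bn EE; rewrite /c_block.
have [stM stN stK [stH stL] stBlk] := Henv.
have [BE1 BE2 BE3] : [/\ B < E, E <= B + N & E <= n.+1] by split; lia.
have B0 : 0 < B by lia.
set G := b.+1 * _; set D := (E - B) * _; set s0 := size (between _ _).
have {}EE : id (E = minn (B + N) n.+1) by [].
wps.
apply: (wp_use (n := 30) (P := fun st' => vars st' rE = E)).
- wpifb c1; rewrite stN stB stBlk in c1; wps; rewrite /id in EE; rewrite ?stN ?stB ?stBlk; lia.
- lia.
move=> st1 b1 E1 F1 le_b1.
have Henv1 : env st1 by apply: env_frame F1 _ _.
have Hrec1 : records st1 B by apply: records_frame F1 _ _.
have [Fv _ Fo] := F1; have := Fv rB isT; have := Fv rV isT; have := Fo isT; hs.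
rewrite stB stV => O1 V1 B1; clear F1 Fv Fo Henv Hrec stM stN stK stH stL stBlk stB stV.
wps.
apply: (wp_use (init_spec B1 E1 (ltnW BE1) BE2 Bn)); first by lia.
move=> st2 b2 W2 F2 le_b2.
have Henv2 : env st2 by apply: env_frame F2 _ _.
have Hrec2 : records st2 B by apply: records_frame F2 _ _.
have [Fv _ Fo] := F2; have := Fv rB isT; have := Fv rE isT; have := Fv rV isT; have := Fo isT.
rewrite O1 V1 E1 B1 => O2 V2 E2 B2; clear F2 Fv Fo Henv1 Hrec1 O1 V1 E1 B1.
have Hw2 : walkers st2 B E E.
  move=> j Hj; have [-> -> [-> ->] [-> ->] ->] := W2 j Hj; apply: walker_init; lia.
wps.
apply: (wp_use (pass_spec Henv2 B2 E2 BE BE1 BE2 BE3 Hrec2 Hw2)); first by rewrite -/G; lia.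
rewrite -/G; move=> st3 b3 W3 F3 le_b3.
have Henv3 : env st3 by apply: env_frame F3 _ _.
have Hrec3 : records st3 B by apply: records_frame F3 _ _.
have [Fv _ Fo] := F3; have := Fv rB isT; have := Fv rE isT; have := Fv rV isT; have := Fo isT.
rewrite O2 V2 E2 B2 => O3 V3 E3 B3; clear F3 Fv Fo Henv2 Hrec2 O2 V2 E2 B2 Hw2 W2.
have {le_b1 le_b2} le_b3 : D + 80 * s0 + 100 <= b3 by clear -BE BE2 le_b1 le_b2 le_b3; lia.
wps.
pose I st' b' := exists i, [/\ in_block st' B E i, B <= i <= E,
  exists o, outs st' = outs st ++ o /\ perm_eq o (between (start Z B) (start Z i)) &
  (E - i) * elt_cost + 80 * size (between (start Z i) (start Z E)) + 20 <= b'].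
apply: (wp_use (n := D + 80 * s0 + 20) (P := fun st' => in_block st' B E E /\
  exists o, outs st' = outs st ++ o /\ perm_eq o (between (start Z B) (start Z E)))).
- clear le_b3; apply: (wp_loop (I := I)).
    exists B; split=> //; [|by lia|by exists [::]; rewrite cats0 between_nil -O3].
    split=> //=; [by lia|].
    move=> y Hy; have := W3 (y - B); rewrite /climbed subnKC; [apply; lia | lia].
  move=> st' b' _ [i [Hin Hi [o [Oo Po]] le_b]].
  have [[Henv' _] [B' E' I'] V' _ _] := Hin.
  split; first by sides.
  hs; rewrite I' E'; case: ifP => lti; last first.
    have iE : i = E by lia.
    by rewrite iE in Hin Po; split; [lia | split=> //; exists o].
  have ltiE : i < E by lia.
  have Hs : start Z i <= start Z i.+1 <= start Z E by rewrite !start_le //; lia.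
  exists (2600 * h + 480 * aT + 3000 + 80 * size (between (start Z i) (start Z i.+1))).
  exists ((E - i.+1) * elt_cost + 80 * size (between (start Z i.+1) (start Z E)) + 20); split.
    move: le_b; rewrite (size_between Hs) -(subnSK ltiE) mulSn /elt_cost; clear; lia.
  have HBi : 0 < B <= i by lia.
  apply: wp_mono (element_spec Hin HBi ltiE BE3 BE2) => st4 b4 [Hin4 [o4 [O4 P4]]].
  exists i.+1; split=> //; first by lia.
  exists (o ++ o4); split; first by rewrite O4 Oo catA.
  apply: perm_trans (between_cat (b := start Z i) _); last by rewrite !start_le //; lia.
  exact: perm_cat.
- by lia.
move=> st4 b4 [[[Henv4 Hrec4] [B4 E4 I4] V4 _ _] H4] _ le_b4.
by wps; split; hs => //; rewrite ?E4.
Qed.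

Definition c_blocks : hcmd :=
  rV ::= #0 ;; rRec ::= #0 ;; rB ::= #1 ;;
  WHILE $rB :< ($rN :+ #1) DO c_block.

Lemma blocks_spec st nb : env st -> outs st = [::] -> n <= nb * N ->
  wp c_blocks (fun st' _ => perm_eq (outs st') (matches k P Q))
    st (nb * (nb * (1200 * N + 300) + 200 * N + 430) + n * elt_cost +
        80 * size (matches k P Q) + 60).
Proof.
move=> Henv O0 Hnb; rewrite /c_blocks.
have [stM stN stK [stH stL] stBlk] := Henv.
set G := nb * (1200 * N + 300) + _ + _.
set s0 := size _; have [D DE] : exists D, id (D = nb * G + n * elt_cost) by eexists.
rewrite -[_ * _ + _ * _]DE.
have {}Hnb : id (n <= nb * N) by [].
wps.
rewrite /id in DE Hnb.
apply: (@wp_weaken _ _ _ _ _ _ _ _ _ _ (D + 80 * s0 + 20)); last by lia.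
pose I st' b' := exists b B, [/\ env st' /\ records st' B, vars st' rB = B /\ vars st' rV = start Z B,
  B = minn (1 + b * N) n.+1 /\ b <= nb, perm_eq (outs st') (between 0 (start Z B)) &
  (nb - b) * G + (n.+1 - B) * elt_cost + 80 * size (between (start Z B) (start Z n.+1)) + 20 <= b'].
have start1 : start Z 1 = 0 by rewrite /start text1.
apply: (wp_loop (I := I)).
  exists 0, 1; rewrite start1 between_nil between_all; split=> //.
  - by split=> //; split=> //= y; lia.
  - by lia.
  - by rewrite /= O0.
  - by rewrite subn0 subn1 /= -DE.
move=> st' b' _ [b [B [[Henv' Hrec] [stB stV] [BE le_b] Po le_b']]].
have [_ stN' _ _ _] := Henv'.
split; first by sides.
hs; rewrite stN' stB; case: ifP => ltB; last first.
  have E : B = n.+1 by lia.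
  by rewrite E between_all in Po; split; [lia | exact: Po].
have Bn : B <= n by lia.
have {}BE : B = 1 + b * N by lia.
have ltb : b < nb.
  rewrite ltnNge; apply/negP => H; have : nb * N <= b * N by rewrite leq_mul2r H orbT.
  by lia.
pose E := minn (B + N) n.+1.
have BEn : B <= E <= n.+1 by rewrite /E; lia.
have Hs : start Z B <= start Z E <= start Z n.+1 by rewrite !start_le //; lia.
have Gle : b.+1 * (1200 * N + 300) + 200 * N + 400 + 30 <= G.
  by rewrite /G; have : b.+1 * (1200 * N + 300) <= nb * (1200 * N + 300) by [rewrite leq_mul2r ltb orbT]; clear; lia.
eexists; exists ((nb - b.+1) * G + (n.+1 - E) * elt_cost + 80 * size (between (start Z E) (start Z n.+1)) + 20).
split; last first.
  apply: wp_mono (block_spec Henv' Hrec stB stV BE Bn erefl) => st2 _ [? ? ? [o [Oo Po']]].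
  exists b.+1, E; split=> //; first by split=> //; rewrite /E BE mulSn; lia.
  rewrite Oo; apply: perm_trans (between_cat (b := start Z B) _); last by rewrite start_le //; lia.
  exact: perm_cat.
move: le_b'; rewrite (size_between Hs) -(subnSK ltb) mulSn.
have -> : n.+1 - B = (E - B) + (n.+1 - E) by lia.
by rewrite mulnDl -/E /=; move: Gle; clear; lia.
Qed.

End Program.

Definition c_all : hcmd :=
  rV ::= #0 ;; rI ::= #1 ;;
  WHILE $rI :< ($rN :+ #1) DO (
    rY ::= eref $rI ;;
    (IF $rY THEN rLen ::= aAcc@[$rY :- #1] :+ #1 ELSE rLen ::= #1) ;;
    aAcc@[$rI :- #1] ::= $rLen ;;
    (WHILE $rLen DO (rV ::= $rV :+ #1 ;; HEmit $rV ;; rLen ::= $rLen :- #1)) ;;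
    rI ::= $rI :+ #1).

Section AllPositions.

Variables (W : nat) (inp : seq nat) (cap : nat).
Variables (ainp : seq nat -> Prop) (aT aS : nat) (apost : seq nat -> seq nat -> Prop).
Variables (m : nat) (Z : zl_string).

Let n := size Z.
Let u := size (decompress Z).

Hypothesis W_big : 100 * (n + m + u + 10) < W.
Hypothesis Z_ok : forall i, 0 < i <= size Z -> reference Z i < i.
Hypothesis inp_ref : forall i, 0 < i <= n -> nth 0 inp (m + 2 + 2 * i) = reference Z i.
Hypothesis n_cap : n <= cap.

Notation wp := (wp W inp cap ainp aT aS apost).

Lemma all_spec st : vars st rM = m -> vars st rN = n -> outs st = [::] ->
  wp c_all (fun st' _ => outs st' = iota 1 u) st (200 * n + 60 * u + 60).
Proof.
move=> stM stN O0; rewrite /c_all.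
wps.
apply: (@wp_weaken _ _ _ _ _ _ _ _ _ _ (200 * n + 60 * u + 30)); last by lia.
pose I st' b := exists i, [/\ vars st' rI = i, vars st' rV = start Z i, 0 < i <= n.+1,
  outs st' = iota 1 (start Z i) /\ 200 * (n.+1 - i) + 60 * (u - start Z i) + 30 <= b &
  forall y, 0 < y < i -> arrs st' aAcc (y - 1) = len Z y].
have start1 : start Z 1 = 0 by rewrite /start text1.
apply: (wp_loop (I := I)).
  by exists 1; rewrite start1 /= O0; split=> //; [split=> //; lia | move=> y; lia].
move=> st' b [Fv _ _] [i [EI EV Hi [EO le_b] Hacc]].
have := Fv rM isT; have := Fv rN isT; hs; rewrite stM stN => sN sM; clear Fv stM stN O0 st.
split; first by sides.
hs; rewrite EI sN; case: ifP => lti; last first.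
  have iE : i = n.+1 by lia.
  by split; [lia | rewrite EO iE /start text_decompress].
have Hin : 0 < i <= n by lia.
have Hin' : i <= n by lia.
have Hs : start Z i + len Z i <= u by rewrite -size_text //; apply: start_le_size; lia.
have refE := inp_ref Hin; rewrite -sM -EI in refE; have lt_r := Z_ok Hin.
have lenE' := lenE Z_ok Hin.
have lenn : len Z i <= n by apply: leq_trans (len_le Z_ok _) _.
have szE := size_text Hin'.
exists (150 + 60 * len Z i), (200 * (n.+1 - i.+1) + 60 * (u - start Z i.+1) + 30).
split; first by rewrite szE; lia.
have acc_r : reference Z i != 0 -> arrs st' aAcc (reference Z i - 1) = len Z (reference Z i).
  by move=> r0; apply: Hacc; lia.
wps; rewrite refE EI.
apply: (wp_use (n := 40) (P := fun st1 => vars st1 rLen = len Z i)).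
- wpif c1; first by have c1' := acc_r c1; have lr : reference Z i - 1 < cap by [lia]; wps; rewrite c1'; lia.
  by wps; rewrite lenE' c1 len0.
- by lia.
move=> st1 b1 L1 [Fv Fa Fo] le_b1.
have := Fv rI isT; have := Fv rV isT; have := Fv rM isT; have := Fv rN isT; have := Fa aAcc isT; have := Fo isT; hs.
rewrite EI EV sM sN EO => O1 A1 N1 M1 V1 I1; clear Fv Fa Fo acc_r.
have icap : vars st1 rI - 1 < cap by lia.
wps; rewrite I1 L1.
set st2 := seta _ _ _ _.
apply: (wp_use (n := 60 * len Z i + 10) (P := fun st3 => outs st3 = iota 1 (start Z i.+1) /\ vars st3 rV = start Z i.+1)).
- clear le_b le_b1 Hacc A1 N1 M1 lenn lenE' Hs; apply: (wp_loop (I := fun st3 b3 => exists q, [/\ vars st3 rLen = q, q <= len Z i,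
      vars st3 rV = start Z i.+1 - q, outs st3 = iota 1 (start Z i.+1 - q) & 60 * q + 10 <= b3])).
    by exists (len Z i); rewrite /= L1 V1 O1 szE addnK.
  have szE' : len Z i <= start Z i.+1 by rewrite szE; apply: leq_addl.
  have Su : start Z i.+1 <= u by apply: start_le_size.
  move: (start Z i.+1) (len Z i) szE' Su => a c ca au.
  clear -W_big ca au.
  move=> st3 b3 _ [q [EQ Hq EV3 EO3 le_b3]].
  split; first by sides.
  hs; rewrite EQ; case: ifP => [q0|/negbFE/eqP q0]; last first.
    by rewrite EO3 EV3 q0 subn0; split; [lia |].
  exists 40, (60 * q.-1 + 10); split; first by lia.
  have vE : vars st3 rV + 1 = a - q.-1 by clear -EV3 q0 Hq ca; lia.
  wps; rewrite vE; exists q.-1; split=> //; try lia.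
  have -> : a - q.-1 = (a - q) + 1 by clear -q0 Hq ca; lia.
  by rewrite iotaD cats1 EO3 /=; f_equal; clear -q0 Hq ca; lia.
- by lia.
move=> st3 b3 [O3 V3] [Fv Fa _] le_b3.
have := Fv rI isT; have := Fa aAcc isT; rewrite /st2; hs; rewrite I1 A1 => A3 I3; clear Fv Fa.
have W1 : i + 1 < W by clear -W_big Hin; lia.
have {le_b1} le_b3 : 20 <= b3 by clear -le_b1 le_b3; lia.
wps; exists i.+1; hs; rewrite I3 addn1; split=> //; try by [lia | split=> //; lia].
move=> y Hy; rewrite A3; case: (y =P i) => [->|ne]; first by rewrite eqxx.
by rewrite ifF; [apply: Hacc | apply/eqP]; clear -Hy ne Hi; lia.
Qed.

End AllPositions.

Definition c_top : hcmd :=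
  rM ::= ERd #0 ;; rN ::= ERd #1 ;; rK ::= ERd #2 ;; rTau ::= ERd #3 ;;
  IF $rK :< $rM THEN (
    rH ::= $rM :+ $rK ;; rL ::= #2 :** $rH ;; rBlk ::= $rN :/ $rTau ;;
    (IF $rBlk THEN HSkip ELSE rBlk ::= #1) ;;
    c_blocks)
  ELSE IF $rK THEN c_all ELSE HSkip.

Lemma nth_pairs (Z : zl_string) j : j < size Z ->
  nth 0 (flatten [seq [:: z.1; z.2] | z <- Z]) (2 * j) = (nth (0, 0) Z j).1 /\
  nth 0 (flatten [seq [:: z.1; z.2] | z <- Z]) (2 * j).+1 = (nth (0, 0) Z j).2.
Proof.
elim: Z j => //= z Z IH [|j] // lt_j.
have -> : 2 * j.+1 = (2 * j).+2 by lia.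
exact: IH.
Qed.

Lemma size_pairs (Z : zl_string) : size (flatten [seq [:: z.1; z.2] | z <- Z]) = 2 * size Z.
Proof. by elim: Z => //= z Z ->; lia. Qed.

Section Input.

Variables (k tau : nat) (P : seq nat) (Z : zl_string).
Let inp := zl78_input k tau P Z.

Lemma size_input : size inp = 4 + size P + 2 * size Z.
Proof. by rewrite /inp /zl78_input !size_cat size_pairs. Qed.

Lemma input_pat j : j < size P -> nth 0 inp (4 + j) = nth 0 P j.
Proof. by move=> lt_j; rewrite /inp /zl78_input /= nth_cat lt_j. Qed.

Lemma input_node i : 0 < i <= size Z ->
  nth 0 inp (size P + 2 + 2 * i) = reference Z i /\ nth 0 inp (size P + 3 + 2 * i) = letter Z i.
Proof.
case: i => // i Hi; have [E1 E2] := nth_pairs (Z := Z) (j := i) Hi.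
have -> : size P + 2 + 2 * i.+1 = 4 + (size P + 2 * i) by lia.
have -> : size P + 3 + 2 * i.+1 = 4 + (size P + (2 * i).+1) by lia.
rewrite /inp /zl78_input /= !nth_cat !ifN -?leqNgt ?leq_addr //.
by rewrite !add0n !addKn E1 E2.
Qed.

Lemma input_max i : nth 0 inp i <= \max_(x <- inp) x.
Proof.
case: (ltnP i (size inp)) => lt_i; last by rewrite nth_default.
by apply: (leq_bigmax_seq (P := xpredT)) => //; exact: mem_nth.
Qed.

Lemma phrases_max (b : nat) : (forall i, 0 < i <= size Z -> reference Z i < i) ->
  (forall i, 0 < i <= size Z -> letter Z i <= b) -> all (fun x => x <= b) (decompress Z).
Proof.
move=> Z_ok le_b.
have ph i : i <= size Z -> all (fun x => x <= b) (phrase Z i).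
  have [n] := ubnP i; elim: n i => // n IH [|i] lti Hi; first by rewrite phrase0.
  rewrite phraseE // all_rcons le_b //=; apply: IH; have := @Z_ok i.+1 Hi; lia.
apply/allP => x /flattenP[X /(nthP [::])[i]]; rewrite size_phrases ltnS => Hi <- xi.
exact: (allP (ph i Hi)).
Qed.

End Input.

Lemma text_input_inj k P S S' : text_input k P S = text_input k P S' -> S = S'.
Proof. by case=> _ /eqP; rewrite eqseq_cat // => /andP[_ /eqP]. Qed.

Lemma runs_weaken w c inp (T S : rat) (p q : seq nat -> Prop) :
  (forall o, p o -> q o) -> runs w c inp T S p -> runs w c inp T S q.
Proof. by move=> pq H st0 /H[? ? H3]; split=> // st r s; apply: pq; exact: H3. Qed.

Lemma wp_runs w inp cap A ainp aT aS apost c Q b (T S : rat) :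
  16 * cap < 2 ^ w -> 16 < 2 ^ w -> (forall i, nth 0 inp i < 2 ^ w) ->
  (forall I, ainp I -> runs w A I aT%:R aS%:R (apost I) /\ forall i, nth 0 I i < 2 ^ w) ->
  (forall st, outs st = [::] -> wp (2 ^ w) inp cap ainp aT aS apost c (fun st' _ => Q (outs st')) st b) ->
  (b%:R <= T)%R -> ((16 * cap)%:R <= S)%R -> runs w (comp A c) inp T S Q.
Proof.
move=> cap_lt w_gt inp_lt HA Hwp bT capS; apply: (safe_runs (cap := 16 * cap)) => // f st0 ini.
apply: safe_weaken bT _; rewrite -[b%:R%R]addr0.
case: st0 ini => ks r m p o [/= ->] Hr Hm -> ->.
pose h := HState (fun x => r (3 * x + 1)) (fun al x => m (16 * x + al)) [::] (fun x => r (3 * x + 2)).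
apply: (sound cap_lt w_gt inp_lt HA (Hwp h erefl)) => //.
move=> f' h' b' r' m' p' o' _ HQ R.
have [_ _ _ _ [ple oE]] := R.
case: f' => [|f']; split=> //=; try by rewrite addr_ge0.
all: by split=> // _; rewrite oE.
Qed.

Lemma top_prefix W inp cap ainp aT aS apost k tau P Z Q b st : inp = zl78_input k tau P Z ->
  3 < W ->
  (forall st', [/\ vars st' rM = size P, vars st' rN = size Z, vars st' rK = k & vars st' rTau = tau] ->
     outs st' = outs st ->
     wp W inp cap ainp aT aS apost
       (IF $rK :< $rM THEN (
          rH ::= $rM :+ $rK ;; rL ::= #2 :** $rH ;; rBlk ::= $rN :/ $rTau ;;
          (IF $rBlk THEN HSkip ELSE rBlk ::= #1) ;;
          c_blocks)
        ELSE IF $rK THEN c_all ELSE HSkip) Q st' b) ->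
  wp W inp cap ainp aT aS apost c_top Q st (b + 24).
Proof.
move=> -> W3 H; rewrite /c_top.
by wps; rewrite (_ : b + 24 - _ - _ - _ - _ - _ - _ - _ - _ = b); [apply: H | lia].
Qed.

Section Cases.

Variables (k tau : nat) (P : seq nat) (Z : zl_string).
Hypothesis Z_ok : forall i, 0 < i <= size Z -> reference Z i < i.

Let inp := zl78_input k tau P Z.
Let n := size Z.
Let m := size P.
Let h := m + k.
Let Q := decompress Z.
Let occ := size (matches k P Q).

Variables (W : nat) (cap : nat).
Variables (ainp : seq nat -> Prop) (aT aS : nat) (apost : seq nat -> seq nat -> Prop).
Notation wp := (wp W inp cap ainp aT aS apost).
Notation post := (fun st' _ => perm_eq (outs st') (matches k P Q)).

Lemma all_match_spec st : k < W -> 100 * (n + m + size Q + 10) < W -> n <= cap ->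
  maxn 1 m <= k -> outs st = [::] ->
  wp c_top post st (200 * n + 60 * size Q + 100).
Proof.
move=> kW W_big n_cap mk O0.
rewrite (_ : 200 * n + 60 * size Q + 100 = 200 * n + 60 * size Q + 76 + 24); last by lia.
apply: (@top_prefix _ _ _ _ _ _ _ k tau P Z) => //; first by lia.
move=> st' [sM sN sK sT] O1.
wpifb c1; first by lia.
wpif c2; last by lia.
apply: (wp_use (n := 200 * n + 60 * size Q + 60) (P := fun st2 => outs st2 = iota 1 (size Q))).
- apply: (all_spec ainp aT aS apost W_big Z_ok _ n_cap sM sN); last by rewrite O1.
  by move=> i Hi; have [] := input_node k tau P Hi.
- by lia.
by move=> st2 b2 -> _ _; rewrite matches_all.
Qed.

Lemma no_match_spec st : 100 < W -> k = 0 -> P = [::] -> outs st = [::] -> wp c_top post st 60.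
Proof.
move=> W_big k0 P0 O0; rewrite (_ : 60 = 36 + 24) //.
apply: (@top_prefix _ _ _ _ _ _ _ k tau P Z) => //; first by lia.
move=> st' [sM sN sK sT] O1.
wpifb c1; first by rewrite sM P0 ltn0 in c1.
wpif c2; first by rewrite sK k0 in c2.
by wps; rewrite matches_nil // O1 O0.
Qed.

Let N := maxn 1 (n %/ tau).

Lemma main_spec (Sigma : pred nat) nb st :
  100 * (n + m + k + N + cap + size Q + 10) < W -> N <= cap -> 2 * h <= cap -> aS <= cap ->
  occ <= cap -> k < m -> n <= nb * N ->
  all Sigma Q -> all Sigma P ->
  (forall S, all Sigma S -> size S = 2 * h -> ainp (text_input k P S)) ->
  (forall S o, size S = 2 * h -> apost (text_input k P S) o -> perm_eq o (matches k P S)) ->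
  outs st = [::] ->
  wp c_top post st (nb * (nb * (1200 * N + 300) + 200 * N + 430) + n * elt_cost aT k P + 80 * occ + 200).
Proof.
move=> W_big N_cap h_cap aS_cap occ_cap km Hnb SQ SP HI HO O0.
pose T0 := nb * (nb * (1200 * N + 300) + 200 * N + 430) + n * elt_cost aT k P + 80 * occ.
have [T TE] : exists T, id (T = T0) by exists T0.
rewrite -[nb * _ + _ + _]TE (_ : T + 200 = T + 176 + 24); last by lia.
have {}Hnb : id (n <= nb * N) by [].
apply: (@top_prefix _ _ _ _ _ _ _ k tau P Z) => //; first by lia.
move=> st' [sM sN sK sT] O1.
wpifb c1; last by lia.
wps.
apply: (wp_use (n := 10) (P := fun st2 => vars st2 rBlk = N)).
- by wpif c2; wps; rewrite /N; rewrite sN sT -/n in c2; rewrite ?sN ?sT -?/n; move: (n %/ tau) c2; clear; lia.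
- by lia.
move=> st2 b2 B2 [Fv Fa Fo] le_b2.
have := Fv rM isT; have := Fv rN isT; have := Fv rK isT; have := Fv rH isT; have := Fv rL isT; have := Fo isT; hs.
rewrite sM sN sK => Ho HL HH HK HN HM.
apply: (wp_use (n := T + 60) (P := fun st2 => perm_eq (outs st2) (matches k P Q))).
- rewrite [T]TE; apply: (blocks_spec (aS := aS) aT W_big _ _ _ _ _ _ _ _ _ SQ SP HI HO) => //.
  + by move=> i Hi; have [] := input_node k tau P Hi.
  + by move=> i Hi; have [] := input_node k tau P Hi.
  + by move=> j; exact: input_pat.
  + by rewrite /N; lia.
  + by lia.
  + by lia.
  + by rewrite Ho O1.
- by lia.
by [].
Qed.

End Cases.

(** * Resource bounds *)

Lemma block_count n tau : 0 < tau -> exists nb, let N := maxn 1 (n %/ tau) in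
  [/\ n <= nb * N, nb * N <= 2 * n & nb * (nb * N) <= 4 * (n * tau)].
Proof.
move=> tau0; case: (posnP (n %/ tau)) => [n0|n0].
  have ltn : n < tau by move: (divn_eq n tau) (ltn_pmod n tau0); rewrite n0 mul0n add0n => <-.
  exists n; rewrite n0 /= !muln1; split=> //; first by lia.
  by have : n * n <= n * tau by [rewrite leq_mul2l ltnW ?orbT]; lia.
have NE : maxn 1 (n %/ tau) = n %/ tau by lia.
have le1 := leq_divM n tau; exists (2 * tau); rewrite NE.
have le2 : 2 * tau * (n %/ tau) <= 2 * n by rewrite -mulnA leq_mul2l mulnC.
split=> //; last by apply: leq_trans (leq_mul (leqnn (2 * tau)) le2) _; lia.
have lt_n : n < (n %/ tau).+1 * tau by rewrite -ltn_divLR.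
have le3 : tau <= n %/ tau * tau by rewrite leq_pmull.
by move: lt_n; rewrite mulSn [2 * _ * _]mulnAC; lia.
Qed.

Lemma time_bound n m tau t occ N nb h : 0 < N -> h <= 2 * m -> 0 < m -> 0 < tau ->
  nb * N <= 2 * n -> nb * (nb * N) <= 4 * (n * tau) ->
  nb * (nb * (1200 * N + 300) + 200 * N + 430) + n * (2600 * h + 480 * t + 3100) + 80 * occ + 200 <=
  100 * 100 * (n * (tau + m + t) + occ + 1).
Proof.
move=> N0 hm m0 tau0 le1 le2.
have le3 : nb * (1200 * N + 300) <= 1500 * (nb * N) by nia.
have le4 : nb * (nb * (1200 * N + 300)) <= 60 * 100 * (n * tau).
  by apply: leq_trans (leq_mul (leqnn nb) le3) _; rewrite mulnCA; move: (nb * (nb * N)) (n * tau) le2 => a b; lia.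
have le5 : nb * (200 * N + 430) <= 1260 * n by nia.
have le6 : n * h <= 2 * (n * m) by nia.
have le7 : n <= n * m by rewrite leq_pmulr.
lia.
Qed.

Lemma count_matches_le k P Q : size (matches k P Q) <= size Q.
Proof. by rewrite matches_ends -[X in _ <= X](size_iota 1) size_filter count_size. Qed.

Lemma input_max_mem k tau P Z : let M := \max_(x <- zl78_input k tau P Z) x in
  [/\ size P <= M, size Z <= M, k <= M, tau <= M & all (fun x => x <= M) P].
Proof.
move=> M; have le_M i : nth 0 (zl78_input k tau P Z) i <= M := input_max k tau P Z i.
split; [exact: (le_M 0) | exact: (le_M 1) | exact: (le_M 2) | exact: (le_M 3) |].
by apply/(all_nthP 0) => j /(input_pat k tau Z) <-.
Qed.

Lemma text_input_wide X e w k P S s M : X ^ (3 * e + 9) <= 2 ^ w -> 6 <= X ->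
  6 + size P + M + s <= X -> size P <= M -> k <= M -> size S = 2 * (size P + k) ->
  all (fun x => x <= M) P -> all (fun x => x <= M) S ->
  wide e w (text_input k P S) s /\ forall i, nth 0 (text_input k P S) i < 2 ^ w.
Proof.
move=> Xw X6 leX mM kM sS PM SM.
have mem_le x : x \in text_input k P S -> x <= 4 * M.
  rewrite /text_input mem_cat !inE sS mem_cat => /orP[/or3P[/eqP->|/eqP->|/eqP->]|/orP[xP|xS]]; try lia.
    by have := allP PM x xP; lia.
  by have := allP SM x xS; lia.
have [Y YE] : exists Y, Y = X ^ 2 by exists (X ^ 2).
have X2 : 6 * X <= Y by rewrite YE -mulnn leq_mul2r X6 orbT.
split; last first.
  move=> i; apply: (@leq_trans Y); last by rewrite YE; apply: leq_trans Xw; apply: leq_pexp2l; lia.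
  case: (ltnP i (size (text_input k P S))) => Hi; last by rewrite nth_default //; lia.
  by apply: leq_ltn_trans (mem_le _ (mem_nth 0 Hi)) _; lia.
have maxI : \max_(x <- text_input k P S) x <= 4 * M.
  by apply/bigmax_leqP_seq => x xI _; exact: mem_le.
apply: leq_trans Xw; apply: (@leq_trans ((X ^ 3) ^ e.+1)); last by rewrite -expnM; apply: leq_pexp2l; lia.
rewrite leq_exp2r //.
rewrite expnS -YE; have X3 : 6 * Y <= X * Y by rewrite leq_mul2r X6 orbT.
have -> : size (text_input k P S) = 3 + size P + size S by rewrite !size_cat addnA.
by move: (\max_(x <- _) x) (X * Y) maxI X3 => maxT X3 ? ?; lia.
Qed.

Lemma space_bound c d n tau x y z : 0 < tau -> d <= c * (n %/ tau + x + y + z) ->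
  (d%:R <= c%:R * (n%:R / tau%:R + x%:R + y%:R + z%:R) :> rat)%R.
Proof.
move=> tau0; rewrite -(ler_nat rat) => /le_trans; apply.
rewrite natrM !natrD ler_wpM2l ?ler0n // !lerD2r ler_pdivlMr ?ltr0n // -natrM ler_nat.
exact: leq_divM.
Qed.

Theorem theorem1 (Sigma : pred nat) (A : cmd) (eA : nat)
    (t s : nat -> nat -> nat -> nat)
    (hA : solves_matching Sigma A eA t s) :
  exists (B : cmd) (eB c : nat),
    forall (w k tau : nat) (Q P : seq nat) (Z : zl_string),
      all Sigma Q -> all Sigma P -> zl78 Q Z -> 1 <= tau ->
      let n := size Z in
      let m := size P in
      let l := 2 * m + 2 * k in
      let occ := size (matches k P Q) in
      wide eB w (zl78_input k tau P Z) (s m l k) ->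
      runs w B (zl78_input k tau P Z)
        (c * (n * (tau + m + t m l k) + occ + 1))%N%:R%R
        (c%:R * (n%:R / tau%:R + m%:R + (s m l k)%:R + occ%:R))%R
        (fun o => perm_eq o (matches k P Q)).
Proof.
exists (comp A c_top), (3 * eA + 8), (100 * 100) => w k tau Q P Z SQ SP [dQ hZ] tau0 n m l occ.
have Z_ok i : 0 < i <= size Z -> reference Z i < i by move=> /hZ[].
subst Q; set inp := zl78_input k tau P Z; set M := \max_(x <- inp) x.
rewrite /wide -/M size_input -/m -/n -addnS => Xw.
have [X XE] : exists X, X = 2 + (4 + m + 2 * n) + M + s m l k by eexists.
rewrite -XE in Xw.
have [mM nM kM tauM PM] := input_max_mem k tau P Z; rewrite -/inp -/M -/m -/n in mM nM kM tauM PM.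
have nX : n <= X by lia.
have leX : 6 + m + M + s m l k <= X by lia.
have X6 : 6 <= X by lia.
set u := size (decompress Z).
have uX : u <= X * X.
  rewrite /u -text_decompress; apply: leq_trans (start_leq Z_ok _) _ => //.
  by apply: leq_mul => //; lia.
have occ_u : occ <= u := count_matches_le _ _ _.
have W6 : X ^ 6 <= 2 ^ w by apply: leq_trans Xw; apply: leq_pexp2l; lia.
have inp_lt i : nth 0 inp i < 2 ^ w.
  apply: leq_ltn_trans (input_max k tau P Z i) _; apply: (@leq_trans X); first by rewrite -/inp -/M XE; lia.
  by apply: leq_trans W6; rewrite -{1}(expn1 X) leq_pexp2l //; lia.
have W_big : 1296 * (X * X) <= 2 ^ w.
  apply: leq_trans W6; rewrite (expnD X 4 2) mulnn leq_mul2r -[1296]/(6 ^ 4) leq_exp2r //.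
  by rewrite X6 orbT.
have X2 : 6 * X <= X * X by rewrite leq_mul2r X6 orbT.
have [W WE] : exists W, W = 2 ^ w by eexists.
have [XX XXE] : exists XX, XX = X * X by eexists.
rewrite -XXE -?WE in uX W6 W_big X2.
case: (ltnP k m) => [km|mk].
  have lE : l = 2 * (m + k) by rewrite /l mulnDr.
  pose M_le := fun x => x <= M; pose Sigma' := predI Sigma M_le.
  pose N := maxn 1 (n %/ tau).
  have [cap capE] : exists cap, cap = N + 2 * (m + k) + s m l k + occ by eexists.
  have [nb [nb1 nb2 nb3]] := block_count n tau0; rewrite -/N in nb1 nb2 nb3.
  have Nn : N <= n.+1 by have := leq_div n tau; rewrite /N; lia.
  have SQ' : all Sigma' (decompress Z).
    rewrite all_predI SQ; apply: phrases_max => // i Hi.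
    by have [_ <-] := input_node k tau P Hi; exact: input_max.
  have SP' : all Sigma' P by rewrite all_predI SP.
  pose ainp I := exists S, [/\ I = text_input k P S, all Sigma' S & size S = 2 * (m + k)].
  pose apost I o := exists2 S, I = text_input k P S & perm_eq o (matches k P S).
  have HA I : ainp I -> runs w A I (t m l k)%:R%R (s m l k)%:R%R (apost I) /\ forall i, nth 0 I i < 2 ^ w.
    case=> S [-> SS sS]; move: SS; rewrite all_predI => /andP[SS SM].
    have [wA ltA] : wide eA w (text_input k P S) (s m l k) /\ forall i, nth 0 (text_input k P S) i < 2 ^ w.
      exact: text_input_wide Xw X6 leX mM kM sS PM SM.
    split=> //; rewrite lE -sS; rewrite lE -sS in wA.
    by apply: runs_weaken (hA _ _ _ _ SP SS wA) => o /andP[_ po]; exists S.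
  have Hw : 100 * (n + m + k + N + cap + u + 10) < W by lia.
  apply: (wp_runs (cap := cap) _ _ inp_lt HA).
  - by rewrite -WE; lia.
  - by rewrite -WE; lia.
  - move=> st O0; rewrite -WE; apply: (main_spec Z_ok (t m l k) Hw _ _ _ _ km nb1 SQ' SP' _ _ O0).
    1-4: by rewrite capE -?/n -?/m -?/N -?/occ; lia.
    + by move=> S SS sS; exists S.
    + by move=> S o sS [S' /text_input_inj <-].
  - rewrite ler_nat.
    by apply: time_bound nb2 nb3; rewrite -?/m -?/n /N //; lia.
  apply: space_bound => //; rewrite capE /N.
  by move: (n %/ tau) (s m l k) => q; lia.
case: (posnP k) => [k0|k0].
  have P0 : P = [::] by apply/nilP; rewrite /nilp -/m; lia.
  apply: (wp_runs (cap := 0) (ainp := fun _ => False) (aT := 0) (aS := 0) (apost := fun _ _ => True) _ _ inp_lt).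
  - by rewrite -WE; lia.
  - by rewrite -WE; lia.
  - by [].
  - by move=> st O0; apply: no_match_spec => //; rewrite -WE; lia.
  - by rewrite ler_nat; lia.
  by apply: space_bound; rewrite ?muln0.
have occE : occ = u by rewrite /occ matches_all ?size_iota // -/m; lia.
have nu : n <= u by rewrite /u -text_decompress; exact: (leq_start Z_ok (leqnn n)).
apply: (wp_runs (cap := n) (ainp := fun _ => False) (aT := 0) (aS := 0) (apost := fun _ _ => True) _ _ inp_lt).
- by rewrite -WE; lia.
- by rewrite -WE; lia.
- by [].
- by move=> st O0; apply: all_match_spec => //; rewrite -?WE -/n -/m -/u; lia.
- by rewrite ler_nat occE -/n; lia.
by apply: space_bound => //; rewrite occE; move: (_ %/ _) (s _ _ _) => ? ?; lia.
Qed.
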